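(* The vertex set $\{0,1\}^4$ of the $4$-dimensional cube $[0,1]^4$ admits exactly $92\,487\,256$ triangulations, partitioned into exactly $247\,451$ symmetry classes.
   Context: A triangulation of a finite set $\mathcal{A}\subset\mathbb{R}^4$ is a set $T$ of affinely independent subsets of $\mathcal{A}$ (its faces) whose convex hulls form a polyhedral complex (closed under taking faces, the empty set included, and any two convex hulls intersect in a common face), and such that the union of these convex hulls is $\mathrm{conv}(\mathcal{A})$. Symmetry classes are the orbits of triangulations of $\{0,1\}^4$ under the group of isometries of $\mathbb{R}^4$ that map the cube $[0,1]^4$ to itself. *)

(* Defs.v *)
From HB Require Import structures.
From mathcomp Require Import all_boot all_order all_algebra finmap.
From mathcomp Require Import all_classical reals convex.

Set Implicit Arguments.
Unset Strict Implicit.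
Unset Printing Implicit Defensive.

Import Order.TTheory GRing.Theory Num.Theory.
Local Open Scope classical_set_scope.
Local Open Scope ring_scope.

Section Triangulations.
Variables (R : realType) (V : lmodType R).

Definition convex_hull (A : set V) : set V := smallest (@convex_set R V) A.

Definition affinely_independent (F : {fset V}) : Prop :=
  forall w : V -> R,
    \sum_(v <- F) w v = 0 -> \sum_(v <- F) w v *: v = 0 ->
    forall v, v \in F -> w v = 0.

Definition polytope (P : set V) : Prop :=
  exists F : {fset V}, P = convex_hull [set` F].

(* [f] may be zero, so the empty set and [P] itself are faces of [P]. *)
Definition faces (P : set V) : set (set V) :=
  [set Q | exists (f : {scalar V}) (b : R),
     (forall x, P x -> f x <= b) /\ Q = P `&` [set x | f x = b]].

Definition polyhedral_complex (K : set (set V)) : Prop :=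
  [/\ K `<=` polytope,
      K set0,
      forall P, K P -> faces P `<=` K
    & forall P Q, K P -> K Q -> faces P (P `&` Q) /\ faces Q (P `&` Q)].

Definition triangulation (A : set V) (T : set {fset V}) : Prop :=
  [/\ forall F, T F -> [set` F] `<=` A /\ affinely_independent F,
      polyhedral_complex [set convex_hull [set` F] | F in T]
    & \bigcup_(F in T) convex_hull [set` F] = convex_hull A].

End Triangulations.

Section Cube.
Variables (R : realType) (n : nat).
Local Notation V := 'rV[R]_n.

Definition cube_vertices : set V :=
  [set x | forall i, x 0 i = 0 \/ x 0 i = 1].

Definition cube : set V := [set x | forall i, 0 <= x 0 i <= 1].

(* The library norm on row vectors is the sup norm, hence this distance. *)
Definition euclidean_dist (x y : V) : R :=
  Num.sqrt (\sum_i (x 0 i - y 0 i) ^+ 2).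

Definition cube_isometry (g : V -> V) : Prop :=
  (forall x y, euclidean_dist (g x) (g y) = euclidean_dist x y) /\
  g @` cube = cube.

Definition cube_triangulations : set (set {fset V}) :=
  [set T | triangulation cube_vertices T].

Definition move_triangulation (g : V -> V) (T : set {fset V}) : set {fset V} :=
  [set [fset g v | v in F]%fset | F in T].

Definition symmetry_class (T : set {fset V}) : set (set {fset V}) :=
  [set move_triangulation g T | g in cube_isometry].

Definition symmetry_classes : set (set (set {fset V})) :=
  [set symmetry_class T | T in cube_triangulations].

End Cube.

Arguments cube_triangulations : clear implicits.
Arguments symmetry_classes : clear implicits.

(* Main.v *)
(* A triangulation is determined by the set S of its full-dimensional simplices.
   A set S of such simplices comes from a triangulation if and only if it is
   balanced (every interior facet has as many simplices of S on either side) and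
   exactly one simplex of S contains a fixed generic point p. Indeed, along a
   generic segment the number of simplices covering the moving point changes at a
   crossed facet by the imbalance of that facet, so it is 1 everywhere; the same
   argument applied near a point to the simplices around its carrier shows that
   simplices meet in common faces.

   If P and P' are parts of S and S' with the same imbalances, each containing one
   simplex over p, then P' together with S minus P is again balanced. Hence the
   number of triangulations containing P depends only on the imbalances of P, and
   it is computed by choosing a facet where P is unbalanced, branching over the
   simplices that fit there, and memoizing. Two simplices that contain the two
   sides of an affine circuit exclude each other, which prunes the search. The
   same count with orbits of simplices in place of simplices gives the number of
   triangulations fixed by a symmetry. It is run once for each of the 20 conjugacy
   classes of the 384 symmetries, and Burnside's lemma gives the number of
   classes. *)

Require Import Defs.
From Stdlib Require Import BinPos BinNat BinInt.
From HB Require Import structures.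
From mathcomp Require Import all_boot all_order all_algebra all_fingroup finmap.
From mathcomp Require Import all_classical reals interval_inference convex.
From mathcomp Require Import zify ssrZ ring lra.

Set Implicit Arguments.
Unset Strict Implicit.
Unset Printing Implicit Defensive.

(** * Counting completions *)

(** The circuits do more than prune: every dependent 5-set of vertices contains both sides of a
    listed circuit, which a finite check confirms, so degenerate sets are certified without
    computing ranks. The point [p] has three uses. It forbids multiple coverings, it splits the
    triangulations by their only simplex over [p], and it makes the exchange of parts safe: a
    balanced list covering [p] once is automatically free of repetitions, so partial solutions can
    be handled as lists with multiplicity. For a symmetry, the starting orbit must have exactly one
    simplex over [p] and each later orbit none. The symmetries do not fix [p]; hence their action on
    triangulations is established through covering and proper intersection, not through balance and
    [p]. Conversely a triangulation in the sense of polyhedral complexes is turned into a balanced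
    set by looking just beyond the centre of each facet. *)

Inductive bitset := BEmpty | BLeaf | BNode of bitset & bitset.

Fixpoint bs_union (a b : bitset) : bitset :=
  match a, b with
  | BEmpty, _ => b
  | _, BEmpty => a
  | BNode l r, BNode l' r' => BNode (bs_union l l') (bs_union r r')
  | _, _ => a
  end.

Fixpoint bs_disjoint (a b : bitset) : bool :=
  match a with
  | BEmpty => true
  | BLeaf => if b is BLeaf then false else true
  | BNode l r =>
    if b is BNode l' r' then if bs_disjoint l l' then bs_disjoint r r' else false else true
  end.

Fixpoint bs_single (p : seq bool) : bitset :=
  match p with
  | [::] => BLeaf
  | b :: p' => if b then BNode BEmpty (bs_single p') else BNode (bs_single p') BEmpty
  end.

Fixpoint bs_mem (p : seq bool) (a : bitset) : bool :=
  match a, p with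
  | BLeaf, [::] => true
  | BNode l r, b :: p' => bs_mem p' (if b then r else l)
  | _, _ => false
  end.

(** A union never invents elements (it may lose some where a leaf meets a node), so every conflict
    that the search detects is real. *)
Lemma bs_mem_union p a b : bs_mem p (bs_union a b) -> bs_mem p a || bs_mem p b.
Proof.
elim: a b p => [|//|l IHl r IHr] [||l' r'] [|[] p] //=; rewrite ?orbF //; [exact: IHr|exact: IHl].
Qed.

Lemma bs_disjointPn a b : ~~ bs_disjoint a b -> exists p, bs_mem p a && bs_mem p b.
Proof.
elim: a b => [//||l IHl r IHr] [||l' r'] //=; first by exists [::].
by case: ifP => [_ /IHr[p H]|/negbT/IHl[p H] _]; [exists (true :: p)|exists (false :: p)].
Qed.

Lemma bs_mem_single p q : bs_mem p (bs_single q) -> p = q.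
Proof.
elim: q p => [|b q IH] [|c p] //=; first by case: b.
by case: b; case: c => //=; [move/IH->|case: p|case: p|move/IH->].
Qed.

Inductive ptrie (A : Type) := PLeaf | PNode of ptrie A & ptrie A & option A.
Arguments PLeaf {A}.

Fixpoint pt_get A (k : positive) (t : ptrie A) {struct t} : option A :=
  match t with
  | PLeaf => None
  | PNode l r v => match k with xH => v | xO k' => pt_get k' l | xI k' => pt_get k' r end
  end.

Fixpoint pt_upd A (k : positive) (f : option A -> option A) (t : ptrie A) : ptrie A :=
  match k with
  | xH => match t with PLeaf => PNode PLeaf PLeaf (f None) | PNode l r v => PNode l r (f v) end
  | xO k' => match t with
             | PLeaf => PNode (pt_upd k' f PLeaf) PLeaf None
             | PNode l r v => PNode (pt_upd k' f l) r v end
  | xI k' => match t with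
             | PLeaf => PNode PLeaf (pt_upd k' f PLeaf) None
             | PNode l r v => PNode l (pt_upd k' f r) v end
  end.

Fixpoint pos_eqb (a b : positive) : bool :=
  match a, b with
  | xH, xH => true
  | xI a', xI b' => pos_eqb a' b'
  | xO a', xO b' => pos_eqb a' b'
  | _, _ => false
  end.

Lemma pos_eqP (a b : positive) : reflect (a = b) (pos_eqb a b).
Proof.
apply: (iffP idP) => [|<-]; last by elim: a.
by elim: a b => [a IH|a IH|] [b|b|] //= /IH ->.
Qed.

Lemma pt_getLeaf A k : pt_get k (@PLeaf A) = None. Proof. by []. Qed.

Lemma pt_get_upd A k k' f (t : ptrie A) :
  pt_get k (pt_upd k' f t) = if pos_eqb k k' then f (pt_get k t) else pt_get k t.
Proof. by elim: k' k t => [k' IH|k' IH|] [k|k|] [|l r v] //=; rewrite IH. Qed.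

Definition pt_list A k (t : ptrie (seq A)) : seq A := odflt [::] (pt_get k t).

Definition pt_cons A k x (t : ptrie (seq A)) : ptrie (seq A) :=
  pt_upd k (fun o => Some (x :: odflt [::] o)) t.

Lemma pt_list_cons A k k' x (t : ptrie (seq A)) :
  pt_list k (pt_cons k' x t) = if pos_eqb k k' then x :: pt_list k t else pt_list k t.
Proof. by rewrite /pt_list pt_get_upd; case: ifP. Qed.

(* The third subtree continues with the next key of the list. *)
Inductive memo := MLeaf | MNode of memo & memo & memo & option N.

Fixpoint memo_sub (k : positive) (t : memo) {struct t} : memo :=
  match t with
  | MLeaf => MLeaf
  | MNode l r e _ => match k with xH => e | xO k' => memo_sub k' l | xI k' => memo_sub k' r end
  end.

Fixpoint memo_get (ks : seq positive) (t : memo) : option N :=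
  match ks with
  | [::] => if t is MNode _ _ _ v then v else None
  | k :: ks' => memo_get ks' (memo_sub k t)
  end.

Fixpoint memo_upd (k : positive) (f : memo -> memo) (t : memo) : memo :=
  match k with
  | xH => match t with
          | MLeaf => MNode MLeaf MLeaf (f MLeaf) None
          | MNode l r e v => MNode l r (f e) v end
  | xO k' => match t with
             | MLeaf => MNode (memo_upd k' f MLeaf) MLeaf MLeaf None
             | MNode l r e v => MNode (memo_upd k' f l) r e v end
  | xI k' => match t with
             | MLeaf => MNode MLeaf (memo_upd k' f MLeaf) MLeaf None
             | MNode l r e v => MNode l (memo_upd k' f r) e v end
  end.

Fixpoint memo_set (ks : seq positive) (n : N) (t : memo) : memo :=
  match ks with
  | [::] => match t with
            | MLeaf => MNode MLeaf MLeaf MLeaf (Some n)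
            | MNode l r e _ => MNode l r e (Some n) end
  | k :: ks' => memo_upd k (memo_set ks' n) t
  end.

Lemma memo_sub_leaf k : memo_sub k MLeaf = MLeaf. Proof. by case: k. Qed.

Lemma memo_get_leaf ks : memo_get ks MLeaf = None. Proof. by elim: ks. Qed.

Lemma memo_sub_upd k k' f t :
  memo_sub k (memo_upd k' f t) = if pos_eqb k k' then f (memo_sub k t) else memo_sub k t.
Proof.
elim: k' k t => [k' IH|k' IH|] [k|k|] [|l r e v] //=; rewrite ?IH ?memo_sub_leaf //.
Qed.

Lemma memo_get_nil_upd k f t : memo_get [::] (memo_upd k f t) = memo_get [::] t.
Proof. by case: k t => [k|k|] [|l r e v]. Qed.

Lemma memo_get_set ks ks' n t m :
  memo_get ks (memo_set ks' n t) = Some m -> ks = ks' /\ m = n \/ memo_get ks t = Some m.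
Proof.
elim: ks' ks t => [|k' ks' IH] [|k ks] t /=.
- by case: t => [|l r e v] /= [<-]; left.
- by case: t => [|l r e v] /=; [case: k => *; right|right].
- by have := memo_get_nil_upd k' (memo_set ks' n) t; rewrite /= => ->; right.
rewrite memo_sub_upd; case: pos_eqP => [<-|_]; last by right.
by move=> /IH [[<- <-]|]; [left|right].
Qed.

(** An orbit of simplices: its members, their interior facet sides with repetition, the circuit
    sides that they contain, and the circuit sides that they exclude. *)
Record entry := Entry {
  e_orb : seq (seq bool); e_keys : seq positive; e_use : bitset; e_forb : bitset }.

(* The low bit of a key tells the side of the facet coded by the other bits. *)
Definition opp (k : positive) : positive :=
  match k with xI k' => xO k' | xO k' => xI k' | xH => xH end.

Lemma oppK k : opp (opp k) = k. Proof. by case: k. Qed.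

(* Any total order would do; this one usually needs few bits. *)
Fixpoint pos_ltb (a b : positive) : bool :=
  match a, b with
  | xH, xH => false
  | xH, _ => true
  | xO _, xI _ => true
  | xO a', xO b' => pos_ltb a' b'
  | xI a', xI b' => pos_ltb a' b'
  | _, _ => false
  end.

Fixpoint fr_mem (k : positive) (l : seq positive) : bool :=
  match l with [::] => false | a :: l' => if pos_eqb k a then true else fr_mem k l' end.

Fixpoint fr_rem (k : positive) (l : seq positive) : seq positive :=
  match l with [::] => [::] | a :: l' => if pos_eqb k a then l' else a :: fr_rem k l' end.

(** Sorted insertion turns equal frontiers into equal lists, so that the memo table recognizes
    them. *)
Fixpoint fr_ins (k : positive) (l : seq positive) : seq positive :=
  match l with
  | [::] => [:: k]
  | a :: l' => if pos_ltb k a then k :: l else a :: fr_ins k l'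
  end.

(** A new simplex on side [k] either meets a demand for [k] or creates one for [opp k]. If [opp k]
    is already demanded, side [k] is occupied and the simplex is refused. *)
Fixpoint toggles (ks : seq positive) (fr : seq positive) : option (seq positive) :=
  match ks with
  | [::] => Some fr
  | k :: ks' =>
    if fr_mem k fr then toggles ks' (fr_rem k fr)
    else if fr_mem (opp k) fr then None else toggles ks' (fr_ins (opp k) fr)
  end.

Definition cnt (k : positive) (l : seq positive) : nat := count (pos_eqb k) l.

Lemma fr_memE k l : fr_mem k l = (0 < cnt k l).
Proof. by elim: l => //= a l ->; case: pos_eqb. Qed.

Lemma cnt_rem k k' l : cnt k (fr_rem k' l) = cnt k l - (fr_mem k' l && pos_eqb k k').
Proof.
elim: l => //= a l IH; case: (pos_eqP k' a) => [<-|ne] /=; first by case: pos_eqb => /=; lia.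
rewrite {}IH; case: (pos_eqP k k') => [e|_]; rewrite ?andbF ?subn0 // andbT.
subst k'; case: (pos_eqP k a) => //= _; lia.
Qed.

Lemma cnt_ins k k' l : cnt k (fr_ins k' l) = cnt k l + pos_eqb k k'.
Proof. by elim: l => //= [|a l IH]; [lia|case: ifP => /= _; rewrite ?IH; lia]. Qed.

Lemma pos_eqb_opp k k' : pos_eqb (opp k) (opp k') = pos_eqb k k'.
Proof. by case: k k' => [k|k|] [k'|k'|]. Qed.

Lemma pos_eqb_oppl k k' : pos_eqb (opp k) k' = pos_eqb k (opp k').
Proof. by case: k k' => [k|k|] [k'|k'|]. Qed.

Definition consistent (fr : seq positive) := forall k, 0 < cnt k fr -> cnt (opp k) fr = 0.

(** With the signed number [cnt k - cnt (opp k)] for each facet, the new frontier is the old one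
    minus [ks]; the equation is arranged so that no subtraction occurs. *)
Lemma toggles_spec ks fr fr' : all (fun k => ~~ pos_eqb k (opp k)) ks ->
  toggles ks fr = Some fr' -> consistent fr -> consistent fr' /\
  forall k, cnt k fr' + cnt k ks + cnt (opp k) fr = cnt (opp k) fr' + cnt (opp k) ks + cnt k fr.
Proof.
elim: ks fr => [|a ks IH] fr /=; first by move=> _ [<-] c; split=> // k; lia.
move=> /andP[na nks].
case: (boolP (fr_mem a fr)) => am.
  move=> /(IH _ nks) H c; have [|c' E] := H.
    move=> k; rewrite !cnt_rem => k0; have := c k; lia.
  split=> // k; have := E k; rewrite !cnt_rem am /=.
  have := am; rewrite fr_memE => a0.
  case: (pos_eqP k a) => [->|ka] /=.
    have -> : pos_eqb (opp a) a = false by apply/negbTE; move: na; rewrite pos_eqb_oppl.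
    move=> /=; lia.
  rewrite !pos_eqb_oppl; case: (pos_eqP k (opp a)) => [e|_] /=; last lia.
  by rewrite e oppK; lia.
case: (boolP (fr_mem (opp a) fr)) => // oam.
move=> /(IH _ nks) H c; have a0 : cnt a fr = 0 by move: am; rewrite fr_memE; lia.
have [|c' E] := H.
  move=> k; rewrite !cnt_ins pos_eqb_opp.
  case: (pos_eqP k (opp a)) => [->|ko].
    by rewrite oppK a0 pos_eqb_oppl (negbTE na).
  case: (pos_eqP k a) => [->|ka]; first by rewrite a0.
  by rewrite !addn0; exact: c.
split=> // k; have := E k; rewrite !cnt_ins !pos_eqb_opp !pos_eqb_oppl.
case: (pos_eqP k a) => [->|ka] /=; case: (pos_eqP _ (opp a)) => [e|_] /=; lia.
Qed.

Section Count.
Variable tab : ptrie (seq entry).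

Fixpoint survivors (fb : bitset) (l : seq entry) : seq entry :=
  match l with
  | [::] => [::]
  | e :: l' => if bs_disjoint (e_use e) fb then e :: survivors fb l' else survivors fb l'
  end.

Definition at_most_one (A : Type) (l : seq A) : bool :=
  match l with [::] | [:: _] => true | _ => false end.

Fixpoint shorter (A : Type) (l l' : seq A) : bool :=
  match l, l' with
  | _, [::] => false
  | [::], _ => true
  | _ :: a, _ :: b => shorter a b
  end.

(** Branching on any demanded side is legitimate, because each completion has exactly one simplex
    there. A side with the fewest candidates keeps the tree small. *)
Fixpoint branch_at (fb : bitset) (best : seq entry) (fr : seq positive) : seq entry :=
  if at_most_one best then best else
  match fr with
  | [::] => best
  | k :: fr' =>
    let c := survivors fb (pt_list k tab) in
    if shorter c best then branch_at fb c fr' else branch_at fb best fr'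
  end.

Fixpoint sum_over (rec : bitset -> seq positive -> memo -> option (N * memo))
    (fb : bitset) (fr : seq positive) (cs : seq entry) (acc : N) (m : memo) : option (N * memo) :=
  if cs is e :: cs' then
    if toggles (e_keys e) fr is Some fr2 then
      if rec (bs_union (e_forb e) fb) fr2 m is Some (n, m')
      then sum_over rec fb fr cs' (N.add n acc) m' else None
    else sum_over rec fb fr cs' acc m
  else Some (acc, m).

(* [fr] lists the facet sides on which a further simplex is needed. The number of
   completions depends only on [fr], hence the memo table; [fb] only serves to
   discard candidates early. *)
Fixpoint completions (fuel : nat) (fb : bitset) (fr : seq positive) (m : memo) {struct fuel}
    : option (N * memo) :=
  if fuel is S fuel' then
    if fr is k :: fr' then
      match branch_at fb (survivors fb (pt_list k tab)) fr' with
      | [::] => Some (N0, m)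
      | [:: e] => sum_over (completions fuel') fb fr [:: e] N0 m
      | cs =>
        if memo_get fr m is Some n then Some (n, m) else
        if sum_over (completions fuel') fb fr cs N0 m is Some (n, m')
        then Some (n, memo_set fr n m') else None
      end
    else Some (Npos xH, m)
  else None.

End Count.
Arguments sum_over : simpl never.
Arguments pt_get : simpl never.

Lemma nat_of_binD (n m : N) : nat_of_bin (N.add n m) = nat_of_bin n + nat_of_bin m.
Proof. by case: n m => [|p] [|q] //=; [rewrite addn0|exact: nat_of_add_pos]. Qed.

(** * Correctness of the memoized search, abstracted from the geometry *)

Section Correctness.
Variables (X : finType) (E : {set {set X}}) (dec : seq bool -> X).
Variables (fac : X -> positive -> bool) (itm cfl : seq bool -> X -> bool).
Variable good : seq X -> Prop.
Variable tab : ptrie (seq entry).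

Definition nfac (P : seq X) k := count (fun G => fac G k) P.

(** Inclusion with multiplicity: a partial list that repeats a simplex has no extension. *)
Definition minc (P : seq X) (S : {set X}) := all (fun G => count_mem G P <= (G \in S)) P.

Definition Ext (P : seq X) := [set S in E | minc P S].

Definition eorb e := map dec (e_orb e).

Definition uses (u : bitset) (P : seq X) := forall p, bs_mem p u -> has (itm p) P.
Definition forbids (u : bitset) (P : seq X) := forall p, bs_mem p u -> has (cfl p) P.

Hypothesis E_bal : forall S k, S \in E -> nfac (enum S) k = nfac (enum S) (opp k).
Hypothesis E_le1 : forall S k, S \in E -> nfac (enum S) k <= 1.
Hypothesis E_conf : forall S p G G', S \in E -> G \in S -> G' \in S ->
  itm p G -> cfl p G' -> False.
Hypothesis exchange : forall P P', good P -> good P' ->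
  (forall k, nfac P k + nfac P' (opp k) = nfac P (opp k) + nfac P' k) -> #|Ext P| = #|Ext P'|.
Hypothesis complete : forall P, good P -> (forall k, nfac P k = nfac P (opp k)) -> #|Ext P| = 1.

Hypothesis tab_entry : forall k e, List.In e (pt_list k tab) ->
  [/\ forall k', cnt k' (e_keys e) = nfac (eorb e) k', uses (e_use e) (eorb e),
      forbids (e_forb e) (eorb e), all (fun k => ~~ pos_eqb k (opp k)) (e_keys e)
    & forall P, good P -> good (eorb e ++ P)].
Hypothesis tab_complete : forall k P S G, good P -> S \in Ext P -> G \in S -> fac G k ->
  nfac P k = 0 ->
  exists2 e, List.In e (pt_list k tab) & S \in Ext (eorb e ++ P).
Hypothesis tab_uniq : forall k S, S \in E ->
  count (fun e => all (mem S) (eorb e)) (pt_list k tab) <= 1.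

Lemma minc_mem P S : minc P S -> {subset P <= S}.
Proof.
move=> /allP H G GP; have := H G GP; case: (G \in S) => //.
by rewrite leqn0 => /eqP c0; move: GP; rewrite -has_pred1 has_count c0.
Qed.

Lemma minc_le P S G : minc P S -> count_mem G P <= (G \in S).
Proof.
move=> /allP H; case: (boolP (G \in P)) => [/H //|/count_memPn ->]; exact: leq0n.
Qed.

Lemma minc_uniq P S : minc P S -> uniq P.
Proof.
move=> mP; rewrite count_mem_uniq // => G.
case: (boolP (G \in P)) => GP; last exact/count_memPn.
have := minc_le G mP; rewrite (minc_mem mP GP) /= => h; apply/eqP.
by rewrite eqn_leq h -has_count has_pred1.
Qed.

Lemma minc_nfac P S k : minc P S -> nfac P k <= nfac (enum S) k.
Proof.
move=> mP; rewrite /nfac -!size_filter; apply: uniq_leq_size.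
  exact: filter_uniq (minc_uniq mP).
by move=> G; rewrite mem_filter => /andP[Gk /(minc_mem mP) GS]; rewrite mem_filter Gk mem_enum.
Qed.

Lemma minc_catr P1 P2 S : minc (P1 ++ P2) S -> minc P2 S.
Proof.
move=> m; apply/allP => G _; apply: leq_trans (minc_le G m).
by rewrite count_cat leq_addl.
Qed.

Lemma nfac_cat P1 P2 k : nfac (P1 ++ P2) k = nfac P1 k + nfac P2 k.
Proof. exact: count_cat. Qed.

Lemma Ext_facet_empty P k : 2 <= nfac P k -> #|Ext P| = 0.
Proof.
move=> h; apply/eqP; rewrite cards_eq0; apply/eqP/setP => S; rewrite !inE.
apply/negP => /andP[SE mP]; have := minc_nfac k mP; have := E_le1 k SE; lia.
Qed.

Lemma Ext_conflict P e fb : forbids fb P -> uses (e_use e) (eorb e) ->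
  ~~ bs_disjoint (e_use e) fb -> #|Ext (eorb e ++ P)| = 0.
Proof.
move=> hf hu /bs_disjointPn[p /andP[/hu/hasP[G Go iG] /hf/hasP[G' GP cG']]].
apply/eqP; rewrite cards_eq0; apply/eqP/setP => S; rewrite !inE.
apply/negP => /andP[SE /minc_mem sub].
by apply: (E_conf SE (sub G _) (sub G' _) iG cG'); rewrite mem_cat ?Go ?GP ?orbT.
Qed.

Lemma count_List_In (T : Type) (a : pred T) x l : List.In x l -> a x -> 0 < count a l.
Proof. by elim: l => //= y l IH [->|/IH h] ax; [rewrite ax|rewrite addn_gt0 h ?orbT]. Qed.

(** Double counting of pairs of an extension [S] of [P] and an entry whose orbit extends [P] inside
    [S]: each [S] has exactly one simplex on the poorer side [k], hence exactly one such entry. *)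
Lemma branch P k : good P -> nfac P k < nfac P (opp k) ->
  #|Ext P| = \sum_(e <- pt_list k tab) #|Ext (eorb e ++ P)|.
Proof.
move=> gP lt.
have -> : \sum_(e <- pt_list k tab) #|Ext (eorb e ++ P)| =
    \sum_(S in Ext P) count (fun e => S \in Ext (eorb e ++ P)) (pt_list k tab).
  transitivity (\sum_(e <- pt_list k tab) \sum_(S in Ext P) (S \in Ext (eorb e ++ P))).
    apply: eq_bigr => e _; rewrite -sum1_card big_mkcond [RHS]big_mkcond; apply: eq_bigr => S _.
    case: (boolP (S \in Ext P)); first by case: ifP.
    case: ifP => //; rewrite !inE => /andP[-> /minc_catr ->] //.
  rewrite exchange_big; apply: eq_bigr => S _.
  by elim: (pt_list k tab) => [|e l IH]; rewrite ?big_nil // big_cons IH.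
rewrite -sum1_card; apply: eq_bigr => S SP; apply/esym/eqP.
have := SP; rewrite inE => /andP[SE mP].
rewrite eqn_leq; apply/andP; split.
  apply: leq_trans (tab_uniq k SE); apply: sub_count => e /=; rewrite inE => /andP[_ /minc_mem m].
  by apply/allP => G Go; apply: m; rewrite mem_cat Go.
(* The richer side carries at most one simplex, so the poorer one carries none. *)
have P0 : nfac P k = 0.
  have := minc_nfac (opp k) mP; have := E_le1 (opp k) SE; lia.
have : 0 < nfac (enum S) k.
  by rewrite E_bal //; apply: leq_trans (minc_nfac (opp k) mP); lia.
rewrite /nfac -has_count => /hasP[G]; rewrite mem_enum => GS Gk.
by have [e el Se] := tab_complete gP SP GS Gk P0; apply: count_List_In el Se.
Qed.

(** Adding the sides listed in [fr] to those of [P] would balance every facet. *)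
Definition frontier P fr := forall k, nfac P k + cnt k fr = nfac P (opp k) + cnt (opp k) fr.

(** A stored number is right for every good [P] with this frontier, whatever choices led to it. *)
Definition memo_valid m := forall fr n, memo_get fr m = Some n ->
  forall P, good P -> frontier P fr -> #|Ext P| = nat_of_bin n.

Lemma survivors_sum fb P l : forbids fb P -> (forall e, List.In e l -> uses (e_use e) (eorb e)) ->
  \sum_(e <- survivors fb l) #|Ext (eorb e ++ P)| = \sum_(e <- l) #|Ext (eorb e ++ P)|.
Proof.
move=> hf; elim: l => //= e l IH H; rewrite big_cons -IH; last by move=> e' h; apply: H; right.
case: ifP => [_|/negbT d]; first by rewrite big_cons.
by rewrite (Ext_conflict hf _ d) //; apply: H; left.
Qed.

Lemma survivors_In fb l e : List.In e (survivors fb l) -> List.In e l.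
Proof. by elim: l => //= a l IH; case: ifP => _ /=; [move=> [->|/IH]|move/IH]; auto. Qed.

Lemma branch_atP fb best fr fr0 :
  (exists2 k, 0 < cnt k fr0 & best = survivors fb (pt_list k tab)) ->
  (forall k, 0 < cnt k fr -> 0 < cnt k fr0) ->
  exists2 k, 0 < cnt k fr0 & branch_at tab fb best fr = survivors fb (pt_list k tab).
Proof.
elim: fr best => [|a fr IH] best hb sub /=; first by case: ifP.
case: ifP => _ //; have sub' k : 0 < cnt k fr -> 0 < cnt k fr0.
  by move=> h; apply: sub; rewrite /= addn_gt0 h orbT.
case: ifP => _; apply: IH => //; exists a => //; apply: sub => /=.
by case: pos_eqP.
Qed.

(** A refusal at [a] means that [opp a] is demanded; the balance then forces [N a] to be positive,
    and [a] itself is the second simplex on that side. *)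
Lemma toggles_None ks fr (N : positive -> nat) : all (fun k => ~~ pos_eqb k (opp k)) ks ->
  toggles ks fr = None -> consistent fr ->
  (forall k, N k + cnt k fr = N (opp k) + cnt (opp k) fr) -> exists a, 2 <= N a + cnt a ks.
Proof.
elim: ks fr N => [//|a ks IH] fr N /= /andP[na nks].
have step fr1 : toggles [:: a] fr = Some fr1 -> toggles ks fr1 = None -> consistent fr ->
   (forall k, N k + cnt k fr = N (opp k) + cnt (opp k) fr) ->
   exists b, 2 <= N b + (pos_eqb b a + cnt b ks).
  move=> t1 t2 c R; have [|c1 R1] := toggles_spec _ t1 c; first by rewrite /= na.
  (* The key just processed is moved from the list into [N], which restores the balance hypothesis
     for the new frontier. *)
  have [|b hb] := IH fr1 (fun k => N k + pos_eqb k a) nks t2 c1; last first.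
    by exists b; move: hb; rewrite -addnA.
  by move=> k; have := R1 k; have := R k; rewrite /=; lia.
case: (boolP (fr_mem a fr)) => am; first by apply: step; rewrite /= am.
case: (boolP (fr_mem (opp a) fr)) => oam; last by apply: step; rewrite /= (negbTE am) (negbTE oam).
move=> _ c R; exists a; have := R a; move: am oam; rewrite !fr_memE.
have -> : pos_eqb a a by case: pos_eqP.
lia.
Qed.

Theorem completions_correct fuel fb fr m n m' P :
  completions tab fuel fb fr m = Some (n, m') -> good P -> frontier P fr -> consistent fr ->
  forbids fb P -> memo_valid m -> #|Ext P| = nat_of_bin n /\ memo_valid m'.
Proof.
elim: fuel fb fr m n m' P => [//|fuel IH] fb fr m n m' P /=.
case: fr => [|k0 fr'].
  (* An empty frontier means that [P] is balanced, and then [P] is its own only extension. *)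
  move=> [<- <-] gP R _ _ mv; split=> //; apply: complete => // k.
  by have := R k; rewrite /= !addn0.
move E0: (k0 :: fr') => fr run gP R c hf mv.
have [k k0fr pk] : exists2 k, 0 < cnt k fr &
    branch_at tab fb (survivors fb (pt_list k0 tab)) fr' = survivors fb (pt_list k tab).
  apply: branch_atP; first by exists k0 => //; rewrite -E0 /=; case: pos_eqP.
  by move=> k h; rewrite -E0 /= addn_gt0 h orbT.
rewrite {}pk in run.
have lt : nfac P k < nfac P (opp k) by have := R k; rewrite (c k k0fr); lia.
have hE e : List.In e (survivors fb (pt_list k tab)) -> List.In e (pt_list k tab).
  exact: survivors_In.
have br : #|Ext P| = \sum_(e <- survivors fb (pt_list k tab)) #|Ext (eorb e ++ P)|.
  rewrite survivors_sum ?branch //; first exact: branch.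
  by move=> e /tab_entry[].
have loop cs acc m1 n1 m2 : (forall e, List.In e cs -> List.In e (pt_list k tab)) ->
   sum_over (completions tab fuel) fb fr cs acc m1 = Some (n1, m2) -> memo_valid m1 ->
   nat_of_bin n1 = \sum_(e <- cs) #|Ext (eorb e ++ P)| + nat_of_bin acc /\ memo_valid m2.
  elim: cs acc m1 => [|e cs IHcs] acc m1 hcs; rewrite /sum_over /= -?/(sum_over _ _ _ _ _ _);
    first by move=> [<- <-] mv1; rewrite big_nil.
  have [ek eu ef ne eg] := tab_entry (hcs e (or_introl erefl)).
  have hcs' e' : List.In e' cs -> List.In e' (pt_list k tab) by move=> h; apply: hcs; right.
  rewrite big_cons; case tE: (toggles _ _) => [fr2|].
    case cE: (completions _ _ _ _ _) => [[n2 m3]|//] h mv1.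
    have [c2 R2] := toggles_spec ne tE c.
    have [|k'|||q1 q2] := IH _ _ _ _ _ (eorb e ++ P) cE _ _ c2 => //.
    - exact: eg.
    - by have := R2 k'; have := R k'; rewrite !nfac_cat -!ek; lia.
    - move=> p pu; have := bs_mem_union pu; rewrite has_cat => /orP[/ef ->//|/hf ->].
      by rewrite orbT.
    have [-> ?] := IHcs _ _ hcs' h q2; split=> //.
    by rewrite nat_of_binD -q1 addnCA addnA.
  (* A refused candidate puts two simplices on one side of a facet, so it contributes no
     extension. *)
  move=> h mv1; have [-> ?] := IHcs _ _ hcs' h mv1; split=> //.
  have [a ha] := toggles_None ne tE c R.
  by rewrite (@Ext_facet_empty _ a) // nfac_cat -ek addnC.
(* Two good lists with the same frontier have the same imbalances, which is what [exchange] asks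
   for. *)
have memoize n1 m1 : nat_of_bin n1 = #|Ext P| -> memo_valid m1 -> memo_valid (memo_set fr n1 m1).
  move=> e1 mv1 fr1 n2 /memo_get_set[[-> ->]|/mv1 //] P' gP' R'; rewrite e1.
  by apply: exchange => // k'; have := R k'; have := R' k'; lia.
move: br hE run; move: (survivors fb _) => l br hE.
have all_l m1 n1 m2 : sum_over (completions tab fuel) fb fr l N0 m1 = Some (n1, m2) ->
    memo_valid m1 -> #|Ext P| = nat_of_bin n1 /\ memo_valid m2.
  by move=> h /(loop _ _ _ _ _ hE h)[e1 ?]; rewrite br e1 addn0.
case: l br hE all_l => [|e [|e2 cs]] br hE all_l.
- by move=> [<- <-]; rewrite br big_nil.
- by move=> run; exact: all_l run mv.
case gE: (memo_get fr m) => [n1|].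
  by move=> [<- <-]; split=> //; exact: mv gE _ gP R.
case sE: (sum_over _ _ _ _ _ _) => [[n1 m1]|//] [<- <-].
have [e1 mv1] := all_l _ _ _ sE mv; split=> //.
exact: memoize.
Qed.

End Correctness.

(** * Tables for the 4-cube *)

Fixpoint bitlists (n : nat) : seq (seq bool) :=
  if n is n'.+1 then map (cons false) (bitlists n') ++ map (cons true) (bitlists n') else [:: [::]].

(** The subsets with [k] elements of [n] points, as characteristic vectors; [subdraws] lists those
    inside the set with vector [s]. *)
Fixpoint draws (n k : nat) : seq (seq bool) :=
  if n is n'.+1 then
    (if k is k'.+1 then map (cons true) (draws n' k') else [::]) ++ map (cons false) (draws n' k)
  else if k is 0 then [:: [::]] else [::].

Fixpoint subdraws (s : seq bool) (k : nat) : seq (seq bool) :=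
  if s is b :: s' then
    (if b then if k is k'.+1 then map (cons true) (subdraws s' k') else [::] else [::])
    ++ map (cons false) (subdraws s' k)
  else if k is 0 then [:: [::]] else [::].

(** The final [xH] marks the end of the list, so lists of different lengths get different codes. *)
Fixpoint code (s : seq bool) : positive :=
  if s is b :: s' then if b then xI (code s') else xO (code s') else xH.

Fixpoint elems (A : Type) (s : seq bool) (vs : seq A) : seq A :=
  match s, vs with
  | b :: s', v :: vs' => if b then v :: elems s' vs' else elems s' vs'
  | _, _ => [::]
  end.

(** The facets of a simplex, each paired with the vertex opposite to it. *)
Fixpoint removals (A : Type) (s : seq bool) (vs : seq A) : seq (seq bool * A) :=
  match s, vs with
  | b :: s', v :: vs' =>
    let r := [seq (b :: x.1, x.2) | x <- removals s' vs'] in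
    if b then (false :: s', v) :: r else r
  | _, _ => [::]
  end.

Lemma bitlists_uniq n : uniq (bitlists n).
Proof.
have inj (b : bool) : injective (cons b) by move=> s t [].
elim: n => //= n IH; rewrite cat_uniq (map_inj_uniq (inj false)) (map_inj_uniq (inj true)) IH andbT /=.
by apply/hasPn => _ /mapP[s _ ->]; apply/negP => /mapP[].
Qed.

Lemma mem_bitlists n s : (s \in bitlists n) = (size s == n).
Proof.
elim: n s => [|n IH] [|b s] //=; rewrite mem_cat.
  by apply/negbTE; rewrite negb_or; apply/andP; split; apply/negP => /mapP[].
have inj (c : bool) : injective (cons c) by move=> s1 t [].
case: b; first rewrite orbC; rewrite mem_map // IH orbC; case: mapP => [[]|] //.
Qed.

Lemma draws_uniq n k : uniq (draws n k).
Proof.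
have inj (b : bool) : injective (cons b) by move=> s t [].
elim: n k => [|n IH] [|k] //=; rewrite ?(map_inj_uniq (inj false)) ?IH // cat_uniq
  (map_inj_uniq (inj false)) (map_inj_uniq (inj true)) !IH andbT /=.
by apply/hasPn => _ /mapP[s _ ->]; apply/negP => /mapP[].
Qed.

Lemma mem_draws n k s : (s \in draws n k) = (size s == n) && (count id s == k).
Proof.
have inj (b : bool) : injective (cons b) by move=> s1 t [].
have nin b c (l : seq (seq bool)) t : b != c -> (b :: t \in map (cons c) l) = false.
  by move=> bc; apply/negbTE/negP => /mapP[u _ [e _]]; rewrite e eqxx in bc.
elim: n k s => [|n IH] k s; first by case: k s => [|k] [|b s]; rewrite /= ?inE.
have nil c (l : seq (seq bool)) : ([::] \in map (cons c) l) = false by apply/negbTE/negP => /mapP[].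
rewrite [draws _ _]/= mem_cat; case: s => [|b s].
  by rewrite nil orbF; case: k => [|k]; rewrite ?nil.
case: b => /=.
  rewrite (nin true false) // orbF; case: k => [|k]; first by rewrite andbF.
  by rewrite mem_map // IH.
rewrite mem_map // IH; case: k => [|k] //.
by rewrite (nin false true).
Qed.

Lemma mem_subdraws s k t : (t \in subdraws s k) ->
  [/\ size t = size s, count id t = k & forall i, nth false t i -> nth false s i].
Proof.
elim: s k t => [|b s IH] [|k] t //=; rewrite ?inE.
- by move/eqP ->.
- case: b => /=; rewrite ?cat0s => /mapP[u /IH[e c H] ->] /=; rewrite e c; split=> // -[|i] //=;
  exact: H.
- rewrite mem_cat => /orP[].
    case: b => // /mapP[u /IH[e c H] ->] /=; rewrite e c; split=> // -[|i] //=; exact: H.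
  move=> /mapP[u /IH[e c H] ->] /=; rewrite e c; split=> // -[|i] //=; exact: H.
Qed.

Lemma code_inj : injective code.
Proof. by elim=> [|b s IH] [|c t] //=; [case: c|case: b|case: b; case: c => // -[/IH ->]]. Qed.

Lemma removalsE (A : Type) (d : A) (s : seq bool) (vs : seq A) : size s = size vs ->
  removals s vs =
  [seq (set_nth false s i false, nth d vs i) | i <- iota 0 (size s) & nth false s i].
Proof.
elim: s vs => [|b s IH] [|v vs] //= [e].
rewrite -[1%N]addn0 iotaDl filter_map (IH _ e) -map_comp.
by case: b => /=; rewrite -map_comp.
Qed.

Local Open Scope Z_scope.

Definition zb (b : bool) : Z := if b then 1 else 0.
Definition vbits := bitlists 4.
Definition verts : seq (seq Z) := map (map zb) vbits.

(* [(c, n)] stands for the affine form [c + n . x]. *)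
Definition hform := (Z * seq Z)%type.

Definition det3 (a b c d e f g h i : Z) : Z :=
  a * (e * i - f * h) - b * (d * i - f * g) + c * (d * h - e * g).

(* Generalized cross product of the edges at the first point. *)
Definition hyperplane_of (l : seq (seq Z)) : hform :=
  match l with
  | [:: [:: a0; a1; a2; a3]; [:: b0; b1; b2; b3]; [:: c0; c1; c2; c3]; [:: d0; d1; d2; d3]] =>
    let u0 := b0 - a0 in let u1 := b1 - a1 in let u2 := b2 - a2 in let u3 := b3 - a3 in
    let v0 := c0 - a0 in let v1 := c1 - a1 in let v2 := c2 - a2 in let v3 := c3 - a3 in
    let w0 := d0 - a0 in let w1 := d1 - a1 in let w2 := d2 - a2 in let w3 := d3 - a3 in
    let n0 := det3 u1 u2 u3 v1 v2 v3 w1 w2 w3 in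
    let n1 := - det3 u0 u2 u3 v0 v2 v3 w0 w2 w3 in
    let n2 := det3 u0 u1 u3 v0 v1 v3 w0 w1 w3 in
    let n3 := - det3 u0 u1 u2 v0 v1 v2 w0 w1 w2 in
    (- (n0 * a0 + n1 * a1 + n2 * a2 + n3 * a3), [:: n0; n1; n2; n3])
  | _ => (0, [:: 0; 0; 0; 0])
  end.

Fixpoint zdot (a b : seq Z) : Z :=
  match a, b with x :: a', y :: b' => x * y + zdot a' b' | _, _ => 0 end.

(* The value at [x / d], multiplied by [d]. *)
Definition hval (f : hform) (x : seq Z) (d : Z) : Z := f.1 * d + zdot f.2 x.

Definition zpos (z : Z) : bool := if z is Zpos _ then true else false.
Definition zneg (z : Z) : bool := if z is Zneg _ then true else false.
Definition zzero (z : Z) : bool := if z is Z0 then true else false.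

Definition hform_of (f : seq bool) : hform := hyperplane_of (elems f verts).

Definition hinterior (h : hform) : bool :=
  if has (fun v => zpos (hval h v 1)) verts then has (fun v => zneg (hval h v 1)) verts else false.

Definition hinfo (f : seq bool) : hform * bool :=
  let h := hform_of f in (h, hinterior h).

(** Each 4-set of vertices is a facet of twelve 5-sets, so its hyperplane is computed once and
    shared. *)
Definition htable : ptrie (hform * bool) :=
  foldr (fun f t => let i := hinfo f in pt_upd (code f) (fun _ => Some i) t) PLeaf (draws 16 4).

(* [pnum / pden] is the generic point; any other would do. *)
Definition pnum : seq Z := [:: 9; 11; 12; 13].
Definition pden : Z := 26.

(** [f_apex] is the value of the affine form of the facet at the opposite vertex; [f_p] is [pden]
    times its value at the generic point. *)
Record facet := Facet { f_code : positive; f_int : bool; f_apex : Z; f_p : Z }.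

Definition mkfacet (f : seq bool) (v : seq Z) (hi : hform * bool) : facet :=
  Facet (code f) hi.2 (hval hi.1 v 1) (hval hi.1 pnum pden).

Definition facets_of (ht : ptrie (hform * bool)) (G : seq bool) : seq facet :=
  [seq mkfacet x.1 x.2 (odflt (hinfo x.1) (pt_get (code x.1) ht)) | x <- removals G verts].

Definition fkey (c : positive) (b : bool) : positive := if b then xI c else xO c.

Definition keys_of (fs : seq facet) : seq positive :=
  [seq fkey (f_code x) (zpos (f_apex x)) | x <- fs & f_int x].

Fixpoint ladd (a b : seq nat) : seq nat :=
  match a, b with x :: a', y :: b' => (x + y)%N :: ladd a' b' | _, _ => [::] end.
Fixpoint wsum (w : seq nat) (vs : seq (seq nat)) : seq nat :=
  match w, vs with
  | x :: w', v :: vs' => ladd (map (muln x) v) (wsum w' vs')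
  | _, _ => [:: 0; 0; 0; 0]%N
  end.
Fixpoint nat_seq_eqb (a b : seq nat) : bool :=
  match a, b with
  | [::], [::] => true
  | x :: a', y :: b' => if eqn x y then nat_seq_eqb a' b' else false
  | _, _ => false
  end.
Fixpoint bits_disjoint (a b : seq bool) : bool :=
  match a, b with
  | x :: a', y :: b' => if (if x then y else false) then false else bits_disjoint a' b'
  | _, _ => true
  end.

Definition nverts : seq (seq nat) := map (map nat_of_bool) vbits.

Record wset := Wset { w_bits : seq bool; w_wts : seq nat; w_sum : seq nat }.

Definition wsets (k : nat) (w : seq nat) : seq wset :=
  [seq Wset s w (wsum w (elems s nverts)) | s <- draws 16 k].

(* Disjoint weighted vertex sets with the same barycentre: no two simplices of
   a triangulation can contain one each. *)
Definition wcircuits (l1 l2 : seq wset) : seq (wset * wset) :=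
  flatten [seq [seq (a, b) | b <- l2 & if nat_seq_eqb (w_sum a) (w_sum b)
                                       then bits_disjoint (w_bits a) (w_bits b) else false] | a <- l1].

(** Either two segments with the same midpoint, or a segment divided 2 to 1 by the barycentre of a
    triangle. Each pair is listed in both orders, as conflicts are symmetric. *)
Definition wpairs_of (e2 e21 t3 : seq wset) : seq (wset * wset) :=
  let c23 := wcircuits e21 t3 in wcircuits e2 e2 ++ c23 ++ [seq (c.2, c.1) | c <- c23].

Definition wpairs : seq (wset * wset) :=
  wpairs_of (wsets 2 [:: 1; 1]%N) (wsets 2 [:: 2; 1]%N ++ wsets 2 [:: 1; 2]%N)
    (wsets 3 [:: 1; 1; 1]%N).

Definition circuits : seq (seq bool * seq bool) := [seq (w_bits c.1, w_bits c.2) | c <- wpairs].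

Fixpoint dedup (l : seq (seq bool)) (t : ptrie unit) : seq (seq bool) :=
  if l is s :: l' then
    if pt_get (code s) t is Some _ then dedup l' t
    else s :: dedup l' (pt_upd (code s) (fun _ => Some tt) t)
  else [::].

(** The sides of the circuits are 88 segments and 160 triangles, so eight bits are enough to number
    them. *)
Definition item_list (cs : seq (seq bool * seq bool)) : seq (seq bool * seq bool) :=
  zip (dedup (map fst cs) PLeaf) (bitlists 8).

Definition item_table (il : seq (seq bool * seq bool)) : ptrie bitset :=
  foldr (fun x t => pt_upd (code x.1) (fun _ => Some (bs_single x.2)) t) PLeaf il.

Definition conflict_table (it : ptrie bitset) (cs : seq (seq bool * seq bool)) : ptrie bitset :=
  foldr (fun c t => if pt_get (code c.2) it is Some s
                    then pt_upd (code c.1) (fun o => Some (bs_union s (odflt BEmpty o))) t else t)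
    PLeaf cs.

Definition collect (t : ptrie bitset) (G : seq bool) : bitset :=
  foldr (fun s u => bs_union (odflt BEmpty (pt_get (code s) t)) u) BEmpty
    (subdraws G 2 ++ subdraws G 3).

(** [s_cov] tells whether the simplex contains the generic point, [s_nd] whether no vertex lies in
    the hyperplane of its opposite facet. *)
Record simplex := Simplex {
  s_bits : seq bool; s_facets : seq facet; s_keys : seq positive; s_use : bitset; s_forb : bitset;
  s_cov : bool; s_nd : bool }.

Definition mksimplex (ht : ptrie (hform * bool)) (it ct : ptrie bitset) (G : seq bool) : simplex :=
  let fs := facets_of ht G in
  Simplex G fs (keys_of fs) (collect it G) (collect ct G)
    (all (fun x => eqb (zpos (f_apex x)) (zpos (f_p x))) fs)
    (all (fun x => ~~ zzero (f_apex x)) fs).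

Definition all_simplices : seq simplex :=
  let ht := htable in let cs := circuits in
  let it := item_table (item_list cs) in let ct := conflict_table it cs in
  [seq mksimplex ht it ct G | G <- draws 16 5].

Definition facets_ok : bool :=
  all (fun f => all (fun v => zzero (hval (hform_of f) v 1)) (elems f verts)) (draws 16 4).

(** For a nondegenerate simplex the generic point must avoid the facet hyperplanes. A degenerate
    5-set must contain both sides of a circuit, which certifies that it is affinely dependent. *)
Definition simplex_ok (s : simplex) : bool :=
  if s_nd s then all (fun x => ~~ zzero (f_p x)) (s_facets s)
  else ~~ bs_disjoint (s_use s) (s_forb s).

Definition simplices_ok (ss : seq simplex) : bool :=
  if all simplex_ok ss then has (fun s => s_nd s && s_cov s) ss else false.

Arguments htable : simpl never.
Arguments circuits : simpl never.
Arguments all_simplices : simpl never.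
Arguments item_table : simpl never.
Arguments conflict_table : simpl never.
Arguments draws : simpl never.

Local Close Scope Z_scope.

(** * Orbits and the count of invariant triangulations *)

(** Reading a characteristic vector through a permutation yields the preimage of the set, not its
    image. *)
Definition img (l : seq nat) (s : seq bool) : seq bool := [seq nth false s i | i <- l].

Fixpoint orb (fuel : nat) (l : seq nat) (c0 : positive) (s : seq bool) : seq (seq bool) :=
  if fuel is S n then
    let s' := img l s in if pos_eqb (code s') c0 then [:: s] else s :: orb n l c0 s'
  else [:: s].

Definition simplex_table (ss : seq simplex) : ptrie simplex :=
  foldr (fun s t => pt_upd (code (s_bits s)) (fun _ => Some s) t) PLeaf ss.

Record start := Start { t_simplex : simplex; t_entry : entry; t_cov : nat }.

(** Fuel 12 reaches the end of every orbit, because [small_order] bounds the order of the symmetry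
    by 12. *)
Definition mkstart (st : ptrie simplex) (l : seq nat) (s : simplex) : start :=
  let o := orb 12 l (code (s_bits s)) (s_bits s) in
  let d := pmap (fun b => pt_get (code b) st) o in
  Start s (Entry o (flatten [seq s_keys x | x <- d]) (foldr (fun x u => bs_union (s_use x) u) BEmpty d)
    (foldr (fun x u => bs_union (s_forb x) u) BEmpty d)) (count s_cov d).

Definition static_ok (e : entry) : bool := bs_disjoint (e_use e) (e_forb e).

(** Starting orbits have exactly one simplex over the generic point ([n = 1]), later ones none
    ([n = 0]). An orbit with an internal conflict lies in no triangulation. *)
Definition eligible (n : nat) (x : start) : bool := if eqn (t_cov x) n then static_ok (t_entry x)
  else false.

(** The entry is filed only under the sides of its own simplex; the other members of the orbit file
    it again through their own starts. *)
Definition add_start (x : start) (t : ptrie (seq entry)) : ptrie (seq entry) :=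
  foldr (fun k t => pt_cons k (t_entry x) t) t (s_keys (t_simplex x)).

Definition mktab (xs : seq start) : ptrie (seq entry) :=
  foldr (fun x t => if eligible 0 x then add_start x t else t) PLeaf xs.

(** The number of invariant triangulations containing a simplex is constant along its orbit under
    the centralizer of the symmetry. *)
Definition record_orbit (cent : seq (seq nat)) (s : seq bool) (n : N) (t : ptrie N) : ptrie N :=
  foldr (fun h t => pt_upd (code (img h s)) (fun _ => Some n) t) t cent.

(** A triangulation has exactly one simplex over the generic point, so summing over such simplices
    counts it once. Fuel 30 exceeds the 24 simplices that a triangulation of the 4-cube can have,
    and [None] would fail the check. *)
Fixpoint runstarts (tab : ptrie (seq entry)) (cent : seq (seq nat)) (xs : seq start)
   (seen : ptrie N) (m : memo) (acc : N) : option N :=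
  if xs is x :: xs' then
    if s_cov (t_simplex x) then
      if eligible 1 x then
        match pt_get (code (s_bits (t_simplex x))) seen with
        | Some n => runstarts tab cent xs' seen m (N.add n acc)
        | None =>
          match toggles (e_keys (t_entry x)) [::] with
          | None => runstarts tab cent xs' seen m acc
          | Some fr =>
            match completions tab 30 (e_forb (t_entry x)) fr m with
            | None => None
            | Some (n, m') =>
              runstarts tab cent xs' (record_orbit cent (s_bits (t_simplex x)) n seen) m' (N.add n acc)
            end
          end
        end
      else runstarts tab cent xs' seen m acc
    else runstarts tab cent xs' seen m acc
  else Some acc.

Definition compo (g h : seq nat) : seq nat := [seq nth 0 g i | i <- h].

(** The signed permutation of the coordinates that sends [v] to the vertex with coordinates
    [v_(sg k) + t_k] modulo 2, as a list of vertex indices. *)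
Definition sperm (sg : seq nat) (t : seq bool) : seq nat :=
  [seq index [seq addb (nth false v (nth 0 sg k)) (nth false t k) | k <- iota 0 4] vbits | v <- vbits].

Definition cube_perms : seq (seq nat) :=
  [seq sperm sg t | sg <- permutations (iota 0 4), t <- vbits].

Definition centralizer (gs : seq (seq nat)) (l : seq nat) : seq (seq nat) :=
  [seq h <- gs | nat_seq_eqb (compo h l) (compo l h)].

Definition fixcount (ss : seq simplex) (cent : seq (seq nat)) (l : seq nat) : option N :=
  let st := simplex_table ss in
  let xs := [seq mkstart st l s | s <- ss] in
  runstarts (mktab xs) cent xs PLeaf MLeaf N0.

Definition idl := iota 0 16.

Definition small_order (l : seq nat) : bool :=
  has (fun m => nat_seq_eqb (iter m (compo l) idl) idl) (iota 1 12).

Definition rep_ok (ss : seq simplex) (gs : seq (seq nat)) (r : seq nat * N) : bool :=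
  if small_order r.1 then
    if r.1 \in gs then
      if fixcount ss (centralizer gs r.1) r.1 is Some n then N.eqb n r.2 else false
    else false
  else false.

Definition inverse_list (h : seq nat) : seq nat := [seq index i h | i <- idl].

Definition lcode (l : seq nat) : positive := code (flatten [seq nth [::] vbits i | i <- l]).

Definition conj_table (gs : seq (seq nat)) (rs : seq (seq nat * N)) : ptrie N :=
  foldr (fun r t => foldr (fun h t =>
    pt_upd (lcode (compo h (compo r.1 (inverse_list h)))) (fun _ => Some r.2) t) t gs) PLeaf rs.

(** A symmetry conjugate to no representative gives [None], so the sum also checks that [reps] meets
    every conjugacy class. *)
Definition conj_sum (t : ptrie N) (gs : seq (seq nat)) : option N :=
  foldr (fun l o => if o is Some a then
    if pt_get (lcode l) t is Some n then Some (N.add n a) else None else None) (Some N0) gs.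

(* Representatives of the 20 conjugacy classes of symmetries, with the numbers of
   triangulations they fix. *)
Definition reps : seq (seq nat * N) := [::
  ([:: 0; 1; 2; 3; 4; 5; 6; 7; 8; 9; 10; 11; 12; 13; 14; 15], 92487256%num);
  ([:: 1; 0; 3; 2; 5; 4; 7; 6; 9; 8; 11; 10; 13; 12; 15; 14], 0%num);
  ([:: 3; 2; 1; 0; 7; 6; 5; 4; 11; 10; 9; 8; 15; 14; 13; 12], 0%num);
  ([:: 7; 6; 5; 4; 3; 2; 1; 0; 15; 14; 13; 12; 11; 10; 9; 8], 6720%num);
  ([:: 15; 14; 13; 12; 11; 10; 9; 8; 7; 6; 5; 4; 3; 2; 1; 0], 22280%num);
  ([:: 0; 2; 1; 3; 4; 6; 5; 7; 8; 10; 9; 11; 12; 14; 13; 15], 147868%num);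
  ([:: 1; 3; 0; 2; 5; 7; 4; 6; 9; 11; 8; 10; 13; 15; 12; 14], 0%num);
  ([:: 4; 6; 5; 7; 0; 2; 1; 3; 12; 14; 13; 15; 8; 10; 9; 11], 0%num);
  ([:: 5; 7; 4; 6; 1; 3; 0; 2; 13; 15; 12; 14; 9; 11; 8; 10], 0%num);
  ([:: 12; 14; 13; 15; 8; 10; 9; 11; 4; 6; 5; 7; 0; 2; 1; 3], 12996%num);
  ([:: 13; 15; 12; 14; 9; 11; 8; 10; 5; 7; 4; 6; 1; 3; 0; 2], 0%num);
  ([:: 0; 2; 4; 6; 1; 3; 5; 7; 8; 10; 12; 14; 9; 11; 13; 15], 1072%num);
  ([:: 1; 3; 5; 7; 0; 2; 4; 6; 9; 11; 13; 15; 8; 10; 12; 14], 0%num);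
  ([:: 8; 10; 12; 14; 9; 11; 13; 15; 0; 2; 4; 6; 1; 3; 5; 7], 0%num);
  ([:: 9; 11; 13; 15; 8; 10; 12; 14; 1; 3; 5; 7; 0; 2; 4; 6], 32%num);
  ([:: 0; 2; 1; 3; 8; 10; 9; 11; 4; 6; 5; 7; 12; 14; 13; 15], 42408%num);
  ([:: 1; 3; 0; 2; 9; 11; 8; 10; 5; 7; 4; 6; 13; 15; 12; 14], 0%num);
  ([:: 5; 7; 4; 6; 13; 15; 12; 14; 1; 3; 0; 2; 9; 11; 8; 10], 0%num);
  ([:: 0; 2; 4; 6; 8; 10; 12; 14; 1; 3; 5; 7; 9; 11; 13; 15], 212%num);
  ([:: 1; 3; 5; 7; 9; 11; 13; 15; 0; 2; 4; 6; 8; 10; 12; 14], 0%num)].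

Definition group_ok (gs : seq (seq nat)) : bool :=
  if uniq gs then if eqn (size gs) 384 then
    (* 384 * 247451 *)
    if conj_sum (conj_table gs reps) gs is Some n then N.eqb n 95021184%num else false
  else false else false.

Definition run_ok (ss : seq simplex) (gs : seq (seq nat)) : bool := all (rep_ok ss gs) reps.

Definition nondeg_simplices (ss : seq simplex) : seq simplex := [seq s <- ss | s_nd s].

Import Order.TTheory GRing.Theory Num.Theory.

Local Open Scope ring_scope.

(** * Affine functions near a point *)

Section Affine.
Variables (R : realFieldType) (n : nat).
Implicit Types (u : 'cV[R]_n * R) (x y : 'rV[R]_n) (t : R).

Definition affv u x : R := (x *m u.1) 0 0 + u.2.

Definition seg x y t : 'rV[R]_n := (1 - t) *: x + t *: y.

Lemma affv_seg u x y t : affv u (seg x y t) = (1 - t) * affv u x + t * affv u y.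
Proof. by rewrite /affv /seg mulmxDl -!scalemxAl !mxE; ring. Qed.

Lemma affv_sum (J : finType) u (w : J -> R) (p : J -> 'rV[R]_n) :
  \sum_j w j = 1 -> affv u (\sum_j w j *: p j) = \sum_j w j * affv u (p j).
Proof.
move=> w1; rewrite /affv mulmx_suml summxE.
under [RHS]eq_bigr do rewrite mulrDr.
rewrite big_split /= -mulr_suml w1 mul1r; congr (_ + _).
by apply: eq_bigr => j _; rewrite -scalemxAl mxE.
Qed.

Definition affZ (c : R) u := (c *: u.1, c * u.2).
Lemma affvZ c u x : affv (affZ c u) x = c * affv u x.
Proof. by rewrite /affv /affZ /= -scalemxAr mxE mulrDr. Qed.

Definition affD u1 u2 := (u1.1 + u2.1, u1.2 + u2.2).
Lemma affvD u1 u2 x : affv (affD u1 u2) x = affv u1 x + affv u2 x.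
Proof. by rewrite /affv /affD /= mulmxDr mxE; ring. Qed.

(** Being true for all small positive [e] is stable under finite conjunction, and this is the only
    form in which limits and perturbations appear below. *)
Definition near0 (P : R -> Prop) := exists2 d : R, 0 < d & forall e, 0 < e < d -> P e.

Lemma near0_and P Q : near0 P -> near0 Q -> near0 (fun e => P e /\ Q e).
Proof.
move=> [d d0 dP] [d' d'0 dQ]; exists (Num.min d d'); first by rewrite lt_min d0.
by move=> e /andP[e0]; rewrite lt_min => /andP[ed ed']; split; [apply: dP|apply: dQ]; rewrite e0.
Qed.

Lemma near0_imp P Q : (forall e, P e -> Q e) -> near0 P -> near0 Q.
Proof. by move=> PQ [d d0 dP]; exists d => // e /dP /PQ. Qed.

Lemma near0_T (P : R -> Prop) : (forall e, P e) -> near0 P.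
Proof. by move=> h; exists 1. Qed.

Lemma near0_lt (c : R) : 0 < c -> near0 (fun e => 0 < e < c).
Proof. by move=> c0; exists c. Qed.

Lemma near0_ex P : near0 P -> exists2 e, 0 < e < 1 & P e.
Proof.
move=> /(near0_and (near0_lt ltr01))[d d0 /(_ (d / 2)) h].
by case: h => [|h1 h2]; [rewrite divr_gt0 //= ltr_pdivrMr // mulr_natr mulr2n ltrDl | exists (d / 2)].
Qed.

Lemma near0_all (J : eqType) (s : seq J) (P : J -> R -> Prop) :
  (forall j, j \in s -> near0 (P j)) -> near0 (fun e => forall j, j \in s -> P j e).
Proof.
elim: s => [|a s IH] h; first by apply: near0_T.
have h1 : near0 (P a) by apply: h; rewrite inE eqxx.
have h2 : near0 (fun e => forall j, j \in s -> P j e).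
  by apply: IH => j js; apply: h; rewrite inE js orbT.
apply: near0_imp (near0_and h1 h2) => e [p q] j; rewrite inE => /predU1P[->//|]; exact: q.
Qed.

Lemma near0_allT (J : finType) (P : J -> R -> Prop) :
  (forall j, near0 (P j)) -> near0 (fun e => forall j, P j e).
Proof.
move=> h; apply: near0_imp (near0_all (s := enum J) (fun j _ => h j)) => e he j.
by apply: he; rewrite mem_enum.
Qed.

Lemma near0_pos (a b : R) : 0 < a -> near0 (fun e => 0 < (1 - e) * a + e * b).
Proof.
move=> a0; have s0 : 0 < a + `|b| by rewrite ltr_wpDr.
have c0 : 0 < a / (a + `|b|) by rewrite divr_gt0.
apply: near0_imp (near0_lt c0) => e /andP[e0].
rewrite ltr_pdivlMr // => h.
have := ler_norm (- b); rewrite normrN => hb.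
have : e * - b <= e * `|b| by rewrite ler_pM2l.
rewrite mulrN; move: h; rewrite mulrDr; lra.
Qed.

Lemma near0_neg (a b : R) : a < 0 -> near0 (fun e => (1 - e) * a + e * b < 0).
Proof.
rewrite -oppr_gt0 => /(near0_pos (- b)); apply: near0_imp => e; lra.
Qed.

Lemma near0_neq (a b : R) : (a != 0) || (b != 0) -> near0 (fun e => (1 - e) * a + e * b != 0).
Proof.
have [->|a0 _] := eqVneq a 0.
  by move=> /= b0; apply: near0_imp (near0_lt ltr01) => e /andP[e0 _];
    rewrite mulr0 add0r mulf_neq0 // gt_eqF.
case: (ltgtP a 0) a0 => // ha _.
  by apply: near0_imp (near0_neg b ha) => e h; rewrite lt_eqF.
by apply: near0_imp (near0_pos b ha) => e h; rewrite gt_eqF.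
Qed.

(** An affine function of [e] has a constant sign just after 0: that of its value at 0 or, if this
    vanishes, that of its value at 1. *)
Lemma near0_ge0_dec (a b : R) :
  near0 (fun e => 0 <= (1 - e) * a + e * b) \/ near0 (fun e => (1 - e) * a + e * b < 0).
Proof.
case: (ltgtP a 0) => ha; [right; exact: near0_neg| |].
  by left; apply: near0_imp (near0_pos b ha) => e /ltW.
rewrite ha; case: (lerP 0 b) => hb.
  left; apply: near0_imp (near0_lt ltr01) => e /andP[e0 _].
  by rewrite mulr0 add0r mulr_ge0 // ltW.
right; apply: near0_imp (near0_lt ltr01) => e /andP[e0 _].
by rewrite mulr0 add0r pmulr_rlt0.
Qed.

Lemma near0_ge0_lim (a b : R) : near0 (fun e => 0 <= (1 - e) * a + e * b) -> 0 <= a.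
Proof.
move=> h; case: (lerP 0 a) => // /(near0_neg b) h2.
by have [e _ [h3 h4]] := near0_ex (near0_and h h2); move: (lt_le_trans h4 h3); rewrite ltxx.
Qed.

(** Finitely many proper hyperplanes do not fill the space: from a point off the earlier ones, a
    small move toward a point off the next one avoids them all. *)
Lemma affine_avoid (s : seq ('cV[R]_n * R)) (x0 : 'rV[R]_n) :
  (forall u, u \in s -> exists x, affv u x != 0) ->
  exists x, forall u, u \in s -> affv u x != 0.
Proof.
elim: s => [|u s IH] h; first by exists x0.
have [|x hx] := IH; first by move=> v vs; apply: h; rewrite inE vs orbT.
have [y hy] := h u (mem_head _ _).
have h1 : near0 (fun e => affv u (seg x y e) != 0).
  apply: near0_imp (near0_neq (a := affv u x) (b := affv u y) _) => [e|]; first by rewrite affv_seg.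
  by rewrite hy orbT.
have h2 : near0 (fun e => forall v, v \in s -> affv v (seg x y e) != 0).
  apply: near0_all => v vs; apply: near0_imp (near0_neq (a := affv v x) (b := affv v y) _) => [e|].
    by rewrite affv_seg.
  by rewrite hx.
have [e _ [h3 h4]] := near0_ex (near0_and h1 h2).
by exists (seg x y e) => v; rewrite inE => /predU1P[->//|]; exact: h4.
Qed.

End Affine.

(** * Segments crossing facets *)

Section Crossing.
Variables (R : realFieldType) (I : eqType).
Implicit Types (a b : I -> R) (s : seq I) (v w : I).

(* With [l_v t = (1 - t) a_v + t b_v], the root of [l_v] lies in ]0, 1[ and
   every other [l_w] is positive there. *)
Definition cross a b s v : bool :=
  (a v * b v < 0) &&
  all (fun w => (w == v) || (0 < (a v * b w - a w * b v) * (a v - b v))) s.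

Definition gsign (x : R) : int := if 0 < x then 1 else -1.

(** The last condition excludes a common root of [l_v] and [l_w]. *)
Definition cross_generic a b s : Prop :=
  [/\ forall v, v \in s -> a v != 0, forall v, v \in s -> b v != 0
    & forall v w, v \in s -> w \in s -> v != w -> a v * b w - a w * b v != 0].

Lemma opp_sign (x y : R) : x * y < 0 -> (0 < x) = ~~ (0 < y).
Proof.
case: (ltgtP x 0) => [x0|x0|->]; last by rewrite mul0r ltxx.
  by rewrite nmulr_rlt0 // => ->.
by rewrite pmulr_rlt0 // => /lt_gtF ->.
Qed.

Lemma same_sign (x y : R) : 0 < x * y -> (0 < x) = (0 < y).
Proof.
case: (ltgtP x 0) => [x0|x0|->]; last by rewrite mul0r ltxx.
  by rewrite nmulr_rgt0 // => /lt_gtF ->.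
by rewrite pmulr_rgt0 // => ->.
Qed.

Lemma cross_swap a b s v : cross b a s v = cross a b s v.
Proof.
rewrite /cross mulrC; congr (_ && _); apply: eq_all => w.
by congr (_ || (0 < _)); ring.
Qed.

Lemma cross_generic_swap a b s : cross_generic a b s -> cross_generic b a s.
Proof.
move=> [ha hb hab]; split=> // v w vs ws vw.
by rewrite -oppr_eq0 opprB mulrC [b v * _]mulrC; apply: hab; rewrite // eq_sym.
Qed.

Definition crossing_formula a b s :=
  (all (fun v => 0 < b v) s)%:Z - (all (fun v => 0 < a v) s)%:Z
  = \sum_(v <- s) (cross a b s v)%:Z * gsign (b v).

Lemma cross_sum_swap a b s : cross_generic a b s ->
  crossing_formula b a s -> crossing_formula a b s.
Proof.
move=> [ha hb _] h; rewrite /crossing_formula -opprB h -sumrN.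
rewrite !big_seq; apply: eq_bigr => v vs; rewrite cross_swap.
rewrite /gsign /cross; case: (boolP (a v * b v < 0)) => //= hc; last by rewrite !mul0r oppr0.
rewrite -mulrN (opp_sign hc); congr (_ * _).
by case: (0 < b v); rewrite ?opprK.
Qed.

(** Along the segment the truth of [all l_v positive] can change only where a single [l_v] changes
    sign while the others are positive. Induction on the list, splitting on how the sign of the head
    coordinate evolves. *)
Lemma crossing_sum a b s : uniq s -> cross_generic a b s -> crossing_formula a b s.
Proof.
elim: s a b => [|m s IH] a b; first by rewrite /crossing_formula big_nil subrr.
move=> /= /andP[ms us].
have base c d : cross_generic c d (m :: s) -> c m < 0 -> 0 < d m ->
    crossing_formula c d (m :: s).
  move=> [hc hd hcd] cm dm.
  set q := d m - c m; have q0 : 0 < q by rewrite /q; lra.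
  pose c' v := (d m * c v - c m * d v) / q.
  (* [c'] gives the values at the point where [l_m] vanishes. The rest of the list is treated on the
     part of the segment after it, where [l_m] is positive. *)
  have E v : c' v * q = d m * c v - c m * d v by rewrite /c' mulfVK // gt_eqF.
  have psi v w : (c' v * d w - c' w * d v) * q = d m * (c v * d w - c w * d v).
    have -> : (c' v * d w - c' w * d v) * q = (c' v * q) * d w - (c' w * q) * d v by ring.
    by rewrite !E; ring.
  have dif v : (c' v - d v) * q = d m * (c v - d v).
    by rewrite mulrBl E /q; ring.
  have g' : cross_generic c' d s.
    have sub v : v \in s -> v \in m :: s by rewrite inE orbC => ->.
    split=> [v vs|v vs|v w vs ws vw].
    - have : c' v * q != 0.
        rewrite E -oppr_eq0 opprB [d m * _]mulrC.
        apply: hcd; rewrite ?mem_head ?sub //; by apply: contraNneq ms => ->.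
      by rewrite mulf_eq0 negb_or => /andP[].
    - by apply: hd; rewrite sub.
    - have : (c' v * d w - c' w * d v) * q != 0.
        by rewrite psi; apply: mulf_neq0; [rewrite gt_eqF | apply: hcd => //; exact: sub].
      by rewrite mulf_eq0 negb_or => /andP[].
  have {IH} := IH c' d us g'; rewrite /crossing_formula => IH.
  rewrite big_cons /= dm /= [0 < c m]lt_gtF //= subr0.
  have -> : gsign (d m) = 1 by rewrite /gsign dm.
  (* The head is crossed exactly when all the others are positive at its root. *)
  have -> : cross c d (m :: s) m = all (fun v => 0 < c' v) s.
    rewrite /cross /= eqxx /= nmulr_rlt0 // dm /=.
    apply: eq_in_all => w ws.
    have -> : (w == m) = false by apply: contraNF ms => /eqP <-.
    rewrite /=.
    rewrite -(pmulr_lgt0 (c' w) q0) E -(nmulr_rlt0 _ (_ : c m - d m < 0)); last by lra.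
    by rewrite -oppr_gt0 -mulNr; congr (0 < _); ring.
  rewrite mulr1; apply/eqP; rewrite addrC -subr_eq IH; apply/eqP.
  rewrite !big_seq; apply: eq_bigr => v vs; congr (_%:Z * _).
  have vm : v != m by apply: contraNneq ms => <-.
  have vms : v \in m :: s by rewrite inE vs orbT.
  have dv := hd v vms.
  rewrite /cross /= [m == v]eq_sym (negbTE vm) /=.
  have -> : all (fun w => (w == v) || (0 < (c' v * d w - c' w * d v) * (c' v - d v))) s
          = all (fun w => (w == v) || (0 < (c v * d w - c w * d v) * (c v - d v))) s.
    apply: eq_all => w; congr (_ || _).
    rewrite -(pmulr_lgt0 ((c' v * d w - c' w * d v) * (c' v - d v)) (mulr_gt0 q0 q0)).
    rewrite -(pmulr_rgt0 ((c v * d w - c w * d v) * (c v - d v)) (mulr_gt0 dm dm)).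
    congr (0 < _).
    have -> : (c' v * d w - c' w * d v) * (c' v - d v) * (q * q)
      = ((c' v * d w - c' w * d v) * q) * ((c' v - d v) * q) by ring.
    by rewrite psi dif; ring.
  (* It remains to see that [l_v] changes sign after the root of [m] exactly when it changes sign on
     the whole segment with [l_m] positive there. *)
  rewrite andbA; congr (_ && _).
  have D0 : c v * d m - c m * d v != 0 by apply: hcd; rewrite ?mem_head.
  have : (c' v * d v < 0) = ((d m * c v - c m * d v) * d v < 0).
    by rewrite -(pmulr_llt0 _ q0) -E; congr (_ < 0); ring.
  move=> ->; set D := c v * d m - c m * d v in D0 *.
  have -> : d m * c v - c m * d v = D by rewrite /D; ring.
  have eD : c v * d m = D + c m * d v by rewrite /D; ring.
  apply/idP/andP.
    case: (ltgtP (d v) 0) dv => // hdv _.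
      rewrite nmulr_llt0 // => hD.
      have : 0 < c v * d m by rewrite eD; nra.
      rewrite pmulr_lgt0 // => hcv; split; first by rewrite pmulr_rlt0.
      by rewrite pmulr_rgt0 // subr_gt0; lra.
    rewrite pmulr_llt0 // => hD.
    have : c v * d m < 0 by rewrite eD; nra.
    rewrite pmulr_llt0 // => hcv; split; first by rewrite nmulr_rlt0.
    by rewrite nmulr_rgt0 // subr_lt0; lra.
  move=> [h1 h2].
  case: (ltgtP (d v) 0) dv h1 => // hdv _.
    rewrite nmulr_llt0 // => hcv; rewrite nmulr_llt0 //.
    by move: h2; rewrite pmulr_lgt0 // subr_gt0; lra.
  rewrite pmulr_llt0 // => hcv; rewrite pmulr_llt0 //.
  by move: h2; rewrite nmulr_lgt0 // subr_lt0; lra.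
move=> g; have [ha hb hab] := g.
have am := ha m (mem_head _ _); have bm := hb m (mem_head _ _).
(* If [l_m] keeps its sign, it constrains no crossing when positive and forbids all of them when
   negative. *)
have same : 0 < a m * b m -> crossing_formula a b (m :: s).
  move=> abm.
  have g' : cross_generic a b s.
    have sub v : v \in s -> v \in m :: s by rewrite inE orbC => ->.
    by split=> [v /sub/ha|v /sub/hb|v w /sub vs /sub ws] //; apply: hab.
  rewrite /crossing_formula big_cons.
  have -> : cross a b (m :: s) m = false by rewrite /cross /= lt_gtF.
  rewrite mul0r add0r.
  have eqab : (0 < a m) = (0 < b m).
    exact: same_sign.
  rewrite /= eqab; case: (boolP (0 < b m)) => hm /=.
    have am0 : 0 < a m by rewrite eqab.
    have := IH a b us g'; rewrite /crossing_formula => ->.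
    rewrite !big_seq; apply: eq_bigr => v vs; congr (_%:Z * _).
    have vm : v != m by apply: contraNneq ms => <-.
    rewrite /cross /= [m == v]eq_sym (negbTE vm) /=.
    case: (boolP (a v * b v < 0)) => //= h.
    suff -> : 0 < (a v * b m - a m * b v) * (a v - b v) by [].
    have : a v * a v > 0 by rewrite -expr2 exprn_even_gt0 //= ha // inE vs orbT.
    have : b v * b v > 0 by rewrite -expr2 exprn_even_gt0 //= hb // inE vs orbT.
    have -> : (a v * b m - a m * b v) * (a v - b v) =
      b m * (a v * a v) + a m * (b v * b v) - (a m + b m) * (a v * b v) by ring.
    move=> h1 h2.
    have := mulr_gt0 hm h2; have := mulr_gt0 am0 h1.
    have : (a m + b m) * (a v * b v) < 0 by rewrite pmulr_rlt0 //; lra.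
    lra.
  rewrite subrr big_seq big1 // => v vs.
  have vm : v != m by apply: contraNneq ms => <-.
  rewrite /cross /= [m == v]eq_sym (negbTE vm) /=.
  case: (boolP (a v * b v < 0)) => //= h; last by rewrite mul0r.
  suff -> : 0 < (a v * b m - a m * b v) * (a v - b v) = false by rewrite mul0r.
  apply/negbTE; rewrite -leNgt.
  have -> : (a v * b m - a m * b v) * (a v - b v) =
      b m * (a v * a v) + a m * (b v * b v) - (a m + b m) * (a v * b v) by ring.
  have hb0 : b m < 0 by case: (ltgtP (b m) 0) bm hm.
  have ha0 : a m < 0 by case: (ltgtP (a m) 0) am eqab hm => // _ _ <-.
  have h1 : 0 <= a v * a v by rewrite -expr2 sqr_ge0.
  have h2 : 0 <= b v * b v by rewrite -expr2 sqr_ge0.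
  have : b m * (a v * a v) <= 0 by rewrite nmulr_rle0.
  have : a m * (b v * b v) <= 0 by rewrite nmulr_rle0.
  have : 0 < (a m + b m) * (a v * b v) by rewrite nmulr_rgt0 //; lra.
  lra.
case: (ltgtP (a m) 0) am => // am _; case: (ltgtP (b m) 0) bm => // bm _.
- by apply: same; rewrite nmulr_rgt0.
- exact: base.
- by apply: cross_sum_swap => //; apply: base => //; exact: cross_generic_swap.
- by apply: same; rewrite pmulr_rgt0.
Qed.

End Crossing.

(** * Covering numbers *)

Section Simplices.
Variables (R : realFieldType) (n : nat) (I : finType).
Variables (pt : I -> 'rV[R]_n) (h : {set I} -> 'cV[R]_n * R).
Hypothesis h_facet : forall (f : {set I}) v, #|f| = n -> v \in f -> affv (h f) (pt v) = 0.
Implicit Types (G f : {set I}) (v w : I) (x y z : 'rV[R]_n) (s : seq {set I}).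

Definition nondeg G : bool :=
  (#|G| == n.+1) && [forall (v | v \in G), affv (h (G :\ v)) (pt v) != 0].

(** The facet form, scaled to be 1 at the opposite vertex, is the barycentric coordinate of that
    vertex. *)
Definition bary G v : 'cV[R]_n * R := affZ (affv (h (G :\ v)) (pt v))^-1 (h (G :\ v)).

Lemma nondeg_card G : nondeg G -> #|G| = n.+1.
Proof. by case/andP => /eqP. Qed.

Lemma nondeg_neq G v : nondeg G -> v \in G -> affv (h (G :\ v)) (pt v) != 0.
Proof. by case/andP => _ /'forall_implyP; apply. Qed.

Lemma card_facet G v : nondeg G -> v \in G -> #|G :\ v| = n.
Proof. by move=> /nondeg_card; rewrite (cardsD1 v) => + vG; rewrite vG => -[]. Qed.

Lemma baryE G v x : affv (bary G v) x = affv (h (G :\ v)) x / affv (h (G :\ v)) (pt v).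
Proof. by rewrite affvZ mulrC. Qed.

Lemma bary_dual G v w : nondeg G -> v \in G -> w \in G ->
  affv (bary G v) (pt w) = (v == w)%:R.
Proof.
move=> nG vG wG; rewrite baryE; case: eqVneq => [<-|vw]; first by rewrite divff ?nondeg_neq.
by rewrite h_facet ?mul0r ?card_facet // !inE eq_sym vw wG.
Qed.

Definition lift x : 'rV[R]_(1 + n) := row_mx 1%:M x.

Lemma affv_lift (u : 'cV[R]_n * R) x : affv u x = (lift x *m col_mx u.2%:M u.1) 0 0.
Proof. by rewrite mul_row_col mul1mx [RHS]mxE [X in _ = X + _]mxE eqxx mulr1n addrC. Qed.

(** Duality says that the matrix of lifted vertices times the matrix of barycentric forms is the
    identity. A one-sided inverse of a square matrix is two-sided, and the other product is the
    claim. *)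
Lemma bary_rep G x : nondeg G ->
  \sum_(v in G) affv (bary G v) x *: pt v = x /\ \sum_(v in G) affv (bary G v) x = 1.
Proof.
move=> nG; have cG := nondeg_card nG.
pose ev (i : 'I_n.+1) : I := enum_val (cast_ord (esym cG) i).
have evG i : ev i \in G by rewrite /ev enum_valP.
have ev_inj : injective ev by move=> i j /enum_val_inj /cast_ord_inj.
pose M : 'M[R]_n.+1 := \matrix_i (lift (pt (ev i)) : 'rV_n.+1).
pose L : 'M[R]_n.+1 := (\matrix_j (col_mx (bary G (ev j)).2%:M (bary G (ev j)).1)^T)^T.
have ML : M *m L = 1%:M.
  apply/matrixP => i j; rewrite !mxE.
  transitivity (affv (bary G (ev j)) (pt (ev i))).
    by rewrite affv_lift !mxE; apply: eq_bigr => k _; rewrite !mxE.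
  by rewrite bary_dual // eq_sym (inj_eq ev_inj).
have /mulmx1C LM := ML.
have key : \sum_i affv (bary G (ev i)) x *: lift (pt (ev i)) = lift x.
  have -> : lift x = lift x *m L *m M by rewrite -mulmxA LM mulmx1.
  rewrite [RHS]mulmx_sum_row; apply: eq_bigr => i _; rewrite rowK; congr (_ *: _).
  by rewrite affv_lift !mxE; apply: eq_bigr => k _; rewrite !mxE.
have reidx (V : nmodType) (F : I -> V) : \sum_(v in G) F v = \sum_i F (ev i).
  rewrite (reindex_onto ev (fun v => cast_ord cG (enum_rank_in (evG ord0) v))) /=.
    by apply: eq_bigl => i; rewrite evG /ev enum_valK_in cast_ordKV eqxx.
  by move=> v vG; rewrite /ev cast_ordK enum_rankK_in.
split.
  have := congr1 rsubmx key; rewrite row_mxKr => e; rewrite -[RHS]e.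
  by rewrite reidx raddf_sum /=; apply: eq_bigr => i _; rewrite /lift scale_row_mx row_mxKr.
have := congr1 (fun A : 'rV_(1 + n) => lsubmx A 0 0) key.
rewrite /= row_mxKl [X in _ = X]mxE eqxx mulr1n => e; rewrite -[RHS]e.
rewrite reidx raddf_sum /= summxE; apply: eq_bigr => i _.
by rewrite /lift scale_row_mx row_mxKl !mxE eqxx mulr1.
Qed.

Lemma bary_uniq G (w : I -> R) v : nondeg G -> v \in G ->
  \sum_(u in G) w u = 1 -> affv (bary G v) (\sum_(u in G) w u *: pt u) = w v.
Proof.
move=> nG vG w1.
pose w' u := if u \in G then w u else 0.
have -> : \sum_(u in G) w u *: pt u = \sum_u w' u *: pt u.
  rewrite [LHS]big_mkcond; apply: eq_bigr => u _.
  by rewrite /w'; case: ifP => // _; rewrite scale0r.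
rewrite affv_sum; last by rewrite /w' -big_mkcond.
rewrite (bigD1 v) //= big1 => [|u uv]; first by rewrite /w' vG bary_dual // eqxx mulr1 addr0.
rewrite /w'; case: ifP => uG; last by rewrite mul0r.
by rewrite bary_dual // eq_sym (negbTE uv) mulr0.
Qed.

Definition insx G x : bool := [forall (v | v \in G), 0 <= affv (bary G v) x].
Definition intx G x : bool := [forall (v | v \in G), 0 < affv (bary G v) x].

Lemma insxP G x : reflect (forall v, v \in G -> 0 <= affv (bary G v) x) (insx G x).
Proof. exact: 'forall_implyP. Qed.
Lemma intxP G x : reflect (forall v, v \in G -> 0 < affv (bary G v) x) (intx G x).
Proof. exact: 'forall_implyP. Qed.

Definition generic x := forall G v, nondeg G -> v \in G -> affv (bary G v) x != 0.

Definition generic_pair y z := [/\ generic y, generic z &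
  forall G v w, nondeg G -> v \in G -> w \in G -> v != w ->
    affv (bary G v) y * affv (bary G w) z - affv (bary G w) y * affv (bary G v) z != 0].

Lemma insx_generic G x : generic x -> nondeg G -> insx G x = intx G x.
Proof.
move=> gx nG; apply: eq_forallb => v; case: (boolP (v \in G)) => //= vG.
by rewrite le_eqVlt eq_sym (negbTE (gx _ _ nG vG)).
Qed.

Definition cov s x := count (fun G => insx G x) s.

Definition onside f (sg : bool) G : bool :=
  [exists (v | v \in G), (G :\ v == f) && ((0 < affv (h f) (pt v)) == sg)].

Definition nside s f sg := count (onside f sg) s.

Lemma setD1_inj_in G v w : v \in G -> w \in G -> G :\ v = G :\ w -> v = w.
Proof.
move=> vG wG e; apply/eqP; apply: contraTT isT => vw.
have : v \in G :\ w by rewrite !inE vw.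
by rewrite -e !inE eqxx.
Qed.

Lemma onsideP f sg G : reflect
  (exists2 v, v \in G & G :\ v = f /\ (0 < affv (h f) (pt v)) = sg) (onside f sg G).
Proof.
apply: (iffP exists_inP) => [[v vG /andP[/eqP e /eqP e']]|[v vG [e e']]]; exists v => //.
by rewrite e e' !eqxx.
Qed.

Lemma onside_sum G (T : {set I} -> bool -> int) :
  \sum_(v in G) T (G :\ v) (0 < affv (h (G :\ v)) (pt v)) =
  \sum_f \sum_sg (onside f sg G)%:Z * T f sg.
Proof.
have E f sg : (onside f sg G)%:Z =
    \sum_(v in G) ((G :\ v == f) && ((0 < affv (h f) (pt v)) == sg))%:Z.
  case: onsideP => [[v vG [e e']]|no].
    rewrite (bigD1 v) //= e e' !eqxx /= big1 ?addr0 // => w /andP[wG wv].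
    case: eqVneq => //= ew; case/eqP: wv; apply: (setD1_inj_in wG vG); by rewrite e.
  rewrite big1 // => v vG; case: eqVneq => //= e; case: eqVneq => //= e'.
  by case: no; exists v.
symmetry; under eq_bigr => f _ do under eq_bigr => sg _ do rewrite E mulr_suml.
under eq_bigr => f _ do rewrite exchange_big /=.
rewrite exchange_big /=; apply: eq_bigr => v vG.
rewrite (bigD1 (G :\ v)) //= [X in _ + X]big1 ?addr0; last first.
  by move=> f fv; rewrite big1 // => sg _; rewrite eq_sym (negbTE fv) mul0r.
rewrite (bigD1 (0 < affv (h (G :\ v)) (pt v))) //= !eqxx mul1r big1 ?addr0 //.
by move=> sg sv; rewrite [X in _ && X]eq_sym (negbTE sv) andbF mul0r.
Qed.

Section Segment.
Variables y z : 'rV[R]_n.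

Definition hit f : 'rV[R]_n :=
  seg y z (affv (h f) y / (affv (h f) y - affv (h f) z)).

Definition crossG G v : bool :=
  cross (fun w => affv (bary G w) y) (fun w => affv (bary G w) z) (enum G) v.

Lemma hit0 f : affv (h f) y * affv (h f) z < 0 -> affv (h f) (hit f) = 0.
Proof.
move=> hyz; rewrite affv_seg.
have d0 : affv (h f) y - affv (h f) z != 0.
  by apply: contraTneq hyz => /eqP; rewrite subr_eq0 => /eqP ->; rewrite -leNgt -expr2 sqr_ge0.
by field.
Qed.

Lemma bary_cross_sign G v : nondeg G -> v \in G ->
  (affv (bary G v) y * affv (bary G v) z < 0) =
  (affv (h (G :\ v)) y * affv (h (G :\ v)) z < 0).
Proof.
move=> nG vG; rewrite !baryE; have := nondeg_neq nG vG.
set c := affv _ (pt v) => c0; rewrite mulrACA pmulr_llt0 //.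
by rewrite -expr2 exprn_even_gt0 //= invr_neq0.
Qed.

(** Up to a positive square factor, the determinant condition in [cross] is the barycentric
    coordinate of [w] at the point where the segment meets the facet hyperplane. *)
Lemma crossGE G v : nondeg G -> v \in G ->
  crossG G v = (affv (h (G :\ v)) y * affv (h (G :\ v)) z < 0) &&
    [forall (w | w \in G :\ v), 0 < affv (bary G w) (hit (G :\ v))].
Proof.
move=> nG vG; rewrite /crossG /cross bary_cross_sign //.
case: (boolP (affv (h (G :\ v)) y * _ < 0)) => //= hyz.
set hy := affv (h (G :\ v)) y in hyz *; set hz := affv (h (G :\ v)) z in hyz *.
have d0 : hy - hz != 0.
  by apply: contraTneq hyz => /eqP; rewrite subr_eq0 => /eqP ->; rewrite -leNgt -expr2 sqr_ge0.
have c0 := nondeg_neq nG vG; set c := affv (h (G :\ v)) (pt v) in c0.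
have E w : (0 < (affv (bary G v) y * affv (bary G w) z - affv (bary G w) y * affv (bary G v) z)
    * (affv (bary G v) y - affv (bary G v) z)) = (0 < affv (bary G w) (hit (G :\ v))).
  have k0 : 0 < ((hy - hz) / c) ^+ 2 by rewrite exprn_even_gt0 //= mulf_neq0 // invr_neq0.
  rewrite -(pmulr_lgt0 (affv (bary G w) (hit (G :\ v))) k0); congr (0 < _).
  rewrite ![affv (bary G v) _]baryE affv_seg -/hy -/hz -/c.
  by field; rewrite c0 d0.
apply/allP/'forall_implyP => [H w|H w].
  by rewrite !inE => /andP[wv wG]; have := H w; rewrite mem_enum (negbTE wv) E; apply.
rewrite mem_enum => wG; rewrite E; case: eqVneq => //= wv.
by apply: H; rewrite !inE wv.
Qed.

(** A point of the hyperplane of the common facet is an affine combination of the vertices of that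
    facet, and barycentric coordinates in [G'] are unique. *)
Lemma bary_common G G' v v' q w : nondeg G -> nondeg G' -> v \in G -> v' \in G' ->
  G :\ v = G' :\ v' -> affv (h (G :\ v)) q = 0 -> w \in G :\ v ->
  affv (bary G' w) q = affv (bary G w) q.
Proof.
move=> nG nG' vG vG' e q0 wf.
have qv : affv (bary G v) q = 0 by rewrite baryE q0 mul0r.
have [qE q1] := bary_rep q nG.
rewrite -{1}qE (bigD1 v) //= qv scale0r add0r.
have q1' : \sum_(u in G :\ v) affv (bary G u) q = 1.
  by rewrite -q1 [RHS](bigD1 v) //= qv add0r; apply: eq_bigl => u; rewrite !inE andbC.
pose w0 u := if u \in G :\ v then affv (bary G u) q else 0.
have sub u : u \in G :\ v -> u \in G' by rewrite e !inE => /andP[].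
have big2 (V : nmodType) (F : I -> V) :
   (forall u, u \in G' -> u \notin G :\ v -> F u = 0) ->
   \sum_(u in G :\ v) F u = \sum_(u in G') F u.
  move=> F0; rewrite [RHS](bigID (mem (G :\ v))) /= [X in _ + X]big1 ?addr0.
    by apply: eq_bigl => u; case: (boolP (u \in G :\ v)) => [/sub->|]; rewrite ?andbF.
  by move=> u /andP[]; exact: F0.
have -> : \sum_(i in G | i != v) affv (bary G i) q *: pt i = \sum_(u in G') w0 u *: pt u.
  rewrite -big2; last by move=> u _ /negbTE uf; rewrite /w0 uf scale0r.
  rewrite (eq_bigl (mem (G :\ v))); last by move=> u; rewrite !inE andbC.
  by apply: eq_bigr => u uf; rewrite /w0 (uf : u \in G :\ v).
rewrite bary_uniq ?sub //; first by rewrite /w0 wf.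
rewrite -big2; last by move=> u _ /negbTE uf; rewrite /w0 uf.
by rewrite -q1'; apply: eq_bigr => u uf; rewrite /w0 uf.
Qed.

(** Being crossed belongs to the facet and not to the simplex that carries it; this allows the
    crossings of all simplices to be regrouped by facets. *)
Definition crossf f : bool :=
  [exists G, nondeg G && [exists (v | v \in G), (G :\ v == f) && crossG G v]].

Lemma crossG_crossf G v : nondeg G -> v \in G -> crossG G v = crossf (G :\ v).
Proof.
move=> nG vG; apply/idP/existsP => [c|[G' /andP[nG' /exists_inP[v' v'G' /andP[/eqP e]]]]].
  by exists G; rewrite nG; apply/exists_inP; exists v => //; rewrite eqxx.
rewrite !crossGE // -e => /andP[hyz /'forall_implyP H]; rewrite hyz /=.
apply/'forall_implyP => w wf; rewrite (@bary_common G' G v' v) ?hit0 //; exact: H.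
Qed.

Lemma gsign_bary G v : generic z -> nondeg G -> v \in G ->
  gsign (affv (bary G v) z) =
  if (0 < affv (h (G :\ v)) (pt v)) == (0 < affv (h (G :\ v)) z) then 1 else -1.
Proof.
move=> gz nG vG; have := gz _ _ nG vG; rewrite /gsign baryE; have := nondeg_neq nG vG.
set c := affv _ (pt v); set d := affv _ z; rewrite mulf_eq0 negb_or => c0 /andP[d0 _].
case: (ltgtP c 0) c0 => // c0 _; case: (ltgtP d 0) d0 => // d0 _ /=.
- by rewrite nmulr_rgt0 // invr_lt0 c0.
- by rewrite pmulr_rgt0 // invr_gt0 lt_gtF.
- by rewrite nmulr_rgt0 // invr_lt0 lt_gtF.
- by rewrite pmulr_rgt0 // invr_gt0 c0.
Qed.

(* Each facet crossed by the segment changes the covering number by the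
   difference between the numbers of simplices on its two sides. *)
Lemma cov_invariant s : generic_pair y z -> {in s, forall G, nondeg G} ->
  (forall G v, G \in s -> v \in G -> crossG G v ->
     nside s (G :\ v) true = nside s (G :\ v) false) ->
  cov s y = cov s z.
Proof.
move=> [gy gz gyz] nds bal; suff : (cov s z)%:Z - (cov s y)%:Z = 0 by move/eqP;
  rewrite subr_eq0 => /eqP [->].
have covE x : generic x ->
    (cov s x)%:Z = \sum_(G <- s) (all (fun v => 0 < affv (bary G v) x) (enum G))%:Z.
  move=> gx; rewrite /cov -sum1_count big_mkcond /= -[LHS]natz natr_sum.
  rewrite !big_seq; apply: eq_bigr => G Gs; rewrite insx_generic // ?nds //.
  have -> : all (fun v => 0 < affv (bary G v) x) (enum G) = intx G x.
    by apply/allP/intxP => H v vG; apply: H; rewrite ?mem_enum // -mem_enum.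
  by case: (intx G x).
rewrite !covE // -sumrB.
(* The contribution of a simplex on side [sg] of a crossed facet: it is entered if [z] lies on that
   side and left otherwise. *)
pose T f (sg : bool) : int := (crossf f)%:Z * (if sg == (0 < affv (h f) z) then 1 else -1).
have -> : \sum_(G <- s) ((all (fun v => 0 < affv (bary G v) z) (enum G))%:Z
     - (all (fun v => 0 < affv (bary G v) y) (enum G))%:Z)
   = \sum_(G <- s) \sum_f \sum_sg (onside f sg G)%:Z * T f sg.
  rewrite !big_seq; apply: eq_bigr => G Gs; have nG := nds _ Gs.
  rewrite -onside_sum.
  rewrite (@crossing_sum _ _ (fun w => affv (bary G w) y) (fun w => affv (bary G w) z)) ?enum_uniq //.
    rewrite big_enum /=; apply: eq_bigr => v vG.
    by rewrite -/(crossG G v) crossG_crossf // gsign_bary.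
  split=> [v|v|v w]; rewrite ?mem_enum => vG; [exact: gy|exact: gz|].
  by move=> wG; exact: gyz.
rewrite exchange_big big1 //= => f _; rewrite exchange_big /=.
have E sg : \sum_(G <- s) (onside f sg G)%:Z * T f sg = (nside s f sg)%:Z * T f sg.
  rewrite -mulr_suml; congr (_ * _); rewrite /nside -sum1_count.
  by rewrite -[RHS]natz natr_sum [RHS]big_mkcond /=; apply: eq_bigr => G _; case: onside.
under eq_bigr do rewrite E.
rewrite (bigD1 true) //= (bigD1 false) //= big1 ?addr0; last by case.
case: (boolP (crossf f)) => cf; last by rewrite /T (negbTE cf) !mul0r !mulr0.
suff -> : nside s f true = nside s f false.
  by rewrite -mulrDr /T -mulrDr; case: (0 < _) => /=; rewrite ?subrr ?addNr !mulr0.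
have none : (forall G v, G \in s -> v \in G -> G :\ v <> f) -> forall sg, nside s f sg = 0%N.
  move=> H sg; apply/eqP; rewrite -leqn0 leqNgt -has_count; apply/hasPn => G Gs.
  by apply/negP => /onsideP[v vG [e _]]; exact: (H G v).
case: (boolP (has (fun G => [exists (v | v \in G), G :\ v == f]) s)) => [/hasP[G Gs]|/hasPn H].
  move=> /exists_inP[v vG /eqP e]; rewrite -e; apply: bal => //.
  by rewrite crossG_crossf ?nds // e.
have N G v : G \in s -> v \in G -> G :\ v <> f.
  by move=> Gs vG e; move/(_ G Gs): H => /exists_inP; apply; exists v => //; rewrite e.
by rewrite !none.
Qed.

End Segment.

End Simplices.

(** * Balanced sets cover the polytope and intersect properly *)

Section Cover.
Variables (R : realFieldType) (n : nat) (I : finType).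
Variables (pt : I -> 'rV[R]_n) (h : {set I} -> 'cV[R]_n * R).
Hypothesis h_facet : forall (f : {set I}) v, #|f| = n -> v \in f -> affv (h f) (pt v) = 0.
Implicit Types (F G f : {set I}) (v w : I) (x y z : 'rV[R]_n) (s : seq {set I}).
Local Notation nondeg := (nondeg pt h).
Local Notation bary := (bary pt h).
Local Notation insx := (insx pt h).
Local Notation intx := (intx pt h).
Local Notation generic := (generic pt h).
Local Notation generic_pair := (generic_pair pt h).
Local Notation cov := (cov pt h).
Local Notation nside := (nside pt h).

Definition hull F x := exists w : I -> R,
  [/\ forall i, 0 <= w i, forall i, i \notin F -> w i = 0, \sum_i w i = 1
    & x = \sum_i w i *: pt i].

Lemma hull_pt F v : v \in F -> hull F (pt v).
Proof.
move=> vF; exists (fun i => (i == v)%:R); split.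
- by move=> i; rewrite ler0n.
- by move=> i iF; case: eqVneq iF => // ->; rewrite vF.
- by rewrite (bigD1 v) //= eqxx big1 ?addr0 // => i /negbTE ->.
- rewrite (bigD1 v) //= eqxx scale1r big1 ?addr0 // => i /negbTE ->; exact: scale0r.
Qed.

Lemma hull_seg F x y t : 0 <= t <= 1 -> hull F x -> hull F y -> hull F (seg x y t).
Proof.
move=> /andP[t0 t1] [w [w0 wF w1 ->]] [w' [w'0 w'F w'1 ->]].
exists (fun i => (1 - t) * w i + t * w' i); split.
- by move=> i; rewrite addr_ge0 // mulr_ge0 // subr_ge0.
- by move=> i iF; rewrite wF // w'F // !mulr0 addr0.
- by rewrite big_split /= -!mulr_sumr w1 w'1; ring.
rewrite /seg !scaler_sumr -big_split; apply: eq_bigr => i _.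
by rewrite /= [RHS]scalerDl !scalerA.
Qed.

Lemma hull_sub F G x : F \subset G -> hull F x -> hull G x.
Proof.
move=> /fintype.subsetP FG [w [w0 wF w1 xE]]; exists w; split=> // i iG.
by apply: wF; apply: contra iG; exact: FG.
Qed.

Lemma affv_hull u F x : hull F x ->
  (forall v, v \in F -> 0 <= affv u (pt v)) -> 0 <= affv u x.
Proof.
move=> [w [w0 wF w1 ->]] H; rewrite affv_sum //; apply: sumr_ge0 => i _.
case: (boolP (i \in F)) => iF; first by rewrite mulr_ge0 // H.
by rewrite wF // mul0r.
Qed.

Lemma sum_set_ext (V : nmodType) F (g : I -> V) :
  (forall i, i \notin F -> g i = 0) -> \sum_i g i = \sum_(i in F) g i.
Proof. by move=> g0; rewrite [RHS]big_mkcond; apply: eq_bigr => i _; case: ifPn => // /g0. Qed.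

Lemma hull_insx G x : nondeg G -> hull G x <-> insx G x.
Proof.
move=> nG; split=> [cx|/insxP ix].
  apply/insxP => v vG; apply: affv_hull cx _ => w wG.
  by rewrite bary_dual // ler0n.
have [xE x1] := bary_rep h_facet x nG.
exists (fun i => if i \in G then affv (bary G i) x else 0); split.
- by move=> i; case: ifP => // /ix.
- by move=> i /negbTE ->.
- by rewrite -big_mkcond.
- rewrite -{1}xE big_mkcond; apply: eq_bigr => i _; case: ifP => // _; exact/esym/scale0r.
Qed.

Lemma insx_hull G x : nondeg G -> insx G x -> hull G x.
Proof. by move=> nG /(hull_insx _ nG). Qed.

Definition center G : 'rV[R]_n := \sum_(v in G) (n.+1%:R^-1) *: pt v.

Lemma bary_center G v : nondeg G -> v \in G -> affv (bary G v) (center G) = n.+1%:R^-1.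
Proof.
move=> nG vG; rewrite /center (bary_uniq h_facet (w := fun=> n.+1%:R^-1)) //.
by rewrite sumr_const (nondeg_card nG) -[_ *+ _]mulr_natr mulVf // pnatr_eq0.
Qed.

Lemma intx_insx G x : intx G x -> insx G x.
Proof. by move=> /intxP H; apply/insxP => v /H /ltW. Qed.

Let no_nil (u : 'cV[R]_n * R) : u \in [::] -> exists x, affv u x != 0.
Proof. by []. Qed.

Lemma avoid_in G (L : seq ('cV[R]_n * R)) : nondeg G ->
  (forall u, u \in L -> exists x, affv u x != 0) ->
  exists x, intx G x /\ forall u, u \in L -> affv u x != 0.
Proof.
move=> nG HL; have [a Ha] := affine_avoid (center G) HL.
have h1 : near0 (fun e => forall u, u \in L -> affv u (seg (center G) a e) != 0).
  apply: near0_all => u uL.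
  apply: near0_imp (near0_neq (a := affv u (center G)) (b := affv u a) _) => [e|].
    by rewrite affv_seg.
  by rewrite Ha ?orbT.
have h2 : near0 (fun e => forall v, v \in enum G -> 0 < affv (bary G v) (seg (center G) a e)).
  apply: near0_all => v; rewrite mem_enum => vG.
  apply: near0_imp (near0_pos (affv (bary G v) a) (_ : 0 < affv (bary G v) (center G))) => [e|].
    by rewrite affv_seg.
  by rewrite bary_center // invr_gt0 ltr0Sn.
have [e _ [H1 H2]] := near0_ex (near0_and h1 h2).
exists (seg (center G) a e); split=> //; apply/intxP => v vG; apply: H2; by rewrite mem_enum.
Qed.

Definition bary_list : seq ('cV[R]_n * R) :=
  [seq bary p.1 p.2 | p <- enum {: {set I} * I} & nondeg p.1 && (p.2 \in p.1)].

Lemma bary_listP G v : nondeg G -> v \in G -> bary G v \in bary_list.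
Proof.
move=> nG vG; apply/mapP; exists (G, v) => //=.
by rewrite mem_filter mem_enum inE /= nG vG.
Qed.

Lemma bary_list_neq0 u : u \in bary_list -> exists x, affv u x != 0.
Proof.
case/mapP=> -[G v]; rewrite mem_filter /= => /andP[/andP[nG vG] _] ->.
by exists (pt v); rewrite bary_dual // eqxx oner_neq0.
Qed.

(** With [y] fixed, the determinants in [generic_pair] are affine forms in the second point, so
    avoiding hyperplanes also makes a pair generic. *)
Definition pair_list y : seq ('cV[R]_n * R) :=
  [seq affD (affZ (affv (bary p.1 p.2.1) y) (bary p.1 p.2.2))
            (affZ (- affv (bary p.1 p.2.2) y) (bary p.1 p.2.1))
  | p <- enum {: {set I} * (I * I)} &
    [&& nondeg p.1, p.2.1 \in p.1, p.2.2 \in p.1 & p.2.1 != p.2.2]].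

Lemma affv_comb (c d : R) (u1 u2 : 'cV[R]_n * R) x :
  affv (affD (affZ c u1) (affZ d u2)) x = c * affv u1 x + d * affv u2 x.
Proof. by rewrite affvD !affvZ. Qed.

Lemma pair_list_neq0 y u : generic y -> u \in pair_list y -> exists x, affv u x != 0.
Proof.
move=> gy /mapP[[G [v w]]]; rewrite mem_filter /= => /andP[/and4P[nG vG wG vw] _] ->.
exists (pt w); rewrite affv_comb !bary_dual // eqxx (negbTE vw) mulr0 addr0 mulr1.
exact: gy.
Qed.

Lemma generic_pair_lists y x : generic y ->
  (forall u, u \in bary_list ++ pair_list y -> affv u x != 0) -> generic_pair y x.
Proof.
move=> gy H; split=> // [G v nG vG|G v w nG vG wG vw].
  by apply: H; rewrite mem_cat bary_listP.
have -> : affv (bary G v) y * affv (bary G w) x - affv (bary G w) y * affv (bary G v) x =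
  affv (affD (affZ (affv (bary G v) y) (bary G w)) (affZ (- affv (bary G w) y) (bary G v))) x.
  by rewrite affv_comb mulNr.
apply: H; rewrite mem_cat; apply/orP; right; apply/mapP; exists (G, (v, w)) => //=.
by rewrite mem_filter mem_enum inE /= nG vG wG vw.
Qed.

Lemma ex_generic_in G (L : seq ('cV[R]_n * R)) : nondeg G ->
  (forall u, u \in L -> exists x, affv u x != 0) ->
  exists x, [/\ intx G x, generic x & forall u, u \in L -> affv u x != 0].
Proof.
move=> nG HL; have [|x [ix Hx]] := avoid_in (L := bary_list ++ L) nG.
  by move=> u; rewrite mem_cat => /orP[/bary_list_neq0|/HL].
exists x; split=> // [G' v nG' vG'|u uL]; apply: Hx; rewrite mem_cat ?uL ?orbT //.
by rewrite bary_listP.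
Qed.

Lemma ex_generic_pair_in G y : nondeg G -> generic y ->
  exists x, intx G x /\ generic_pair y x.
Proof.
move=> nG gy; have [|x [ix Hx]] := avoid_in (L := bary_list ++ pair_list y) nG.
  by move=> u; rewrite mem_cat => /orP[/bary_list_neq0|/(pair_list_neq0 gy)].
by exists x; split=> //; exact: generic_pair_lists.
Qed.

Lemma ex_generic_pair2_in G y z : nondeg G -> generic y -> generic z ->
  exists x, [/\ intx G x, generic_pair y x & generic_pair z x].
Proof.
move=> nG gy gz.
have [|x [ix Hx]] := avoid_in (L := (bary_list ++ pair_list y) ++ pair_list z) nG.
  by move=> u; rewrite !mem_cat => /orP[/orP[/bary_list_neq0|/(pair_list_neq0 gy)]|/(pair_list_neq0
    gz)].
exists x; split=> //; apply: generic_pair_lists => // u uL; apply: Hx.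
  by rewrite mem_cat uL.
by move: uL; rewrite !mem_cat => /orP[] ->; rewrite ?orbT.
Qed.

Lemma near0_generic x a : generic a -> near0 (fun e => generic (seg x a e)).
Proof.
move=> ga.
have H : near0 (fun e => forall u, u \in bary_list -> affv u (seg x a e) != 0).
  apply: near0_all => u /mapP[[G v]]; rewrite mem_filter /= => /andP[/andP[nG vG] _] ->.
  apply: near0_imp (near0_neq (a := affv (bary G v) x) (b := affv (bary G v) a) _) => [e|].
    by rewrite affv_seg.
  by rewrite ga // orbT.
by apply: near0_imp H => e H G v nG vG; apply: H; exact: bary_listP.
Qed.

Lemma near0_generic_pair x a b : generic_pair a b ->
  near0 (fun e => generic_pair (seg x a e) (seg x b e)).
Proof.
move=> [ga gb gab].
pose J : finType := ({set I} * (I * I))%type.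
have H : near0 (fun e => forall p : J,
   nondeg p.1 && (p.2.1 \in p.1) && (p.2.2 \in p.1) && (p.2.1 != p.2.2) ->
   affv (bary p.1 p.2.1) (seg x a e) * affv (bary p.1 p.2.2) (seg x b e) -
   affv (bary p.1 p.2.2) (seg x a e) * affv (bary p.1 p.2.1) (seg x b e) != 0).
  apply: near0_allT => -[G [v w]] /=.
  case: (boolP (nondeg G && _ && _ && _)) => [|_]; last by apply: near0_T.
  move=> /andP[/andP[/andP[nG vG] wG] vw].
  set p := affv (bary G v) x; set q := affv (bary G w) x.
  set av := affv (bary G v) a; set aw := affv (bary G w) a.
  set bv := affv (bary G v) b; set bw := affv (bary G w) b.
  (* At the shifted points the determinant is [e] times an affine function of [e] whose value at 1
     is the determinant of the pair [a], [b]; that function is nonzero for small [e]. *)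
  have B0 : (p * bw + av * q - q * bv - aw * p != 0) || (av * bw - aw * bv != 0).
    by rewrite gab ?orbT.
  apply: near0_imp (near0_and (near0_lt ltr01) (near0_neq B0)) => e [/andP[e0 _] He] _.
  rewrite !affv_seg -/p -/q -/av -/aw -/bv -/bw.
  have -> : ((1 - e) * p + e * av) * ((1 - e) * q + e * bw) -
    ((1 - e) * q + e * aw) * ((1 - e) * p + e * bv) =
    e * ((1 - e) * (p * bw + av * q - q * bv - aw * p) + e * (av * bw - aw * bv)) by ring.
  by rewrite mulf_neq0 // gt_eqF.
apply: near0_imp (near0_and (near0_and (near0_generic x ga) (near0_generic x gb)) H).
move=> e [[g1 g2] g3]; split=> // G v w nG vG wG vw.
by apply: (g3 (G, (v, w))); rewrite /= nG vG wG.
Qed.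

Lemma near0_insx G x a : nondeg G -> near0 (fun e => insx G (seg x a e)) -> insx G x.
Proof.
move=> nG H; apply/insxP => v vG; apply: (@near0_ge0_lim _ _ (affv (bary G v) a)).
by apply: near0_imp H => e /insxP /(_ v vG); rewrite affv_seg.
Qed.

Lemma near0_insx_dec G x a :
  near0 (fun e => insx G (seg x a e)) \/ near0 (fun e => ~~ insx G (seg x a e)).
Proof.
have [H|H] : (forall v, v \in enum G -> near0 (fun e => 0 <= affv (bary G v) (seg x a e))) \/
   exists2 v, v \in G & near0 (fun e => affv (bary G v) (seg x a e) < 0).
  have: forall t : seq I, {subset t <= G} ->
    (forall v, v \in t -> near0 (fun e => 0 <= affv (bary G v) (seg x a e))) \/
    exists2 v, v \in G & near0 (fun e => affv (bary G v) (seg x a e) < 0).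
    elim=> [|u t IH] sub; first by left.
    have [ht|] := IH (fun v vt => sub v (mem_behead (s := u :: t) vt)); last by right.
    have [hu|hu] := near0_ge0_dec (affv (bary G u) x) (affv (bary G u) a).
      left=> v; rewrite inE => /predU1P[->|]; last exact: ht.
      by apply: near0_imp hu => e; rewrite affv_seg.
    right; exists u; first by apply: sub; exact: mem_head.
    by apply: near0_imp hu => e; rewrite affv_seg.
  by apply=> v; rewrite mem_enum.
  left; apply: near0_imp (near0_all H) => e He; apply/insxP => v vG.
  by apply: He; rewrite mem_enum.
case: H => v vG Hv; right; apply: near0_imp Hv => e Hv.
by apply/insxP => /(_ v vG); rewrite leNgt Hv.
Qed.

Definition interior_facet f : bool :=
  [exists v, 0 < affv (h f) (pt v)] && [exists v, affv (h f) (pt v) < 0].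

Lemma crossed_interior f y z : hull [set: I]%SET y -> hull [set: I]%SET z ->
  affv (h f) y * affv (h f) z < 0 -> interior_facet f.
Proof.
move=> Qy Qz; apply: contraTT; rewrite -leNgt negb_and !negb_exists.
have sgn (u : 'cV[R]_n * R) : (forall v, 0 <= affv u (pt v)) -> 0 <= affv u y * affv u z.
  by move=> H; apply: mulr_ge0; [apply: affv_hull Qy _|apply: affv_hull Qz _] => v _; exact: H.
case/orP => /forallP H; last by apply: sgn => v; rewrite leNgt H.
have := sgn (affZ (-1) (h f)); rewrite !affvZ !mulN1r mulrNN; apply=> v.
by rewrite affvZ mulN1r oppr_ge0 leNgt H.
Qed.

Definition balanced s := forall f, interior_facet f -> nside s f true = nside s f false.

Section Balanced.
Variables (s : seq {set I}) (p : 'rV[R]_n).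
Hypotheses (s_nondeg : {in s, forall G, nondeg G}) (s_bal : balanced s).
Hypotheses (p_generic : generic p) (p_in : hull [set: I]%SET p) (p_cov : cov s p = 1%N).

Lemma cov_pair y z : generic_pair y z -> hull [set: I]%SET y -> hull [set: I]%SET z ->
  cov s y = cov s z.
Proof.
move=> gyz Qy Qz; apply: (cov_invariant h_facet gyz s_nondeg) => G v Gs vG.
rewrite crossGE // ?s_nondeg // => /andP[c _].
by apply: s_bal; exact: crossed_interior c.
Qed.

Lemma s_ex : exists2 G, G \in s & insx G p.
Proof. by have : has (fun G => insx G p) s; [rewrite has_count -/(cov s p) p_cov|move/hasP]. Qed.

Lemma insx_setT G x : nondeg G -> insx G x -> hull [set: I]%SET x.
Proof. by move=> nG /(insx_hull nG); apply: hull_sub; rewrite finset.subsetT. Qed.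

(** The points [y] and [p] may fail to form a generic pair, so both are compared with a third
    point. *)
Lemma cov_generic y : generic y -> hull [set: I]%SET y -> cov s y = 1%N.
Proof.
move=> gy Qy; have [G Gs _] := s_ex; have nG := s_nondeg Gs.
have [x [ix gyx gpx]] := ex_generic_pair2_in nG gy p_generic.
have Qx : hull [set: I]%SET x by apply: (insx_setT nG); exact: intx_insx.
by rewrite (cov_pair gyx) // -(cov_pair gpx).
Qed.

(** If no simplex contained [x], then by closedness none would contain the generic points near [x]
    on a segment, yet each of these is covered once. *)
Lemma balanced_cover x : hull [set: I]%SET x -> exists2 G, G \in s & insx G x.
Proof.
move=> Qx; apply/hasP; apply/negPn/negP => /hasPn no.
have [G0 Gs0 _] := s_ex; have nG0 := s_nondeg Gs0.
have [a [ia ga _]] := @ex_generic_in G0 [::] nG0 (no_nil).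
have Qa : hull [set: I]%SET a by apply: (insx_setT nG0); exact: intx_insx.
have H : near0 (fun e => forall G, G \in s -> ~~ insx G (seg x a e)).
  apply: near0_all => G Gs; case: (near0_insx_dec G x a) => // /(near0_insx (s_nondeg Gs)) i.
  by move: (no G Gs); rewrite i.
have [e /andP[e0 e1] [ge He]] := near0_ex (near0_and (near0_generic x ga) H).
have : cov s (seg x a e) = 1%N.
  by apply: cov_generic => //; apply: hull_seg => //; rewrite !ltW.
move=> c; have : has (fun G => insx G (seg x a e)) s by rewrite has_count -/(cov s _) c.
by case/hasP => G Gs; rewrite (negbTE (He G Gs)).
Qed.

Lemma cov_uniq_at x F G : cov s x = 1%N -> F \in s -> G \in s ->
  insx F x -> insx G x -> F = G.
Proof.
rewrite /cov; elim: s => //= A t IH; rewrite !inE.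
case: (boolP (insx A x)) => iA; rewrite ?add1n ?add0n => c.
  have no B : B \in t -> insx B x -> False.
    move=> Bt iB; have : has (fun G => insx G x) t by apply/hasP; exists B.
    by rewrite has_count; case: c => ->.
  move=> /predU1P[->|Ft] /predU1P[->|Gt] iF iG //.
  - by case: (no G Gt iG).
  - by case: (no F Ft iF).
  - by case: (no F Ft iF).
move=> /predU1P[->|Ft] /predU1P[->|Gt] //; rewrite ?(negbTE iA) //; exact: IH.
Qed.

(** A repeated simplex would cover its own generic interior points at least twice. *)
Lemma s_uniq : uniq s.
Proof.
rewrite count_mem_uniq // => G; case: (boolP (G \in s)) => Gs; last exact/count_memPn.
have nG := s_nondeg Gs.
have [a [ia ga _]] := @ex_generic_in G [::] nG (no_nil).
have ca : cov s a = 1%N by apply: cov_generic => //; apply: (insx_setT nG); exact: intx_insx.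
apply/eqP; rewrite /= eqn_leq -has_count has_pred1 Gs andbT -ca; apply: sub_count => F /eqP ->.
exact: intx_insx.
Qed.

Lemma insx_seg G x y t : 0 <= t <= 1 -> nondeg G ->
  insx G x -> insx G y -> insx G (seg x y t).
Proof. by move=> t01 nG /(hull_insx _ nG) ? /(hull_insx _ nG) ?; apply/(hull_insx _ nG)/hull_seg. Qed.

(* Near x the simplices containing the carrier A of x in F are themselves
   balanced, because every facet crossed near x contains A; so they cover
   a neighbourhood of x, and G, which has x, must be one of them. *)
Lemma balanced_proper F G x v : F \in s -> G \in s -> insx F x -> insx G x ->
  v \in F -> 0 < affv (bary F v) x -> v \in G.
Proof.
move=> Fs Gs iF iG; have nF := s_nondeg Fs; have nG := s_nondeg Gs.
pose A := [set u in F | 0 < affv (bary F u) x].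
suff : A \subset G by move=> /fintype.subsetP AG vF xv; apply: AG; rewrite inE vF.
pose sA := [seq H : {set I} <- s | A \subset H].
have sAs : {subset sA <= s} by move=> H; rewrite mem_filter => /andP[].
have [a [ia ga _]] := @ex_generic_in F [::] nF (no_nil).
have [b [ib gab]] := ex_generic_pair_in nG ga.
(* For small [e], every barycentric coordinate that is nonzero at [x] keeps its sign at the points
   shifted toward [a] and [b]. *)
have loc : near0 (fun e => forall q : {set I} * I, nondeg q.1 -> q.2 \in q.1 ->
   affv (bary q.1 q.2) x != 0 ->
   0 < affv (bary q.1 q.2) x * affv (bary q.1 q.2) (seg x a e) /\
   0 < affv (bary q.1 q.2) x * affv (bary q.1 q.2) (seg x b e)).
  apply: near0_allT => -[H w] /=.
  case: (boolP (affv (bary H w) x != 0)) => [x0|_]; last by apply: near0_T.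
  have x2 : 0 < affv (bary H w) x * affv (bary H w) x by rewrite -expr2 exprn_even_gt0.
  have N c : near0 (fun e => 0 < affv (bary H w) x * affv (bary H w) (seg x c e)).
    apply: near0_imp (near0_pos (affv (bary H w) x * affv (bary H w) c) x2) => e.
    rewrite affv_seg; congr (0 < _); ring.
  by apply: near0_imp (near0_and (N a) (N b)) => e He.
have [e e01 [gp He]] := near0_ex (near0_and (near0_generic_pair x gab) loc).
have {e01} e01 : 0 <= e <= 1 by case/andP: e01 => /ltW -> /ltW.
set y := seg x a e in gp He *; set z := seg x b e in gp He *.
have iy : insx F y by apply: insx_seg => //; exact: intx_insx.
have iz : insx G z by apply: insx_seg => //; exact: intx_insx.
have Qy := insx_setT nF iy; have Qz := insx_setT nG iz.
(* By uniqueness, [x] has in each simplex containing [A] the same coordinates as in [F]. *)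
have xA H w : H \in sA -> w \in H -> affv (bary H w) x = if w \in A then affv (bary F w) x else 0.
  move=> HsA wH; have nH := s_nondeg (sAs _ HsA).
  move: HsA; rewrite mem_filter => /andP[/fintype.subsetP AH Hs].
  have [xE x1] := bary_rep h_facet x nF.
  pose w0 u := if u \in A then affv (bary F u) x else 0.
  have out u : u \in F -> u \notin A -> affv (bary F u) x = 0.
    rewrite inE => uF; rewrite uF /= -leNgt => le; apply/eqP; rewrite eq_le le.
    by move/insxP: iF; apply.
  have big2 (V : nmodType) (g1 g2 : I -> V) : (forall u, u \in A -> g1 u = g2 u) ->
     (forall u, u \in F -> u \notin A -> g1 u = 0) -> (forall u, u \notin A -> g2 u = 0) ->
     \sum_(u in F) g1 u = \sum_(u in H) g2 u.
    move=> e12 g10 g20; rewrite [LHS]big_mkcond [RHS]big_mkcond /=; apply: eq_bigr => u _.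
    case: (boolP (u \in A)) => uA; first by rewrite AH // e12 //; move: uA; rewrite inE => /andP[->].
    by rewrite g20 //; case: (boolP (u \in F)) => uF; rewrite ?g10 // if_same.
  have xE' : x = \sum_(u in H) w0 u *: pt u.
    rewrite -{1}xE; apply: big2 => [u uA|u uF uA|u uA]; rewrite /w0 ?uA ?(negbTE uA) ?scale0r //.
    by rewrite out // scale0r.
  rewrite {1}xE' (bary_uniq h_facet) // -x1; apply/esym/big2 => [u uA|u uF uA|u uA];
    by rewrite /w0 ?uA ?(negbTE uA) // out.
have balA H w : H \in sA -> w \in H -> crossG pt h y z H w ->
    nside sA (H :\ w) true = nside sA (H :\ w) false.
  move=> HsA wH; have nH := s_nondeg (sAs _ HsA); rewrite crossGE // => /andP[c _].
  (* The coordinate of a vertex in [A] is positive at [x], hence at [y] and [z], so its opposite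
     facet is not crossed. *)
  have wA : w \notin A.
    apply/negP => wA; have := xA H w HsA wH; rewrite wA => xw.
    have [|q1 q2] := He (H, w) nH wH; rewrite /=.
      by rewrite xw gt_eqF //; move: wA; rewrite inE => /andP[].
    move: c; rewrite -(bary_cross_sign y z nH wH) ltNge => /negP; apply.
    have xw0 : 0 < affv (bary H w) x by rewrite xw; move: wA; rewrite inE => /andP[].
    by move: q1 q2; rewrite !pmulr_rgt0 // => q1 q2; rewrite mulr_ge0 // ltW.
  have AH : A \subset H :\ w.
    rewrite subsetD1 wA andbT; by move: HsA; rewrite mem_filter => /andP[].
  (* The crossed facet contains [A], so all simplices having it belong to [sA]. *)
  have E sg : nside sA (H :\ w) sg = nside s (H :\ w) sg.
    rewrite /nside /sA count_filter; apply: eq_count => K /=.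
    case: onsideP => // -[u uK [Ku _]] /=; apply: (fintype.subset_trans AH); rewrite -Ku;
      exact: subD1set.
  by rewrite !E; apply: s_bal; apply: crossed_interior c.
have cyz : cov sA y = cov sA z.
  by apply: (cov_invariant h_facet gp) balA => H /sAs; exact: s_nondeg.
have : has (fun H => insx H z) sA.
  rewrite has_count -/(cov sA z) -cyz -has_count; apply/hasP; exists F => //.
  by rewrite mem_filter Fs andbT; apply/fintype.subsetP => u; rewrite inE => /andP[].
case/hasP => H HsA iHz.
have gz : generic z by case: gp.
have := cov_uniq_at (cov_generic gz Qz) (sAs _ HsA) Gs iHz iz.
by move=> <-; move: HsA; rewrite mem_filter => /andP[].
Qed.

End Balanced.
End Cover.

Local Close Scope ring_scope.

Lemma count_le1 (J : eqType) (P : pred J) (t : seq J) : uniq t ->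
  (forall a b, a \in t -> b \in t -> P a -> P b -> a = b) -> (count P t <= 1)%N.
Proof.
elim: t => //= a t IH /andP[at_ ut] H.
case: (boolP (P a)) => Pa; rewrite ?add0n ?add1n.
  rewrite ltnS leqn0 -leqn0 leqNgt -has_count; apply/hasPn => b bt; apply/negP => Pb.
  have := H a b (mem_head _ _); rewrite inE bt orbT => /(_ isT Pa Pb) e.
  by move: at_; rewrite e bt.
by apply: IH => // b c bt ct; apply: H; rewrite inE ?bt ?ct orbT.
Qed.

(** * Meaning of the tables *)

Section Bits.
Definition dec (s : seq bool) : {set 'I_16} := [set i : 'I_16 | nth false s i].
Definition enc (F : {set 'I_16}) : seq bool := [seq i \in F | i <- enum 'I_16].

Lemma size_enc F : size (enc F) = 16. Proof. by rewrite size_map size_enum_ord. Qed.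

Lemma nth_enc F (i : 'I_16) : nth false (enc F) i = (i \in F).
Proof. by rewrite (nth_map i) ?size_enum_ord // nth_ord_enum. Qed.

Lemma encK : cancel enc dec.
Proof. by move=> F; apply/setP => i; rewrite inE nth_enc. Qed.

Lemma decK s : size s = 16 -> enc (dec s) = s.
Proof.
move=> ss; apply: (@eq_from_nth _ false); rewrite size_enc ?ss // => i i16.
by rewrite (nth_enc _ (Ordinal i16)) inE.
Qed.

Lemma dec_inj s t : size s = 16 -> size t = 16 -> dec s = dec t -> s = t.
Proof. by move=> ss st e; rewrite -(decK ss) e decK. Qed.

Lemma count_enc F : count id (enc F) = #|F|.
Proof. by rewrite count_map cardE enumT -size_filter; congr size; apply: eq_filter. Qed.

Lemma card_dec s : size s = 16 -> #|dec s| = count id s.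
Proof. by move=> ss; rewrite -count_enc decK. Qed.

Lemma mem_draws16 k s : s \in draws 16 k -> size s = 16 /\ #|dec s| = k.
Proof. by rewrite mem_draws => /andP[/eqP ss /eqP c]; rewrite card_dec. Qed.

Lemma enc_draws (F : {set 'I_16}) k : #|F| = k -> enc F \in draws 16 k.
Proof. by move=> c; rewrite mem_draws size_enc count_enc c !eqxx. Qed.

Lemma size_set_false s i : (i < size s)%N -> size (set_nth false s i false) = size s.
Proof. by move=> h; rewrite size_set_nth; apply/maxn_idPr. Qed.

Lemma dec_set_nth s (i : 'I_16) : dec (set_nth false s i false) = dec s :\ i.
Proof.
apply/setP => j; rewrite !inE nth_set_nth /=.
by rewrite -val_eqE /=; case: eqP.
Qed.

Lemma enc_setD1 F i : enc (F :\ i) = set_nth false (enc F) i false.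
Proof.
by apply: dec_inj; rewrite ?size_enc ?size_set_false ?size_enc // dec_set_nth !encK.
Qed.

Lemma removals16 (A : Type) (d : A) (F : {set 'I_16}) (vs : seq A) : size vs = 16 ->
  removals (enc F) vs = [seq (enc (F :\ i), nth d vs i) | i : 'I_16 <- enum F].
Proof.
move=> sv; rewrite (removalsE d) ?size_enc ?sv // -val_enum_ord filter_map -map_comp.
have -> : enum F = [seq i <- enum 'I_16 | i \in F] by rewrite {1}/enum_mem -enumT.
rewrite (eq_filter (a1 := preim val _) (a2 := mem F)) => [|i]; last exact: nth_enc.
by apply: eq_map => i; rewrite /= enc_setD1.
Qed.
Lemma elems_mem (A : eqType) (d : A) s vs i : size s = size vs -> nth false s i ->
  nth d vs i \in elems s vs.
Proof.
elim: s vs i => [|b s IH] [|v vs] //= i; first by rewrite nth_nil.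
case: i => [|i] [e] /=; first by move=> ->; rewrite mem_head.
by move=> /(IH _ _ e) h1; case: b => //; rewrite inE h1 orbT.
Qed.

End Bits.

(* Keeps the unifier from evaluating [b]. *)
Variant checked (b : bool) : Prop := Checked of b.

Local Open Scope ring_scope.

Section Real.
Variable R : realFieldType.

Definition zr (z : Z) : R := (int_of_Z z)%:~R.

Lemma zrD x y : zr (Z.add x y) = zr x + zr y.
Proof. by rewrite /zr -intrD; congr (_%:~R); lia. Qed.
Lemma zrM x y : zr (Z.mul x y) = zr x * zr y.
Proof. by rewrite /zr -intrM; congr (_%:~R); lia. Qed.
Lemma zr0 : zr Z0 = 0. Proof. by []. Qed.
Lemma zr_pos z : (0 < zr z) = zpos z.
Proof. by rewrite /zr ltr0z; case: z => //= p; lia. Qed.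
Lemma zr_neg z : (zr z < 0) = zneg z.
Proof. by rewrite /zr ltrz0; case: z => //= p; lia. Qed.
Lemma zr_zero z : (zr z == 0) = zzero z.
Proof. by rewrite /zr intr_eq0; case: z => //= p; lia. Qed.

Definition haff (f : hform) : 'cV[R]_4 * R := (\col_k zr (nth Z0 f.2 k), zr f.1).
Definition ptz (x : seq Z) (d : Z) : 'rV[R]_4 := \row_k (zr (nth Z0 x k) / zr d).

Lemma affv_haff f x d : size f.2 = 4 -> size x = 4 -> ~~ zzero d ->
  affv (haff f) (ptz x d) = zr (hval f x d) / zr d.
Proof.
case: f => c [|n0 [|n1 [|n2 [|n3 []]]]] // _; case: x => [|x0 [|x1 [|x2 [|x3 []]]]] // _.
rewrite -zr_zero => d0; rewrite /affv /hval /= !mxE !big_ord_recl big_ord0 !mxE /=.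
by rewrite !zrD !zrM zr0; field.
Qed.

Definition pt (i : 'I_16) : 'rV[R]_4 := ptz (nth [::] verts i) (Zpos xH).
Definition pp : 'rV[R]_4 := ptz pnum pden.
Definition h (F : {set 'I_16}) : 'cV[R]_4 * R := haff (hform_of (enc F)).

Lemma size_hform s : size (hform_of s).2 = 4.
Proof.
rewrite /hform_of; move: (elems _ _) => l; rewrite /hyperplane_of.
by repeat match goal with |- context [match ?x with _ => _ end] => destruct x end.
Qed.

Lemma size_vert i : (i < 16)%N -> size (nth [::] verts i) = 4.
Proof.
move=> i16; rewrite (nth_map [::]) ?size_map //.
by have := mem_nth [::] (i16 : (i < size vbits)%N); rewrite mem_bitlists => /eqP.
Qed.

Lemma affv_pt F (i : 'I_16) : affv (h F) (pt i) = zr (hval (hform_of (enc F)) (nth [::] verts i)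
  (Zpos xH)).
Proof. by rewrite affv_haff ?size_hform ?size_vert // divr1. Qed.

Lemma affv_pp F : affv (h F) pp = zr (hval (hform_of (enc F)) pnum pden) / zr pden.
Proof. by rewrite affv_haff // size_hform. Qed.

Hypothesis f_ok : checked facets_ok.
Hypothesis s_ok : checked (all simplex_ok all_simplices).

Lemma h_facet (f : {set 'I_16}) v : #|f| = 4 -> v \in f -> affv (h f) (pt v) = 0.
Proof.
move=> cf vf; case: f_ok; rewrite /facets_ok => /allP H.
have /allP /(_ (nth [::] verts v)) := H _ (enc_draws cf).
rewrite affv_pt => h0; apply/eqP; rewrite zr_zero; apply: h0.
by apply: elems_mem; rewrite ?size_enc // nth_enc.
Qed.

Lemma htable_get f : f \in draws 16 4 -> pt_get (code f) htable = Some (hinfo f).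
Proof.
rewrite /htable; elim: (draws 16 4) => //= g l IH; rewrite inE pt_get_upd.
case: pos_eqP => [/code_inj -> //|ne] /predU1P[e|/IH //]; by rewrite e in ne.
Qed.

Definition fct (G : {set 'I_16}) i : facet :=
  mkfacet (enc (G :\ i)) (nth [::] verts i) (hinfo (enc (G :\ i))).

Lemma facets_ofE (G : {set 'I_16}) : #|G| = 5 ->
  facets_of htable (enc G) = [seq fct G i | i <- enum G].
Proof.
move=> cG; rewrite /facets_of (removals16 [::]) // -map_comp; apply/eq_in_map => i.
rewrite mem_enum => iG; rewrite /= htable_get //; apply: enc_draws.
by move: cG; rewrite (cardsD1 i) iG => -[].
Qed.

Lemma all_facets (G : {set 'I_16}) (a : pred facet) : #|G| = 5 ->
  all a (facets_of htable (enc G)) = [forall (i | i \in G), a (fct G i)].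
Proof.
move=> cG; rewrite facets_ofE // all_map; apply/allP/'forall_implyP => H i.
  by move=> iG; apply: H; rewrite mem_enum.
by rewrite mem_enum; exact: H.
Qed.

Definition simplex_of (G : {set 'I_16}) : simplex :=
  let it := item_table (item_list circuits) in
  mksimplex htable it (conflict_table it circuits) (enc G).

Lemma simplex_of_nd (G : {set 'I_16}) : #|G| = 5 -> s_nd (simplex_of G) = nondeg pt h G.
Proof.
move=> cG; rewrite /= all_facets // /nondeg cG eqxx /=; apply: eq_forallb => i.
by rewrite affv_pt zr_zero.
Qed.

Lemma simplex_all (a : pred simplex) (G : {set 'I_16}) : all a all_simplices -> #|G| = 5 ->
  a (simplex_of G).
Proof. by rewrite all_map => /allP H cG; apply: (H _ (enc_draws cG)). Qed.

Lemma pp_generic : generic pt h pp.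
Proof.
move=> G v nG vG; have cG := nondeg_card nG; case: s_ok => /simplex_all/(_ cG).
rewrite /simplex_ok simplex_of_nd // nG /= all_facets // => /'forall_implyP /(_ v vG) /= H.
rewrite baryE mulf_neq0 ?invr_neq0 ?(nondeg_neq nG vG) //.
by rewrite affv_pp mulf_neq0 ?invr_neq0 // zr_zero.
Qed.

Lemma simplex_of_cov (G : {set 'I_16}) : nondeg pt h G -> s_cov (simplex_of G) = insx pt h G pp.
Proof.
move=> nG; have cG := nondeg_card nG; rewrite /= all_facets //.
rewrite (insx_generic pp_generic nG); apply: eq_forallb => i; case: (boolP (i \in G)) => //= iG.
rewrite baryE affv_pp.
have := nondeg_neq nG iG; have := pp_generic nG iG.
rewrite baryE affv_pp affv_pt mulf_eq0 negb_or => /andP[].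
set a := hval _ _ (Zpos xH); set b := hval _ pnum pden; rewrite mulf_eq0 negb_or => /andP[b0 _] _ a0.
have d0 : 0 < zr pden by rewrite zr_pos.
rewrite -(zr_pos a) -(zr_pos b).
case: (ltgtP (zr a) 0) a0 => // a0 _; case: (ltgtP (zr b) 0) b0 => // b0 _.
- by rewrite nmulr_lgt0 ?invr_lt0 // pmulr_llt0 ?invr_gt0 // b0.
- by rewrite nmulr_lgt0 ?invr_lt0 // pmulr_llt0 ?invr_gt0 // lt_gtF.
- by rewrite pmulr_lgt0 ?invr_gt0 // pmulr_lgt0 ?invr_gt0 // lt_gtF.
- by rewrite pmulr_lgt0 ?invr_gt0 // pmulr_lgt0 ?invr_gt0 // b0.
Qed.

Lemma hinterior_interior f : hinterior (hform_of (enc f)) = interior_facet pt h f.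
Proof.
have E (a : Z -> bool) (b : R -> bool) : (forall z, b (zr z) = a z) ->
   has (fun v => a (hval (hform_of (enc f)) v (Zpos xH))) verts = [exists i, b (affv (h f) (pt i))].
  move=> ab; apply/hasP/existsP => [[v /(nthP [::])[i i16 <-]]|[i]].
    by move=> av; exists (Ordinal i16); rewrite affv_pt ab.
  by rewrite affv_pt ab => av; exists (nth [::] verts i) => //; apply: mem_nth.
rewrite /hinterior /interior_facet -(E zpos (fun x => 0 < x) zr_pos) -(E zneg (fun x => x < 0) zr_neg).
by case: has.
Qed.

Definition key (f : {set 'I_16}) (sg : bool) : positive := fkey (code (enc f)) sg.

Lemma enc_inj : injective enc. Proof. exact: can_inj encK. Qed.

Lemma key_inj f sg f' sg' : key f sg = key f' sg' -> f = f' /\ sg = sg'.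
Proof. by rewrite /key; case: sg; case: sg' => //= -[/code_inj /enc_inj]. Qed.

Lemma opp_key f sg : opp (key f sg) = key f (~~ sg). Proof. by case: sg. Qed.

Definition fac (G : {set 'I_16}) (k : positive) : bool :=
  [exists (i | i \in G), interior_facet pt h (G :\ i) &&
     pos_eqb k (key (G :\ i) (0 < affv (h (G :\ i)) (pt i)))].

Lemma facP (G : {set 'I_16}) k : reflect (exists2 i, i \in G & interior_facet pt h (G :\ i) /\
   k = key (G :\ i) (0 < affv (h (G :\ i)) (pt i))) (fac G k).
Proof.
apply: (iffP exists_inP) => [[i iG /andP[ii /pos_eqP e]]|[i iG [ii e]]]; exists i => //.
by rewrite ii; apply/pos_eqP.
Qed.

Lemma fac_key (G f : {set 'I_16}) sg : fac G (key f sg) = interior_facet pt h f && onside pt h f sg G.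
Proof.
apply/facP/andP => [[i iG [ii /key_inj[e ->]]]|[fi /onsideP[i iG [e e']]]].
  by rewrite e; split=> //; apply/onsideP; exists i.
by exists i => //; rewrite e e'.
Qed.

Lemma cnt_keys (G : {set 'I_16}) k : #|G| = 5 -> cnt k (s_keys (simplex_of G)) = fac G k.
Proof.
move=> cG; rewrite /= /keys_of facets_ofE //.
pose q i := interior_facet pt h (G :\ i) && pos_eqb k (key (G :\ i) (0 < affv (h (G :\ i)) (pt i))).
have -> : cnt k [seq fkey (f_code x) (zpos (f_apex x)) | x <- [seq fct G i | i <- enum G] & f_int x] =
   count q (enum G).
  rewrite /cnt count_map count_filter count_map; apply: eq_count => i /=.
  by rewrite andbC /q affv_pt zr_pos hinterior_interior.
have q1 : (count q (enum G) <= 1)%N.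
  apply: count_le1 (enum_uniq _) _ => i j; rewrite !mem_enum => iG jG /andP[_ /pos_eqP ki].
  move=> /andP[_ /pos_eqP kj]; have [e _] := key_inj (etrans (esym ki) kj).
  exact: setD1_inj_in iG jG e.
have -> : fac G k = has q (enum G).
  apply/exists_inP/hasP => [[i iG qi]|[i]]; first by exists i; rewrite ?mem_enum.
  by rewrite mem_enum; exists i.
by rewrite has_count; case: (count q _) q1 => [|[]].
Qed.
End Real.

Local Close Scope ring_scope.

(** * Circuits and conflicts between simplices *)

Fixpoint spread (s : seq bool) (w : seq nat) : seq nat :=
  if s is b :: s' then if b then head 0 w :: spread s' (behead w) else 0 :: spread s' w else [::].

Lemma nth_spread0 s w i : nth false s i = false -> nth 0 (spread s w) i = 0.
Proof. by elim: s w i => [|b s IH] w [|i] //=; case: b => //= /IH. Qed.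

Lemma sum_spread s w : count id s = size w ->
  \sum_(i < size s) nth 0 (spread s w) i = sumn w.
Proof.
elim: s w => [|b s IH] w /=; first by rewrite big_ord0; case: w.
rewrite big_ord_recl; case: b => /= [|/IH <-]; last by rewrite add0n.
by case: w => //= x w [/IH <-].
Qed.

Lemma nth_ladd (a b : seq nat) j : size a = size b -> nth 0 (ladd a b) j = nth 0 a j + nth 0 b j.
Proof. by elim: a b j => [|x a IH] [|y b] [|j] //= [/IH]. Qed.

Lemma size_ladd (a b : seq nat) : size a = size b -> size (ladd a b) = size a.
Proof. by elim: a b => [|x a IH] [|y b] //= [/IH ->]. Qed.

Lemma size_wsum w vs : all (fun v => size v == 4) vs -> size (wsum w vs) = 4.
Proof.
elim: w vs => [|x w IH] [|v vs] //= /andP[/eqP sv /IH e].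
by rewrite size_ladd size_map ?e ?sv.
Qed.

Lemma wsum_spread s w vs j : size s = size vs -> all (fun v => size v == 4) vs ->
  count id s = size w -> (j < 4)%N ->
  nth 0 (wsum w (elems s vs)) j = \sum_(i < size s) nth 0 (spread s w) i * nth 0 (nth [::] vs i) j.
Proof.
move=> + + + j4; elim: s w vs => [|b s IH] w [|v vs] //=.
  by rewrite big_ord0; case: w => // _ _ _; case: j j4 => [|[|[|[|]]]].
move=> [e] /andP[/eqP sv av]; rewrite big_ord_recl; case: b => /= h; last first.
  by rewrite mul0n add0n IH.
case: w h => //= x w [h].
have ae : all (fun v => size v == 4) (elems s vs).
  elim: s vs e av {IH h} => [|c s IH] [|u vs] //= [e] /andP[su av].
  by case: c => /=; rewrite ?su IH.
rewrite nth_ladd ?size_map ?sv ?size_wsum // IH // (nth_map 0) ?sv //.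
Qed.

Definition wok (t : nat) (w : wset) := [/\ size (w_bits w) = 16,
  count id (w_bits w) = size (w_wts w), sumn (w_wts w) = t
  & w_sum w = wsum (w_wts w) (elems (w_bits w) nverts)].

Lemma In_map (T U : Type) (f : T -> U) y l : List.In y (map f l) -> exists2 x, List.In x l & y = f x.
Proof. by elim: l => //= a l IH [<-|/IH[x ? ->]]; [exists a; auto|exists x; auto]. Qed.

Lemma In_mem (T : eqType) (x : T) l : List.In x l -> x \in l.
Proof. by elim: l => //= y l IH [->|/IH h]; rewrite inE ?eqxx ?h ?orbT. Qed.

Lemma wsets_ok k ws w t : size ws = k -> sumn ws = t -> List.In w (wsets k ws) -> wok t w.
Proof.
rewrite /wsets => sk st H; have [s sl ->] := In_map H; have := In_mem sl.
by rewrite mem_draws => /andP[/eqP ss /eqP cs]; split=> //=; rewrite cs sk.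
Qed.

Lemma nat_seq_eqP a b : nat_seq_eqb a b -> a = b.
Proof. by elim: a b => [|x a IH] [|y b] //=; case: eqnP => // -> /IH ->. Qed.

Lemma bits_disjointP a b i : bits_disjoint a b -> nth false a i -> nth false b i -> False.
Proof.
elim: a b i => [|x a IH] [|y b] [|i] //=; first by case: x; case: y.
by case: ifP => // _; exact: IH.
Qed.

Definition wcircuit t (c : wset * wset) := [/\ wok t c.1, wok t c.2, w_sum c.1 = w_sum c.2
  & forall i, nth false (w_bits c.1) i -> nth false (w_bits c.2) i -> False].

Lemma wcircuit_sym t c : wcircuit t c -> wcircuit t (c.2, c.1).
Proof. by move=> [? ? ? H]; split=> // i h1 h2; exact: (H i). Qed.

Lemma In_cat (T : Type) (x : T) l1 l2 : List.In x (l1 ++ l2) -> List.In x l1 \/ List.In x l2.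
Proof. by elim: l1 => /= [|y l IH]; [right|move=> [->|/IH[]]; auto]. Qed.

Lemma In_filter (T : Type) (a : pred T) x l : List.In x [seq y <- l | a y] -> List.In x l /\ a x.
Proof. by elim: l => //= y l IH; case: ifP => ay; [move=> [<-|/IH[]]|move/IH=> []]; auto. Qed.

Lemma wcircuits_ok t l1 l2 c : (forall w, List.In w l1 -> wok t w) ->
  (forall w, List.In w l2 -> wok t w) -> List.In c (wcircuits l1 l2) -> wcircuit t c.
Proof.
move=> + ok2; rewrite /wcircuits; elim: l1 => //= w l1 IH ok1 /(@In_cat _ _ _ _)[H|]; last first.
  by apply: IH => u ul; apply: ok1; right.
have [w2 /(@In_filter _ _ _ _)[w2l] + ->] := In_map H; case: ifP => // /nat_seq_eqP e d.
by split=> //=; [apply: ok1; left|exact: ok2|move=> i; exact: bits_disjointP].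
Qed.

Lemma wpairs_of_ok e2 e21 t3 c : (forall w, List.In w e2 -> wok 2 w) ->
  (forall w, List.In w e21 -> wok 3 w) -> (forall w, List.In w t3 -> wok 3 w) ->
  List.In c (wpairs_of e2 e21 t3) -> exists2 t, (0 < t)%N & wcircuit t c.
Proof.
move=> ok2 ok21 ok3; have ok23 c' : List.In c' (wcircuits e21 t3) -> wcircuit 3 c'.
  exact: wcircuits_ok.
rewrite /wpairs_of => /(@In_cat _ _ _ _)[H|/(@In_cat _ _ _ _)[H|H]].
- by exists 2; [|apply: wcircuits_ok H].
- by exists 3; [|exact: ok23].
- by have [c' /ok23/wcircuit_sym h ->] := In_map H; exists 3.
Qed.

Lemma wpairs_ok c : List.In c wpairs -> exists2 t, (0 < t)%N & wcircuit t c.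
Proof.
have ok2 w := @wsets_ok 2 [:: 1; 1] w 2 erefl erefl.
have ok21 w : List.In w (wsets 2 [:: 2; 1] ++ wsets 2 [:: 1; 2]) -> wok 3 w.
  move=> /(@In_cat _ _ _ _)[]; first exact: (@wsets_ok 2 [:: 2; 1] w 3 erefl erefl).
  exact: (@wsets_ok 2 [:: 1; 2] w 3 erefl erefl).
have ok3 w := @wsets_ok 3 [:: 1; 1; 1] w 3 erefl erefl.
rewrite /wpairs => H; exact (wpairs_of_ok ok2 ok21 ok3 H).
Qed.

Lemma circuitsE : circuits = [seq (w_bits c.1, w_bits c.2) | c <- wpairs].
Proof. by rewrite /circuits. Qed.

Lemma mem_map_In (T : Type) (U : eqType) (f : T -> U) y l :
  y \in map f l -> exists2 x, List.In x l & y = f x.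
Proof.
elim: l => //= a l IH; rewrite inE => /predU1P[->|/IH[x ? ->]]; by [exists a; auto|exists x; auto].
Qed.

Local Open Scope ring_scope.

Section Circuit.
Variable R : realFieldType.
Local Notation pt := (@pt R).

Definition vtx (i : 'I_16) (k : 'I_4) : bool := nth false (nth [::] vbits i) k.

Lemma size_vbits_nth (i : 'I_16) : size (nth [::] vbits i) = 4%N.
Proof. by apply/eqP; rewrite -mem_bitlists; apply: mem_nth; exact: ltn_ord. Qed.

Lemma pt_coord (i : 'I_16) (k : 'I_4) : pt i 0 k = (vtx i k)%:R.
Proof.
rewrite mxE divr1 /verts (nth_map [::]) ?(nth_map false) ?size_vbits_nth //.
by rewrite -/(vtx i k); case: vtx.
Qed.

Lemma nverts_coord (i : 'I_16) (k : 'I_4) : nth 0%N (nth [::] nverts i) k = vtx i k.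
Proof. by rewrite /nverts (nth_map [::]) ?(nth_map false) ?size_vbits_nth //. Qed.

Lemma nverts_size : all (fun v => size v == 4%N) nverts.
Proof.
apply/allP => v /mapP[u]; rewrite /vbits mem_bitlists => /eqP su ->.
by rewrite size_map su.
Qed.

Definition circuit_weights (F G : {set 'I_16}) (a b : 'I_16 -> R) :=
  [/\ [/\ forall i, 0 <= a i, forall i, i \notin F -> a i = 0 & \sum_i a i = 1],
      [/\ forall i, 0 <= b i, forall i, i \notin G -> b i = 0 & \sum_i b i = 1],
      \sum_i a i *: pt i = \sum_i b i *: pt i & exists i, a i != b i].

(** Dividing the integer weights by their common total gives two convex combinations of the same
    point with disjoint supports. *)
Lemma circuits_weights s1 s2 : (s1, s2) \in circuits ->
  exists a b, circuit_weights (dec s1) (dec s2) a b.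
Proof.
rewrite circuitsE => sc; have [c cP [-> ->]] := mem_map_In sc.
have [t t0 [w1 w2 es dis]] := wpairs_ok cP; clear sc cP.
pose wt (w : wset) (i : 'I_16) : R := (nth 0%N (spread (w_bits w) (w_wts w)) i)%:R / t%:R.
have t0' : (t%:R : R) != 0 by rewrite pnatr_eq0 -lt0n.
have ge w i : 0 <= wt w i by rewrite divr_ge0 ?ler0n.
have out w i : i \notin dec (w_bits w) -> wt w i = 0.
  by rewrite inE => /negbTE h; rewrite /wt nth_spread0 ?mul0r.
have sum1 w : wok t w -> \sum_i wt w i = 1.
  move=> [s16 cw st _]; rewrite -mulr_suml -natr_sum.
  have := sum_spread cw; rewrite s16 st => ->; exact: divff.
have sumpt w k : wok t w -> (\sum_i wt w i *: pt i) 0 k = (nth 0%N (w_sum w) k)%:R / t%:R.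
  move=> [s16 cw st ->]; rewrite summxE (wsum_spread _ nverts_size cw) ?s16 ?ltn_ord //.
  rewrite natr_sum mulr_suml; apply: eq_bigr => i _.
  by rewrite mxE pt_coord nverts_coord natrM mulrAC.
exists (wt c.1), (wt c.2); split.
- by split; [exact: ge|exact: out|exact: sum1].
- by split; [exact: ge|exact: out|exact: sum1].
- by apply/rowP => k; rewrite !sumpt // es.
have [i wi] : exists i, wt c.1 i != 0.
  apply/existsP; apply: contraT; rewrite negb_exists => /forallP H.
  have := sum1 _ w1; rewrite big1 => [/esym/eqP|i _]; first by rewrite oner_eq0.
  by apply/eqP; move/negPn: (H i).
exists i; rewrite [wt c.2 i]out //.
have : i \in dec (w_bits c.1) by apply: contraR wi => /out ->.
by rewrite !inE => h1; apply/negP => h2; exact: dis h1 h2.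
Qed.

End Circuit.

Section Items.
Variable cs : seq (seq bool * seq bool).
Let it := item_table (item_list cs).
Let ct := conflict_table it cs.

Definition tab_has (t : ptrie bitset) (p : seq bool) (G : {set 'I_16}) : bool :=
  has (fun s => bs_mem p (odflt BEmpty (pt_get (code s) t))) (subdraws (enc G) 2 ++ subdraws (enc G) 3).

Definition itm := tab_has it.
Definition cfl := tab_has ct.

Lemma collect_has t p G : bs_mem p (collect t (enc G)) -> tab_has t p G.
Proof.
rewrite /collect /tab_has; elim: (_ ++ _) => [|s l IH] /= h; first by case: p h.
by case/orP: (bs_mem_union h) => [->|/IH ->]; rewrite ?orbT.
Qed.

Lemma tab_hasP t p G : tab_has t p G -> exists s,
  [/\ size s = 16, dec s \subset G & bs_mem p (odflt BEmpty (pt_get (code s) t))].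
Proof.
move=> /hasP[s + sp]; rewrite mem_cat => si; exists s.
have [k sub] : exists k, s \in subdraws (enc G) k by case/orP: si => h; [exists 2|exists 3].
have [e _ sub2] := mem_subdraws sub; split; rewrite ?e ?size_enc //.
by apply/fintype.subsetP => i; rewrite inE => /sub2; rewrite nth_enc.
Qed.

Lemma mem_zip2 (A B : eqType) (a : seq A) (b : seq B) x y : (x, y) \in zip a b -> y \in b.
Proof.
by elim: a b => [|u a IH] [|v b] //=; rewrite !inE => /orP[/eqP[_ ->]|/IH ->]; rewrite ?eqxx ?orbT.
Qed.

Lemma zip_inj (A B : eqType) (a : seq A) (b : seq B) x x' y : uniq b ->
  (x, y) \in zip a b -> (x', y) \in zip a b -> x = x'.
Proof.
elim: a b => [|u a IH] [|v b] //= /andP[vb ub]; rewrite !inE.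
case/orP => [/eqP[-> yv]|h1]; case/orP => [/eqP[-> yv']|h2] //.
- by move: vb; rewrite -yv (mem_zip2 h2).
- by move: vb; rewrite -yv' (mem_zip2 h1).
- exact: IH ub h1 h2.
Qed.

Lemma item_tableP il s p : bs_mem p (odflt BEmpty (pt_get (code s) (item_table il))) ->
  (s, p) \in il.
Proof.
elim: il => [|[s' p'] il IH] /=; first by case: p.
rewrite /item_table /= -/(item_table il) pt_get_upd inE.
case: pos_eqP => [/code_inj -> /bs_mem_single ->|_ /IH ->]; by rewrite ?eqxx ?orbT.
Qed.

Lemma conflict_tableP it' cc s p : bs_mem p (odflt BEmpty (pt_get (code s) (conflict_table it' cc))) ->
  exists2 s2, (s, s2) \in cc & bs_mem p (odflt BEmpty (pt_get (code s2) it')).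
Proof.
elim: cc => [|[s1 s2] cc IH] /=; first by case: p.
have weak : (exists2 s2, (s, s2) \in cc & bs_mem p (odflt BEmpty (pt_get (code s2) it'))) ->
  exists2 s3, (s, s3) \in (s1, s2) :: cc & bs_mem p (odflt BEmpty (pt_get (code s3) it')).
  by move=> [s3 h1 h2]; exists s3 => //; rewrite inE h1 orbT.
rewrite /conflict_table /= -/(conflict_table it' cc).
case sE: (pt_get (code s2) it') => [u|]; last by move/IH/weak.
rewrite pt_get_upd; case: pos_eqP => [/code_inj e|_]; last by move/IH/weak.
move=> /bs_mem_union /orP[pu|/IH/weak //]; exists s2; first by rewrite inE e eqxx.
by rewrite sE.
Qed.

(** Distinct items have distinct numbers, so a number found both among the contents of [G] and the
    exclusions of [G'] names a single circuit side. *)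
Lemma conflict_circuit p G G' : itm p G -> cfl p G' -> exists s1 s2,
  [/\ (s1, s2) \in cs, dec s1 \subset G' & dec s2 \subset G].
Proof.
move=> /tab_hasP[s2 [_ sub2 /item_tableP i2]] /tab_hasP[s1 [_ sub1 /conflict_tableP[s3 c3
  /item_tableP i3]]].
exists s1, s2; split=> //.
by have <- := zip_inj (bitlists_uniq 8) i3 i2.
Qed.
End Items.

Local Close Scope ring_scope.

Local Open Scope classical_set_scope.
Local Open Scope ring_scope.

(** * Triangulations as balanced sets of simplices *)

Section Hull.
Variables (R : realType) (n : nat) (I : finType) (pt : I -> 'rV[R]_n).
Hypothesis pt_inj : injective pt.
Implicit Types (F G : {set I}) (x y : 'rV[R]_n).

Definition vset F : {fset 'rV[R]_n} := [fset pt i | i in F]%fset.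

Lemma vsetE F x : (x \in vset F) = [exists (i | i \in F), x == pt i].
Proof.
apply/imfsetP/exists_inP => [[i iF ->]|[i iF /eqP ->]]; exists i => //.
Qed.

Lemma vset_pt F i : (pt i \in vset F) = (i \in F).
Proof.
rewrite vsetE; apply/exists_inP/idP => [[j jF /eqP /pt_inj ->] //|iF]; by exists i.
Qed.

Lemma vset_inj : injective vset.
Proof. by move=> F G e; apply/setP => i; rewrite -!vset_pt e. Qed.

Lemma hull_convex F : @convex_set R 'rV[R]_n [set x | hull pt F x].
Proof.
move=> x y l; rewrite !inE /= => cx cy.
have -> : conv l x y = seg y x l%:num by rewrite /conv /= /seg addrC.
by apply: hull_seg => //; apply/andP; split; [exact: ge0|exact: le1].
Qed.

(** Convexity concerns two points at a time: one vertex of nonzero weight is split off and the rest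
    is rescaled by [1 - w v]. Weight 1 is treated apart, since there is then no rest to rescale. *)
Lemma hull_min (M : set 'rV[R]_n) F x : @convex_set R 'rV[R]_n M ->
  (forall i, i \in F -> M (pt i)) -> hull pt F x -> M x.
Proof.
move=> cM; have [k] := ubnP #|F|; elim: k F x => // k IH F x /ltnSE cF FM [w [w0 wF w1 xE]].
have [v vF wv0] : exists2 v, v \in F & w v != 0.
  apply/exists_inP; apply: contraT; rewrite negb_exists_in => /forall_inP H.
  have /eqP : \sum_i w i = 0.
    apply: big1 => i _; case: (boolP (i \in F)) => [/H/negPn/eqP //|]; exact: wF.
  by rewrite w1 oner_eq0.
have wv_ge := w0 v.
have rest : \sum_(i | i != v) w i = 1 - w v by rewrite -w1 [in RHS](bigD1 v) //= addrAC subrr add0r.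
have wv1 : w v <= 1 by rewrite -subr_ge0 -rest sumr_ge0.
have [e1|ne1] := eqVneq (w v) 1.
  have z i : i != v -> w i = 0.
    move=> iv; have /eqP := rest; rewrite e1 subrr psumr_eq0 // => /allP /(_ i).
    by rewrite mem_index_enum iv /= => /(_ isT) /eqP.
  rewrite xE (bigD1 v) //= e1 scale1r big1 ?addr0; first exact: FM.
  by move=> i /z ->; rewrite scale0r.
have d0 : 0 < 1 - w v by rewrite subr_gt0 lt_neqAle ne1.
pose x' := \sum_i (if i == v then 0 else w i / (1 - w v)) *: pt i.
have x'E : (1 - w v) *: x' = \sum_(i | i != v) w i *: pt i.
  rewrite /x' scaler_sumr [RHS]big_mkcond /=; apply: eq_bigr => i _.
  by case: eqVneq => _ /=; rewrite ?scale0r ?scaler0 // scalerA mulrC mulfVK // gt_eqF.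
have Mx' : M x'.
  apply: (IH (F :\ v)) => [|i|].
  - by move: cF; rewrite (cardsD1 v) vF.
  - by rewrite !inE => /andP[_ /FM].
  exists (fun i => if i == v then 0 else w i / (1 - w v)); split=> //.
  - by move=> i; case: ifP => // _; rewrite divr_ge0 // ltW.
  - by move=> i; rewrite !inE; case: eqVneq => //= _ /wF ->; rewrite mul0r.
  rewrite (bigD1 v) //= eqxx add0r -[RHS](divff (_ : 1 - w v != 0)) ?gt_eqF // -rest mulr_suml.
  by apply: eq_bigr => i /negbTE ->.
have Mv : M (pt v) by exact: FM.
have l01 : 0 <= w v <= 1 by rewrite wv_ge.
have := cM (pt v) x' (Itv01 wv_ge wv1); rewrite !inE => /(_ Mv Mx').
by congr M; rewrite xE (bigD1 v) //= -x'E /conv /=.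
Qed.

Lemma hullE F : convex_hull [set` vset F] = [set x | hull pt F x].
Proof.
apply/seteqP; split.
  apply: smallest_sub; first exact: hull_convex.
  by move=> x /=; rewrite vsetE => /exists_inP[i iF /eqP ->]; exact: hull_pt.
move=> x /= cx M [cM FM]; apply: hull_min cx => // i iF; apply: FM => /=.
by rewrite vset_pt.
Qed.

End Hull.

(** Supporting functionals of faces have to be linear maps of type [{scalar V}]; this packages the
    linear part of an affine form as one. *)
Definition dotc (R : realType) n (c : 'cV[R]_n) (x : 'rV[R]_n) : R := (x *m c) 0 0.

Lemma dotc_linear (R : realType) n (c : 'cV[R]_n) : linear_for *%R (dotc c).
Proof. by move=> a x y; rewrite /dotc mulmxDl -scalemxAl !mxE. Qed.

HB.instance Definition _ (R : realType) n (c : 'cV[R]_n) :=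
  GRing.isLinear.Build R 'rV[R]_n R *%R (dotc c) (dotc_linear c).

Lemma dotcN (R : realType) n (c : 'cV[R]_n) x : dotc (- c) x = - dotc c x.
Proof. by rewrite /dotc mulmxN mxE. Qed.

Lemma affv_dotc (R : realType) n (c : 'cV[R]_n) b x : affv (c, b) x = dotc c x + b.
Proof. by []. Qed.

(** * Balanced sets and triangulations determine each other *)

Section Equiv.
Variables (R : realType) (n : nat) (I : finType).
Variables (pt : I -> 'rV[R]_n) (h : {set I} -> 'cV[R]_n * R).
Hypothesis h_facet : forall (f : {set I}) v, #|f| = n -> v \in f -> affv (h f) (pt v) = 0.
Hypothesis pt_inj : injective pt.
Implicit Types (F G f : {set I}) (v w : I) (x y z : 'rV[R]_n) (S : {set {set I}}).
Local Notation nondeg := (nondeg pt h).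
Local Notation bary := (bary pt h).
Local Notation insx := (insx pt h).
Local Notation intx := (intx pt h).
Local Notation generic := (generic pt h).
Local Notation cov := (cov pt h).
Local Notation nside := (nside pt h).
Local Notation hull := (hull pt).
Local Notation vset := (vset pt).

Definition aindep G := forall w : I -> R, (forall i, i \notin G -> w i = 0) ->
  \sum_i w i = 0 -> \sum_i w i *: pt i = 0 -> forall i, w i = 0.

Hypothesis pt_extreme : forall F a, hull F (pt a) -> a \in F.
Hypothesis aindep_nondeg : forall G, #|G| = n.+1 -> aindep G -> nondeg G.
Variable p : 'rV[R]_n.
Hypotheses (p_generic : generic p) (p_in : hull [set: I]%SET p).
Variable G0 : {set I}.
Hypothesis G0_nondeg : nondeg G0.
Hypothesis n_gt0 : (0 < n)%N.

Definition triang S := [/\ forall G, G \in S -> nondeg G,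
  forall f, interior_facet pt h f -> nside (enum S) f true = nside (enum S) f false
  & cov (enum S) p = 1%N].

Definition toT S : set {fset 'rV[R]_n} :=
  [set vset F | F in [set F : {set I} | exists2 G, G \in S & F \subset G]].

(** Intersection in common faces, read on vertices: the carrier in [F] of a point common to [F] and
    [G] consists of vertices of [G]. *)
Definition properS S := forall F G x v, F \in S -> G \in S -> insx F x -> insx G x ->
  v \in F -> 0 < affv (bary F v) x -> v \in G.

Lemma triang_proper S : triang S -> properS S.
Proof.
move=> [nS bS cS] F G x v FS GS; apply: (balanced_proper h_facet _ bS p_generic p_in cS);
  rewrite ?mem_enum //.
by move=> H; rewrite mem_enum; exact: nS.
Qed.

Lemma triang_cover S x : triang S -> hull [set: I]%SET x -> exists2 G, G \in S & insx G x.
Proof.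
move=> [nS bS cS] Qx.
have nS' : {in enum S, forall G, nondeg G} by move=> H; rewrite mem_enum; exact: nS.
have [G] := balanced_cover h_facet nS' bS p_generic p_in cS Qx.
by rewrite mem_enum; exists G.
Qed.

(** Adding a dependency to the barycentric coordinates of the origin represents the origin a second
    time, and these coordinates are unique. *)
Lemma nondeg_aindep G : nondeg G -> aindep G.
Proof.
move=> nG w wG w0 wp i; case: (boolP (i \in G)) => iG; last exact: wG.
have [xE x1] := bary_rep h_facet 0 nG.
pose b v := affv (bary G v) 0.
have : affv (bary G i) (\sum_(u in G) (b u + w u) *: pt u) = b i + w i.
  apply: bary_uniq => //; rewrite big_split /= x1.
  by rewrite -(sum_set_ext (F := G)) // w0 addr0.
have -> : \sum_(u in G) (b u + w u) *: pt u = 0.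
  under eq_bigr do rewrite scalerDl.
  rewrite big_split /= xE add0r -(sum_set_ext (F := G)) // => j /wG ->.
  exact: scale0r.
by move/eqP; rewrite -subr_eq0 opprD addNKr oppr_eq0 => /eqP.
Qed.

Lemma aindep_sub F G : F \subset G -> aindep G -> aindep F.
Proof.
move=> /fintype.subsetP FG aG w wF; apply: aG => i iG; apply: wF; apply: contra iG; exact: FG.
Qed.

Lemma vset_sum (V : nmodType) F (g : 'rV[R]_n -> V) :
  \sum_(v <- vset F) g v = \sum_(i in F) g (pt i).
Proof.
rewrite /vset big_imfset /=; last by move=> i j _ _; exact: pt_inj.
by rewrite big_enum.
Qed.

Lemma aindepE F : affinely_independent (vset F) <-> aindep F.
Proof.
split=> [aF w wF w0 wp i|aF w w0 wp v].
  case: (boolP (i \in F)) => iF; last exact: wF.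
  pose w' (x : 'rV[R]_n) := \sum_(j | pt j == x) w j.
  have w'E j : w' (pt j) = w j.
    by rewrite /w' (eq_bigl (pred1 j)) ?big_pred1_eq // => k; rewrite /= (inj_eq pt_inj).
  rewrite -w'E; apply: aF; rewrite ?vset_pt // vset_sum.
    under eq_bigr do rewrite w'E; by rewrite -(sum_set_ext (F := F)).
  under eq_bigr do rewrite w'E; rewrite -(sum_set_ext (F := F)) // => j /wF ->.
  exact: scale0r.
rewrite vsetE => /exists_inP[i iF /eqP ->].
pose w' j := if j \in F then w (pt j) else 0.
have := aF w'; move=> /(_ _ _ _ i); rewrite /w' iF; apply.
- by move=> j /negbTE ->.
- by rewrite -big_mkcond -(vset_sum F w).
- rewrite -[RHS]wp vset_sum [RHS]big_mkcond; apply: eq_bigr => j _.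
  by case: ifP; rewrite // scale0r.
Qed.

Lemma hull0 : [set x | hull finset.set0 x] = set0.
Proof.
apply/seteqP; split=> // x [w [_ w0 w1 _]]; have := oner_neq0 R.
by rewrite -w1 big1 ?eqxx // => i _; apply: w0; rewrite inE.
Qed.

(** The terms [w i * (b - phi (pt i))] are nonnegative and sum to [b - phi x = 0]. *)
Lemma hull_sup F x (w : I -> R) (phi : {scalar 'rV[R]_n}) b :
  (forall y, hull F y -> phi y <= b) -> phi x = b ->
  (forall i, 0 <= w i) -> (forall i, i \notin F -> w i = 0) -> \sum_i w i = 1 ->
  x = \sum_i w i *: pt i -> forall v, w v != 0 -> phi (pt v) = b.
Proof.
move=> le xb w0 wF w1 xE v wv.
have inF i : w i != 0 -> i \in F by apply: contraR => /wF ->.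
have le' i : i \in F -> phi (pt i) <= b by move=> iF; apply: le; exact: hull_pt.
have : \sum_i w i * (b - phi (pt i)) = 0.
  under eq_bigr do rewrite mulrBr.
  rewrite sumrB -mulr_suml w1 mul1r -xb xE linear_sum /=.
  under [X in X - _]eq_bigr do rewrite linearZ /=.
  exact: subrr.
move/eqP; rewrite psumr_eq0; last first.
  move=> i _; case: (eqVneq (w i) 0) => [->|/inF /le' h1]; first by rewrite mul0r.
  by rewrite mulr_ge0 ?subr_ge0.
move=> /allP /(_ v); rewrite mem_index_enum => /(_ isT) /=.
by rewrite mulf_eq0 (negbTE wv) subr_eq0 => /eqP.
Qed.

Lemma hull_face F (phi : {scalar 'rV[R]_n}) b : (forall y, hull F y -> phi y <= b) ->
  [set x | hull F x] `&` [set x | phi x = b] =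
  [set x | hull [set v in F | phi (pt v) == b]%SET x].
Proof.
move=> le; apply/seteqP; split=> x /=.
  move=> [[w [w0 wF w1 xE]] xb]; exists w; split=> // i.
  rewrite inE negb_and => /orP[/wF //|]; apply: contraNeq => wi.
  by apply/eqP; exact: (hull_sup le xb w0 wF w1 xE).
move=> hx; split; first by apply: hull_sub hx; apply/fintype.subsetP => i; rewrite inE => /andP[].
case: hx => w [w0 wF w1 ->]; rewrite linear_sum -[RHS]mul1r -w1 mulr_suml.
apply: eq_bigr => i _; rewrite linearZ /=.
case: (boolP (i \in [set v in F | phi (pt v) == b]%SET)); first by rewrite inE => /andP[_ /eqP ->].
by move/wF => ->; rewrite !mul0r.
Qed.

Lemma bary_hull0 G F x v : nondeg G -> F \subset G -> hull F x -> v \in G ->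
  v \notin F -> affv (bary G v) x = 0.
Proof.
move=> nG /fintype.subsetP FG [w [w0 wF w1 ->]] vG vF; rewrite affv_sum // big1 // => i _.
case: (boolP (i \in F)) => iF; last by rewrite wF // mul0r.
rewrite (bary_dual h_facet nG vG (FG _ iF)).
by case: eqVneq vF => [->|]; rewrite ?iF // mulr0.
Qed.

Lemma hull_of_bary G F x : nondeg G -> F \subset G -> insx G x ->
  (forall v, v \in G -> v \notin F -> affv (bary G v) x = 0) -> hull F x.
Proof.
move=> nG FG /insxP ix H; have [xE x1] := bary_rep h_facet x nG.
exists (fun i => if i \in F then affv (bary G i) x else 0).
have sub i : i \in F -> i \in G by move/fintype.subsetP: FG; apply.
have big2 (V : nmodType) (g1 g2 : I -> V) : (forall i, i \in F -> g1 i = g2 i) ->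
   (forall i, i \notin F -> g2 i = 0) -> (forall i, i \in G -> i \notin F -> g1 i = 0) ->
   \sum_(i in G) g1 i = \sum_i g2 i.
  move=> e g20 g10; rewrite [LHS]big_mkcond; apply: eq_bigr => i _.
  case: (boolP (i \in F)) => iF; first by rewrite sub // e.
  by rewrite g20 //; case: ifP => // iG; rewrite g10.
split.
- by move=> i; case: ifP => // /sub /ix.
- by move=> i /negbTE ->.
- by rewrite -x1; apply/esym/big2 => [i ->|i /negbTE ->|i iG iF] //; exact: H.
- rewrite -{1}xE; apply: big2 => [i ->|i /negbTE ->|i iG iF] //; first exact: scale0r.
  by rewrite H // scale0r.
Qed.

(* The face of the hull of [F] spanned by [F'], cut out by the barycentric
   coordinates of the vertices of [F :\: F']. *)
Lemma subset_face G F F' : nondeg G -> F \subset G -> F' \subset F ->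
  faces [set x | hull F x] [set x | hull F' x].
Proof.
move=> nG FG F'F.
pose c := \sum_(v in G :\: F') (bary G v).1; pose b := \sum_(v in G :\: F') (bary G v).2.
have E x : affv (c, b) x = \sum_(v in G :\: F') affv (bary G v) x.
  rewrite /affv /= /c /b mulmx_sumr summxE -big_split; exact: eq_bigr.
have ge x : hull F x -> 0 <= affv (c, b) x.
  move=> hx; rewrite E; apply: sumr_ge0 => v; rewrite !inE => /andP[_ vG].
  by have /insxP := (hull_insx h_facet x nG).1 (hull_sub FG hx); apply.
exists (dotc (- c)), b; split.
  by move=> x /= /ge; rewrite affv_dotc dotcN; lra.
have dE x : (dotc (- c) x = b) <-> affv (c, b) x = 0.
  by rewrite affv_dotc dotcN; split=> ?; lra.
apply/seteqP; split=> x /=.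
  move=> hx; split; first exact: hull_sub hx.
  apply/dE; rewrite E big1 // => v; rewrite !inE => /andP[vF' vG].
  exact: (bary_hull0 nG (fintype.subset_trans F'F FG) hx).
move=> [hx /dE]; rewrite E => /eqP; rewrite psumr_eq0; last first.
  move=> v; rewrite !inE => /andP[_ vG].
  by have /insxP := (hull_insx h_facet x nG).1 (hull_sub FG hx); apply.
move=> /allP H; apply: (hull_of_bary nG (fintype.subset_trans F'F FG)).
  by apply/(hull_insx h_facet x nG); exact: hull_sub hx.
move=> v vG vF'; have := H v; rewrite mem_index_enum !inE vG vF' => /(_ isT) /= /eqP //.
Qed.

Lemma hull_inj F G : [set x | hull F x] = [set x | hull G x] -> F = G.
Proof.
move=> e; apply/setP => i; apply/idP/idP => iF; apply: pt_extreme.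
  by have : [set x | hull F x] (pt i) by [exact: hull_pt]; rewrite e.
by have : [set x | hull G x] (pt i) by [exact: hull_pt]; rewrite -e.
Qed.

(** By [properS] the carrier in [F'] of a common point lies in [G'], so the point has the same
    coordinates in both simplices; they vanish off [F] on one side and off [G] on the other. *)
Lemma proper_inter S F G : properS S -> (forall G, G \in S -> nondeg G) ->
  forall F' G', F' \in S -> G' \in S -> F \subset F' -> G \subset G' ->
  [set x | hull F x] `&` [set x | hull G x] = [set x | hull (F :&: G) x].
Proof.
move=> pS nS F' G' F'S G'S FF' GG'; have nF := nS _ F'S; have nG := nS _ G'S.
apply/seteqP; split=> x /=; last first.
  by move=> hx; split; apply: hull_sub hx; rewrite (finset.subsetIl, finset.subsetIr).
move=> [hF hG]; have iF := (hull_insx h_facet x nF).1 (hull_sub FF' hF).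
have iG := (hull_insx h_facet x nG).1 (hull_sub GG' hG).
apply: (hull_of_bary nF _ iF) => [|v vF' vFG].
  exact: fintype.subset_trans (finset.subsetIl _ _) FF'.
case: (boolP (v \in F)) => vF; last exact: (bary_hull0 nF FF' hF).
move: vFG; rewrite inE vF /= => vG.
apply: contra_notP (negP vG) => /eqP x0.
have xv : 0 < affv (bary F' v) x by rewrite lt_neqAle eq_sym x0; move/insxP: iF; apply.
have vG' := pS _ _ _ _ F'S G'S iF iG vF' xv.
apply: contraT => {}vG; have xv0 := bary_hull0 nG GG' hG vG' vG.
have [xE x1] := bary_rep h_facet x nF.
suff : affv (bary G' v) x = affv (bary F' v) x by rewrite xv0 => e; rewrite -e ltxx in xv.
have supp u : u \in F' -> affv (bary F' u) x != 0 -> u \in G'.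
  move=> uF ux; apply: (pS _ _ _ _ F'S G'S iF iG uF).
  by rewrite lt_neqAle eq_sym ux; move/insxP: iF; apply.
pose w u := if u \in F' then affv (bary F' u) x else 0.
have big2 (V : nmodType) (g1 g2 : I -> V) : (forall i, i \in F' -> i \in G' -> g1 i = g2 i) ->
   (forall i, i \in F' -> i \notin G' -> g1 i = 0) -> (forall i, i \notin F' -> g2 i = 0) ->
   \sum_(i in F') g1 i = \sum_(i in G') g2 i.
  move=> e g10 g20; rewrite [LHS]big_mkcond [RHS]big_mkcond /=; apply: eq_bigr => i _.
  case: (boolP (i \in F')) => iF'; last by rewrite g20 // if_same.
  by case: ifPn => iG'; [exact: e|exact: g10].
have z u : u \in F' -> u \notin G' -> affv (bary F' u) x = 0.
  by move=> uF uG; apply/eqP; apply: contraNT uG; exact: supp.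
have xw : x = \sum_(u in G') w u *: pt u.
  rewrite -{1}xE; apply: big2 => [u uF uG|u uF uG|u uF]; rewrite /w ?uF //.
    by rewrite z // scale0r.
  by rewrite (negbTE uF) scale0r.
rewrite {1}xw bary_uniq //; first by rewrite /w vF'.
rewrite -x1; apply/esym/big2 => [u uF uG|u uF uG|u uF]; rewrite /w ?uF //; first exact: z.
by rewrite (negbTE uF).
Qed.

Theorem triang_triangulation S : triang S -> triangulation (range pt) (toT S).
Proof.
move=> tS; have [nS _ _] := tS; have pS := triang_proper tS.
have KE : [set convex_hull [set` F] | F in toT S] =
    [set [set x | hull F x] | F in [set F : {set I} | exists2 G, G \in S & F \subset G]].
  apply/seteqP; split=> [_ [_ [F HF <-] <-]|_ [F HF <-]].
    by exists F => //; rewrite (hullE pt_inj).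
  by exists (vset F); [exists F|rewrite (hullE pt_inj)].
split.
- move=> _ [F [G GS FG] <-]; split.
    by move=> x /=; rewrite vsetE => /exists_inP[i _ /eqP ->]; exists i.
  by apply/aindepE; apply: aindep_sub FG _; exact: nondeg_aindep (nS _ GS).
- rewrite KE; split.
  + by move=> _ [F _ <-]; exists (vset F); rewrite (hullE pt_inj).
  + have [G GS _] := triang_cover tS p_in.
    by exists finset.set0; [exists G => //; exact: finset.sub0set|exact: hull0].
  + move=> _ [F [G GS FG] <-] Q [phi [b [le ->]]].
    rewrite hull_face //; exists [set v in F | phi (pt v) == b]%SET => //=; exists G => //.
    by apply: fintype.subset_trans FG; apply/fintype.subsetP => i; rewrite inE => /andP[].
  + move=> _ _ [F [F' F'S FF'] <-] [G [G' G'S GG'] <-].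
    rewrite (proper_inter pS nS F'S G'S FF' GG'); split.
      by apply: (subset_face (nS _ F'S) FF'); exact: finset.subsetIl.
    by apply: (subset_face (nS _ G'S) GG'); exact: finset.subsetIr.
- have -> : range pt = [set` vset [set: I]%SET].
    apply/seteqP; split=> [_ [i _ <-]|x] /=; first by rewrite vset_pt.
    by rewrite vsetE => /exists_inP[i _ /eqP ->]; exists i.
  rewrite (hullE pt_inj); apply/seteqP; split=> x.
    move=> [_ [F [G GS FG] <-]]; rewrite (hullE pt_inj) => /=.
    by apply: hull_sub; rewrite finset.subsetT.
  move=> /(triang_cover tS)[G GS iG]; exists (vset G); first by exists G => //; exists G.
  by rewrite (hullE pt_inj) /=; apply: insx_hull (nS _ GS) iG.
Qed.

(** Affine forms make up a space of dimension [n + 1], so at most [n] vanishing conditions leave a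
    nonzero form; it is tested at the origin and at the unit vectors. *)
Lemma hyperplane F : (#|F| <= n)%N -> exists2 u : 'cV[R]_n * R,
  exists x, affv u x != 0 & forall v, v \in F -> affv u (pt v) = 0.
Proof.
move=> cF; pose A : 'M[R]_(1 + n, #|F|) := \matrix_(i, j) lift (pt (enum_val j)) 0 i.
have : kermx A != 0.
  rewrite kermx_eq0 /row_free; apply/negP => /eqP r.
  by have := rank_leq_col A; rewrite r leqNgt => /negP; apply; rewrite add1n ltnS.
case/matrix0Pn => i [j Kij].
pose k : 'rV[R]_(1 + n) := row i (kermx A).
have kA : k *m A = 0 by rewrite -row_mul mulmx_ker row0.
pose u := ((rsubmx k)^T, lsubmx k 0 0).
have uE x : affv u x = (k *m (lift x)^T) 0 0.
  rewrite /affv /= /lift tr_row_mx -[k in RHS]hsubmxK mul_row_col trmx1 mulmx1 [RHS]mxE addrC.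
  by congr (_ + _); rewrite -[x in LHS]trmxK -trmx_mul mxE.
exists u => [|v vF]; last first.
  rewrite uE; have := congr1 (fun B : 'rV_#|F| => B 0 (enum_rank_in vF v)) kA.
  rewrite !mxE => e; rewrite -[RHS]e; apply: eq_bigr => l _.
  by rewrite !mxE enum_rankK_in.
apply: contrapT => no.
have u0 x : affv u x = 0 by apply/eqP; apply: contrapT => /negP h1; apply: no; exists x.
have b0 : u.2 = 0 by have := u0 0; rewrite /affv mul0mx mxE add0r.
suff k0 : k = 0 by move: Kij; have := congr1 (fun B : 'rV_(1 + n) => B 0 j) k0; rewrite !mxE => ->;
  rewrite eqxx.
rewrite -[k]hsubmxK; have -> : rsubmx k = 0.
  apply/rowP => l; have := u0 (delta_mx 0 l); rewrite /affv b0 addr0 -rowE.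
  by rewrite !mxE.
have -> : lsubmx k = 0 by apply/matrixP => a b; rewrite !ord1 [RHS]mxE -[RHS]b0.
exact: row_mx0.
Qed.

(** Each simplex is eventually in or eventually out along the segment. If all were out, the points
    just after [x] would be uncovered. *)
Lemma cover_near S x a : (forall y, hull [set: I]%SET y -> exists2 G, G \in S & insx G y) ->
  hull [set: I]%SET x -> hull [set: I]%SET a ->
  exists2 G, G \in S & near0 (fun e => insx G (seg x a e)).
Proof.
move=> cS Qx Qa; apply: contrapT => no.
have H : near0 (fun e => forall G, G \in enum S -> ~~ insx G (seg x a e)).
  apply: near0_all => G; rewrite mem_enum => GS.
  by case: (near0_insx_dec pt h G x a) => // h1; case: no; exists G.
have [e /andP[e0 e1] He] := near0_ex H.
have [|G GS iG] := cS (seg x a e); first by apply: hull_seg => //; rewrite !ltW.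
by have := He G; rewrite mem_enum iG => /(_ GS).
Qed.

(** * The full-dimensional simplices of a triangulation *)

Section FromTriangulation.
Variable T : set {fset 'rV[R]_n}.
Hypothesis tT : triangulation (range pt) T.

Definition TT : {set {set I}} := [set F : {set I} | `[< T (vset F) >]]%SET.

Lemma TT_P F : reflect (T (vset F)) (F \in TT).
Proof. by rewrite inE; exact: asboolP. Qed.

Lemma T_vset (X : {fset 'rV[R]_n}) : T X -> exists2 F, F \in TT & X = vset F.
Proof.
move=> TX; case: tT => /(_ _ TX)[sX _] _ _.
pose F := [set i | pt i \in X]%SET.
have e : X = vset F.
  apply/fsetP => x; rewrite vsetE; apply/idP/exists_inP => [xX|[i + /eqP ->]].
    have [i _ ix] := sX x xX; exists i; last by rewrite ix.
    by rewrite inE ix.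
  by rewrite inE.
by exists F => //; apply/TT_P; rewrite -e.
Qed.

Lemma TT_aindep F : F \in TT -> aindep F.
Proof. by move/TT_P; case: tT => H _ _ /H[_ /aindepE]. Qed.

(** Of [n + 2] independent vertices, [n + 1] form a nondegenerate simplex, in which the coordinates
    of the last vertex give a dependency. *)
Lemma TT_card F : F \in TT -> (#|F| <= n.+1)%N.
Proof.
move=> /TT_aindep aF; rewrite leqNgt; apply/negP => /card_geqP[t [ut st sF]].
case: t ut st sF => [|v t] //= /andP[vt ut] [st] sF.
pose G := [set x in t]%SET.
have cG : #|G| = n.+1 by rewrite -st -(card_uniqP ut); apply: eq_card => i; rewrite inE.
have GF : G \subset F by apply/fintype.subsetP => i; rewrite inE => it; apply: sF; rewrite inE it orbT.
have vF : v \in F by apply: sF; rewrite inE eqxx.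
have vG : v \notin G by rewrite inE.
have nG : nondeg G by apply: aindep_nondeg cG _; exact: aindep_sub aF.
have [xE x1] := bary_rep h_facet (pt v) nG.
pose w i : R := if i == v then -1 else if i \in G then affv (bary G i) (pt v) else 0.
have split2 (V : nmodType) (g : I -> V) : \sum_(i | i != v) (if i \in G then g i else 0) = \sum_(i
  in G) g i.
  rewrite [LHS]big_mkcond [RHS]big_mkcond /=; apply: eq_bigr => i _.
  by case: eqVneq => [->|] //=; rewrite (negbTE vG).
have := aF w; move=> /(_ _ _ _ v); rewrite /w eqxx => H; have /eqP := oner_neq0 R.
apply; apply/eqP; rewrite -oppr_eq0 H //.
- move=> i iF; case: eqVneq => [e|_]; first by rewrite e vF in iF.
  by case: ifP => // iG; rewrite (fintype.subsetP GF _ iG) in iF.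
- rewrite (bigD1 v) //= eqxx -{2}x1 -split2 addrC; apply/eqP; rewrite subr_eq0; apply/eqP.
  by rewrite -[RHS]x1 -split2; apply: eq_bigr => i /negbTE ->.
- rewrite (bigD1 v) //= eqxx scaleN1r addrC; apply/eqP; rewrite subr_eq0; apply/eqP.
  rewrite -[RHS]xE -split2; apply: eq_bigr => i /negbTE ->.
  by case: ifP => // _; rewrite scale0r.
Qed.

(** The two hulls meet in a face of the first. Its supporting functional is maximal at [x], hence at
    every vertex carrying weight, so these vertices lie in the hull of [G] and are among its
    vertices. *)
Lemma TT_carrier F G x (w : I -> R) v : F \in TT -> G \in TT -> hull G x ->
  (forall i, 0 <= w i) -> (forall i, i \notin F -> w i = 0) -> \sum_i w i = 1 ->
  x = \sum_i w i *: pt i -> w v != 0 -> v \in G.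
Proof.
move=> /TT_P FT /TT_P GT hG w0 wF w1 xE wv; case: tT => _ [_ _ _ K4] _.
have hF : hull F x by exists w.
have vF : v \in F by apply: contraR wv => /wF ->.
have [] := K4 [set x | hull F x] [set x | hull G x].
- by exists (vset F) => //; rewrite hullE.
- by exists (vset G) => //; rewrite hullE.
move=> [phi [b [le e]]] _; apply: pt_extreme.
have xb : phi x = b.
  by have : ([set x | hull F x] `&` [set x | hull G x]) x by []; rewrite e => -[].
have vb := hull_sup le xb w0 wF w1 xE wv.
suff : ([set x | hull F x] `&` [set x | hull G x]) (pt v) by case.
by rewrite e; split=> //=; exact: hull_pt.
Qed.

Lemma TT_subset G F : G \in TT -> nondeg G -> F \subset G -> F \in TT.
Proof.
move=> /TT_P GT nG FG; case: tT => _ [_ _ K3 _] _.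
have [] := K3 [set x | hull G x] _ [set x | hull F x].
- by exists (vset G) => //; rewrite hullE.
- exact: (subset_face nG (subxx _) FG).
move=> X /T_vset[F' F'T ->]; rewrite hullE // => /hull_inj e.
by rewrite -e.
Qed.

Lemma range_vset : range pt = [set` vset [set: I]%SET].
Proof.
apply/seteqP; split=> [_ [i _ <-]|x] /=; first by rewrite vset_pt.
by rewrite vsetE => /exists_inP[i _ /eqP ->]; exists i.
Qed.

Lemma TT_cover x : hull [set: I]%SET x -> exists2 F, F \in TT & hull F x.
Proof.
move=> Qx; case: tT => _ _ e.
have : (\bigcup_(F in T) convex_hull [set` F]) x by rewrite e range_vset hullE.
by case=> X /T_vset[F FT ->]; rewrite hullE //; exists F.
Qed.

Definition TS : {set {set I}} := [set G in TT | #|G| == n.+1]%SET.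

Lemma TS_nondeg G : G \in TS -> nondeg G.
Proof. by rewrite inE => /andP[/TT_aindep aG /eqP cG]; exact: aindep_nondeg. Qed.

Lemma TS_TT G : G \in TS -> G \in TT.
Proof. by rewrite inE => /andP[]. Qed.

(** Faces with at most [n] vertices lie in finitely many hyperplanes, which a suitable direction
    leaves at once. So points near [x] lie in full-dimensional simplices, and by closedness so does
    [x]. *)
Lemma TS_cover x : hull [set: I]%SET x -> exists2 G, G \in TS & insx G x.
Proof.
move=> Qx.
pose P (F : {set I}) (u : 'cV[R]_n * R) := (#|F| <= n)%N ->
  (exists x, affv u x != 0) /\ forall v, v \in F -> affv u (pt v) = 0.
have exP F : exists u, P F u.
  rewrite /P; case: (leqP #|F| n) => [/hyperplane[u u1 u2]|_]; first by exists u.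
  by exists (0, 0).
have [uf Huf] := choice exP.
pose L := [seq uf F | F : {set I} <- enum {: {set I}} & (#|F| <= n)%N].
have Lneq u : u \in L -> exists x, affv u x != 0.
  by case/mapP => F; rewrite mem_filter => /andP[cF _] ->; case: (Huf F cF).
have [a [ia Ha]] := avoid_in h_facet G0_nondeg Lneq.
have Qa : hull [set: I]%SET a.
  by apply: (insx_setT h_facet G0_nondeg); exact: intx_insx.
have H1 : near0 (fun e => forall u, u \in L -> affv u (seg x a e) != 0).
  apply: near0_all => u uL.
  apply: near0_imp (near0_neq (a := affv u x) (b := affv u a) _) => [e|]; first by rewrite affv_seg.
  by rewrite Ha // orbT.
apply: contrapT => no.
have H2 : near0 (fun e => forall G, G \in enum TS -> ~~ insx G (seg x a e)).
  apply: near0_all => G; rewrite mem_enum => GS.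
  have nG := TS_nondeg GS.
  by case: (near0_insx_dec pt h G x a) => // /(near0_insx nG) h1; case: no; exists G.
have [e /andP[e0 e1] [h1 h2]] := near0_ex (near0_and H1 H2).
have [|F FT hF] := @TT_cover (seg x a e); first by apply: hull_seg => //; rewrite !ltW.
have cF : (n < #|F|)%N.
  rewrite ltnNge; apply/negP => cF; have [_ z] := Huf F cF.
  have /h1/eqP[] : uf F \in L by apply/mapP; exists F => //; rewrite mem_filter cF mem_enum inE.
  case: hF => w [_ wF w1 ->]; rewrite affv_sum // big1 // => i _.
  by case: (boolP (i \in F)) => [/z ->|/wF ->]; rewrite ?mulr0 ?mul0r.
have FS : F \in TS by rewrite inE FT eqn_leq TT_card.
have := h2 F; rewrite mem_enum => /(_ FS) /negP; apply.
exact/(hull_insx h_facet _ (TS_nondeg FS)).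
Qed.

Lemma insx_weights G x : nondeg G -> insx G x ->
  let w i := if i \in G then affv (bary G i) x else 0 in
  [/\ forall i, 0 <= w i, forall i, i \notin G -> w i = 0, \sum_i w i = 1
    & x = \sum_i w i *: pt i].
Proof.
move=> nG /insxP ix w; have [xE x1] := bary_rep h_facet x nG; split.
- by move=> i; rewrite /w; case: ifP => // /ix.
- by move=> i /negbTE; rewrite /w => ->.
- by rewrite -x1 [RHS]big_mkcond.
- rewrite -{1}xE [LHS]big_mkcond; apply: eq_bigr => i _; rewrite /w.
  by case: ifP => // _; rewrite scale0r.
Qed.

Lemma TS_proper : properS TS.
Proof.
move=> F G x v FS GS iF iG vF xv.
have [w0 wF w1 xE] := insx_weights (TS_nondeg FS) iF.
apply: (TT_carrier (TS_TT FS) (TS_TT GS) _ w0 wF w1 xE); rewrite ?vF ?gt_eqF //.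
exact: insx_hull (TS_nondeg GS) iG.
Qed.

End FromTriangulation.

Definition fcenter f : 'rV[R]_n := \sum_(u in f) (n%:R^-1) *: pt u.

Lemma bary_fcenter G v u : nondeg G -> v \in G -> u \in G ->
  affv (bary G u) (fcenter (G :\ v)) = if u == v then 0 else n%:R^-1.
Proof.
move=> nG vG uG; pose w i : R := if i == v then 0 else n%:R^-1.
have -> : fcenter (G :\ v) = \sum_(i in G) w i *: pt i.
  rewrite /fcenter [LHS]big_mkcond [RHS]big_mkcond /=; apply: eq_bigr => i _.
  by rewrite !inE /w; case: eqVneq => //= _; rewrite scale0r if_same.
rewrite bary_uniq // (bigD1 v) //= /w eqxx add0r.
rewrite (eq_bigr (fun=> n%:R^-1)) => [|i /andP[_ /negbTE ->] //].
rewrite (eq_bigl (mem (G :\ v))) => [|i]; last by rewrite !inE andbC.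
rewrite sumr_const (card_facet nG vG) -[_ *+ _]mulr_natr mulVf // pnatr_eq0.
by rewrite -lt0n.
Qed.

(** Slightly off the centre of the facet toward [v1] there is a point interior to both simplices, as
    they are on the same side; proper intersection then identifies them. *)
Lemma onside_uniq S f sg G1 G2 : properS S -> (forall G, G \in S -> nondeg G) ->
  G1 \in S -> G2 \in S -> onside pt h f sg G1 -> onside pt h f sg G2 -> G1 = G2.
Proof.
move=> pS nS G1S G2S /onsideP[v1 v1G [f1 s1]] /onsideP[v2 v2G [f2 s2]].
have n1 := nS _ G1S; have n2 := nS _ G2S.
have cn : 0 < (n%:R : R)^-1 by rewrite invr_gt0 ltr0n.
have h1 := nondeg_neq n1 v1G; have h2 := nondeg_neq n2 v2G; rewrite f1 in h1; rewrite f2 in h2.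
have H : near0 (fun e => forall u, u \in enum f ->
   0 < affv (bary G2 u) (seg (fcenter f) (pt v1) e)).
  apply: near0_all => u; rewrite mem_enum -f2 => uf.
  have := uf; rewrite !inE => /andP[uv uG].
  apply: near0_imp (near0_pos (affv (bary G2 u) (pt v1)) (a := affv (bary G2 u) (fcenter (G2 :\
    v2))) _).
    by move=> e; rewrite affv_seg.
  by rewrite bary_fcenter // (negbTE uv).
have [e /andP[e0 e1] He] := near0_ex H.
set x := seg _ _ _ in He.
have x1 u : u \in G1 -> 0 < affv (bary G1 u) x.
  move=> uG; rewrite /x affv_seg -f1 bary_fcenter // bary_dual //.
  case: eqVneq => _; first by rewrite mulr0 add0r mulr1.
  by rewrite mulr0 addr0 mulr_gt0 // subr_gt0.
have x2 u : u \in G2 -> 0 < affv (bary G2 u) x.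
  move=> uG; have [->|uv] := eqVneq u v2; last first.
    by apply: He; rewrite mem_enum -f2 !inE uv.
  rewrite /x affv_seg -f2 bary_fcenter // eqxx mulr0 add0r mulr_gt0 // baryE f2.
  move: s1 s2; case: (ltgtP (affv (h f) (pt v1)) 0) h1 => // a1 _ <-;
    case: (ltgtP (affv (h f) (pt v2)) 0) h2 => // a2 _ _.
    by rewrite nmulr_rgt0 // invr_lt0.
  by rewrite divr_gt0.
have i1 : insx G1 x by apply/insxP => u /x1 /ltW.
have i2 : insx G2 x by apply/insxP => u /x2 /ltW.
apply/eqP; rewrite eqEcard (nondeg_card n1) (nondeg_card n2) leqnn andbT.
by apply/fintype.subsetP => u uG; exact: (pS _ _ _ _ G1S G2S i1 i2 uG (x1 u uG)).
Qed.

(** Leaving the centre of the facet toward a vertex beyond it, one enters some simplex of [S]. It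
    contains the centre, hence by properness the whole facet, and it lies on the other side. *)
Lemma onside_ex S f sg G : properS S -> (forall G, G \in S -> nondeg G) ->
  (forall y, hull [set: I]%SET y -> exists2 G, G \in S & insx G y) ->
  interior_facet pt h f -> G \in S -> onside pt h f sg G ->
  exists2 G', G' \in S & onside pt h f (~~ sg) G'.
Proof.
move=> pS nS cS fi GS /onsideP[v vG [fE sgE]]; have nG := nS _ GS.
have [w hw sw] : exists2 w, affv (h f) (pt w) != 0 & (0 < affv (h f) (pt w)) = ~~ sg.
  case/andP: fi => /existsP[a ha] /existsP[b hb].
  case: (sg).
    by exists b; [rewrite lt_eqF|rewrite lt_gtF].
  by exists a; [rewrite gt_eqF|rewrite ha].
have cn : 0 < (n%:R : R)^-1 by rewrite invr_gt0 ltr0n.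
have fcG u : u \in G -> affv (bary G u) (fcenter f) = if u == v then 0 else n%:R^-1.
  by move=> uG; rewrite -fE bary_fcenter.
have iG : insx G (fcenter f).
  by apply/insxP => u uG; rewrite fcG //; case: ifP => // _; exact: ltW.
have Qf : hull [set: I]%SET (fcenter f) by exact: insx_setT nG iG.
have Qw : hull [set: I]%SET (pt w) by apply: hull_pt; rewrite inE.
have [G' G'S H] := cover_near cS Qf Qw; have nG' := nS _ G'S.
have iG' := near0_insx nG' H.
have fG' : f \subset G'.
  apply/fintype.subsetP => u; rewrite -fE !inE => /andP[uv uG].
  by apply: (pS _ _ _ _ GS G'S iG iG' uG); rewrite fcG // (negbTE uv).
have cf : #|f| = n by rewrite -fE (card_facet nG vG).
have [v' v'G v'f] : exists2 v', v' \in G' & v' \notin f.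
  have : ~~ (G' \subset f).
    by apply/negP => /subset_leq_card; rewrite (nondeg_card nG') cf ltnn.
  by case/subsetPn => v' ? ?; exists v'.
have fE' : G' :\ v' = f.
  apply/esym/eqP; rewrite eqEcard (card_facet nG' v'G) cf leqnn andbT.
  by rewrite subsetD1 fG'.
exists G' => //; apply/onsideP; exists v' => //; split=> //.
have [e /andP[e0 e1] /insxP/(_ v' v'G)] := near0_ex H.
rewrite affv_seg; have := nondeg_neq nG' v'G; rewrite fE' => h'.
have -> : affv (bary G' v') (fcenter f) = 0 by rewrite -fE' bary_fcenter // eqxx.
rewrite mulr0 add0r pmulr_rge0 // baryE fE' -sw.
case: (ltgtP (affv (h f) (pt w)) 0) hw => // a1 _; case: (ltgtP (affv (h f) (pt v')) 0) h' => // a2 _.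
  by rewrite pmulr_lge0 ?invr_gt0 // leNgt a1.
by rewrite nmulr_lge0 ?invr_lt0 // leNgt a1.
Qed.

Lemma nside_le1 S f sg : properS S -> (forall G, G \in S -> nondeg G) ->
  (nside (enum S) f sg <= 1)%N.
Proof.
move=> pS nS; apply: count_le1 (enum_uniq _) _ => a b; rewrite !mem_enum.
exact: onside_uniq.
Qed.

Lemma triang_of_proper S : (forall G, G \in S -> nondeg G) -> properS S ->
  (forall y, hull [set: I]%SET y -> exists2 G, G \in S & insx G y) -> triang S.
Proof.
move=> nS pS cS.
split=> // [f fi|].
  have E sg : has (onside pt h f sg) (enum S) -> has (onside pt h f (~~ sg)) (enum S).
    case/hasP => G; rewrite mem_enum => GS oG.
    have [G' G'S oG'] := onside_ex pS nS cS fi GS oG.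
    by apply/hasP; exists G' => //; rewrite mem_enum.
  have := nside_le1 f true pS nS; have := nside_le1 f false pS nS.
  have := E true; have := E false; rewrite /= !has_count -/(nside _ _ true) -/(nside _ _ false).
  case: (nside _ f true) => [|[|]] //; case: (nside _ f false) => [|[|]] //.
    by move=> /(_ isT).
  by move=> _ /(_ isT).
apply/eqP; rewrite eqn_leq; apply/andP; split.
  apply: count_le1 (enum_uniq _) _ => F G; rewrite !mem_enum => FS GS iF iG.
  apply/eqP; rewrite eqEcard (nondeg_card (nS _ FS)) (nondeg_card (nS _ GS)) leqnn andbT.
  apply/fintype.subsetP => u uF; apply: (pS _ _ _ _ FS GS iF iG uF).
  by rewrite lt_neqAle eq_sym p_generic ?nS //; move/insxP: iF; apply.
have [G GS iG] := cS _ p_in.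
by rewrite -has_count; apply/hasP; exists G => //; rewrite mem_enum.
Qed.

Theorem triangulation_triang T : triangulation (range pt) T ->
  exists2 S, triang S & T = toT S.
Proof.
move=> tT; exists (TS T); last first.
  apply/seteqP; split=> [X /(T_vset tT)[F FT ->]|_ [F [G GS FG] <-]]; last first.
    by apply/TT_P; apply: (TT_subset tT (TS_TT GS) (TS_nondeg tT GS) FG).
  exists F => //=.
  have [->|[v vF]] := set_0Vmem F.
    by have [G GS _] := TS_cover tT p_in; exists G => //; exact: finset.sub0set.
  have cF : 0 < (#|F|%:R : R) by rewrite ltr0n card_gt0; apply/set0Pn; exists v.
  pose w i : R := if i \in F then #|F|%:R^-1 else 0.
  have w0 i : 0 <= w i by rewrite /w; case: ifP => // _; rewrite invr_ge0 ltW.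
  have wF i : i \notin F -> w i = 0 by rewrite /w => /negbTE ->.
  have w1 : \sum_i w i = 1.
    rewrite /w -big_mkcond sumr_const -[_ *+ _]mulr_natr mulVf // gt_eqF //.
  (* The barycentre of [F] has positive weight on every vertex of [F], so a full-dimensional simplex
     containing it contains [F]. *)
  have [|G GS iG] := TS_cover tT (x := \sum_i w i *: pt i).
    by exists w; split=> // i; rewrite inE.
  exists G => //; apply/fintype.subsetP => u uF.
  apply: (TT_carrier tT FT (TS_TT GS) _ w0 wF w1 erefl (v := u)).
    exact: insx_hull (TS_nondeg tT GS) iG.
  by rewrite /w uF invr_neq0 // gt_eqF.
apply: triang_of_proper; [exact: TS_nondeg|exact: TS_proper|exact: TS_cover].
Qed.

(** The centre of a simplex of [S] lies in a simplex of [S'], which is also in [S]; being an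
    interior point, it forces the two to coincide. *)
Lemma triang_sub_eq S S' : triang S -> triang S' -> S' \subset S -> S' = S.
Proof.
move=> tS tS' sub; apply/eqP; rewrite finset.eqEsubset sub /=; apply/fintype.subsetP => G GS.
have [nS _ _] := tS; have nG := nS _ GS.
have ic : intx G (center pt G).
  by apply/intxP => v vG; rewrite bary_center // invr_gt0 ltr0Sn.
have iG := intx_insx ic.
have [G' G'S iG'] := triang_cover tS' (insx_setT h_facet nG iG).
have G'S' := fintype.subsetP sub _ G'S.
suff -> : G = G' by [].
apply/eqP; rewrite eqEcard (nondeg_card nG) (nondeg_card (nS _ G'S')) leqnn andbT.
apply/fintype.subsetP => u uG; apply: (triang_proper tS GS G'S' iG iG' uG).
by move/intxP: ic; apply.
Qed.

Lemma balanced_triang (s : seq {set I}) : {in s, forall G, nondeg G} ->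
  balanced pt h s -> cov s p = 1%N -> uniq s /\ triang [set G in s]%SET.
Proof.
move=> ns bs cs; have us := s_uniq h_facet ns bs p_generic p_in cs; split=> //.
have pe : perm_eq (enum [set G in s]%SET) s.
  by apply: uniq_perm => //; [exact: enum_uniq|move=> G; rewrite mem_enum inE].
split=> [G|f fi|]; first by rewrite inE; exact: ns.
  by have := bs f fi; rewrite /nside !(seq.permP pe).
by rewrite -cs /cov (seq.permP pe).
Qed.

Lemma toT_sub S S' : (forall G, G \in S -> nondeg G) -> (forall G, G \in S' -> nondeg G) ->
  toT S = toT S' -> S \subset S'.
Proof.
move=> nS nS' e; apply/fintype.subsetP => G GS.
have : toT S (vset G) by exists G => //; exists G.
rewrite e => -[F [G' G'S FG'] /(vset_inj pt_inj) e']; rewrite e' in FG'.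
suff -> : G = G' by [].
by apply/eqP; rewrite eqEcard FG' (nondeg_card (nS _ GS)) (nondeg_card (nS' _ G'S)) leqnn.
Qed.

Lemma toT_inj S S' : triang S -> triang S' -> toT S = toT S' -> S = S'.
Proof.
move=> [nS _ _] [nS' _ _] e; apply/eqP; rewrite finset.eqEsubset.
by rewrite (toT_sub nS nS' e) (toT_sub nS' nS (esym e)).
Qed.

(** A point has only one representation by simplices of a triangulation. For a circuit this means
    that its two sides cannot be contained in two simplices of [S]. *)
Lemma proper_weights S F G (a b : I -> R) : properS S -> (forall G, G \in S -> nondeg G) ->
  F \in S -> G \in S ->
  (forall i, 0 <= a i) -> (forall i, i \notin F -> a i = 0) -> \sum_i a i = 1 ->
  (forall i, 0 <= b i) -> (forall i, i \notin G -> b i = 0) -> \sum_i b i = 1 ->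
  \sum_i a i *: pt i = \sum_i b i *: pt i -> a =1 b.
Proof.
move=> pS nS FS GS a0 aF a1 b0 bG b1 e; have nF := nS _ FS; have nG := nS _ GS.
set x := \sum_i a i *: pt i in e.
have hF : hull F x by exists a.
have hG : hull G x by exists b.
have iF := (hull_insx h_facet x nF).1 hF; have iG := (hull_insx h_facet x nG).1 hG.
have baryw H (w : I -> R) v : nondeg H -> (forall i, i \notin H -> w i = 0) -> \sum_i w i = 1 ->
    x = \sum_i w i *: pt i -> v \in H -> affv (bary H v) x = w v.
  move=> nH wH w1 -> vH; rewrite (sum_set_ext (F := H)) => [|i /wH ->]; last by rewrite scale0r.
  by rewrite bary_uniq // -(sum_set_ext (F := H)).
have aG i : i \notin G -> a i = 0.
  move=> iG'; apply/eqP; apply: contraNT iG' => ai.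
  have iF' : i \in F by apply: contraR ai => /aF ->.
  by apply: (pS _ _ _ _ FS GS iF iG iF'); rewrite (baryw F a) // lt_neqAle eq_sym ai a0.
move=> i; case: (boolP (i \in G)) => iG'; last by rewrite aG // bG.
by rewrite -(baryw G a) // (baryw G b).
Qed.

End Equiv.

Local Close Scope ring_scope.
Local Close Scope classical_set_scope.

Local Open Scope ring_scope.

(** * The vertices of the 4-cube *)

Section Points.
Variable R : realType.
Local Notation pt := (@pt R).
Local Notation h := (@h R).
Implicit Types (F G : {set 'I_16}).

Lemma vtx_inj (i j : 'I_16) : (forall k, vtx i k = vtx j k) -> i = j.
Proof.
move=> H; apply: val_inj; apply/eqP; rewrite -(nth_uniq [::] _ _ (bitlists_uniq 4)) //=.
apply/eqP/(@eq_from_nth _ false) => [|k]; rewrite !size_vbits_nth //.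
by move=> k4; exact: (H (Ordinal k4)).
Qed.

Lemma pt_inj : injective pt.
Proof.
move=> i j e; apply: vtx_inj => k; have := congr1 (fun x : 'rV[R]_4 => x 0 k) e.
by rewrite !pt_coord => /eqP; rewrite eqr_nat; case: (vtx i k); case: (vtx j k).
Qed.

Lemma vtx_surj (a : 'I_4 -> bool) : exists i, forall k, vtx i k = a k.
Proof.
have : [seq a k | k <- enum 'I_4] \in vbits by rewrite mem_bitlists size_map size_enum_ord.
case/(nthP [::]) => i i16 e; exists (Ordinal (i16 : (i < 16)%N)) => k.
by rewrite /vtx /= e (nth_map k) ?size_enum_ord // nth_ord_enum.
Qed.

Lemma range_pt : range pt = cube_vertices (R := R) (n := 4).
Proof.
apply/seteqP; split=> [_ [i _ <-] k|x H].
  by rewrite pt_coord; case: (vtx i k); [right|left].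
have [i Hi] := vtx_surj (fun k => x 0 k == 1).
exists i => //; apply/rowP => k; rewrite pt_coord Hi.
by case: (H k) => ->; rewrite ?eqxx // eq_sym oner_eq0.
Qed.

Lemma pt_extreme F a : hull pt F (pt a) -> a \in F.
Proof.
move=> [w [w0 wF w1 e]]; apply: contraT => aF.
suff w00 i : w i = 0 by move: w1; rewrite big1 => [/eqP|i _ //]; rewrite eq_sym oner_eq0.
have [->|ia] := eqVneq i a; first exact: wF.
have [k ik] : exists k, vtx i k != vtx a k.
  apply/existsP; apply: contraNT ia; rewrite negb_exists => /forallP H.
  by apply/eqP/vtx_inj => k; apply/eqP/negPn; exact: H.
have ek : (vtx a k)%:R = \sum_j w j * (vtx j k)%:R :> R.
  rewrite -pt_coord e summxE; apply: eq_bigr => j _; by rewrite mxE pt_coord.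
(* Coordinate [k] of a vertex is extreme in the cube, so all the weight sits on vertices that agree
   with [a] there. *)
have sum0 : \sum_j w j * (vtx j k != vtx a k)%:R = 0.
  case ak: (vtx a k) in ek *.
    transitivity (\sum_j (w j - w j * (vtx j k)%:R)); last by rewrite sumrB w1 -ek subrr.
    by apply: eq_bigr => j _; case: (vtx j k); rewrite /= ?mulr0 ?mulr1 ?subr0 ?subrr.
  transitivity (\sum_j w j * (vtx j k)%:R); last exact: esym ek.
  by apply: eq_bigr => j _; case: (vtx j k).
move/eqP: sum0; rewrite psumr_eq0 => [/allP/(_ i)|j _]; last by rewrite mulr_ge0 ?ler0n.
by rewrite mem_index_enum ik mulr1 => /(_ isT)/eqP.
Qed.

Hypothesis f_ok : checked facets_ok.
Hypothesis s_ok : checked (all simplex_ok all_simplices).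
Hypothesis c_ok : checked (has (fun s => s_nd s && s_cov s) all_simplices).

Lemma circuit_absurd F G : (exists a b, @circuit_weights R F G a b) ->
  forall H, aindep pt H -> F \subset H -> G \subset H -> False.
Proof.
move=> [a [b [[a0 aF a1] [b0 bG b1] e [i ab]]]] H aH /fintype.subsetP FH /fintype.subsetP GH.
move/eqP: ab; apply; apply/eqP; rewrite -subr_eq0; apply/eqP.
apply: (aH (fun i => a i - b i)) => [j jH||].
- by rewrite aF ?bG ?subrr //; apply: contra jH; [exact: GH|exact: FH].
- by rewrite sumrB a1 b1 subrr.
- under eq_bigr do rewrite scalerBl.
  by rewrite sumrB e subrr.
Qed.

(** By [simplex_ok] a degenerate 5-set contains both sides of a circuit, and the difference of their
    weights is a dependency. *)
Lemma aindep_nondeg G : #|G| = 5 -> aindep pt G -> nondeg pt h G.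
Proof.
move=> cG aG; case: s_ok => /simplex_all/(_ cG); rewrite /simplex_ok (simplex_of_nd R cG).
case: ifP => // _ /bs_disjointPn[p /andP[/collect_has pi /collect_has pc]].
have [s1 [s2 [sc sub1 sub2]]] := conflict_circuit pi pc.
by case: (circuit_absurd (circuits_weights R sc) aG sub1 sub2).
Qed.

Lemma simplex_has (a : pred simplex) : has a all_simplices ->
  exists2 G : {set 'I_16}, #|G| = 5 & a (simplex_of G).
Proof.
rewrite has_map => /hasP[e ed ae]; have [se ce] := mem_draws16 ed.
by exists (dec e) => //; rewrite /simplex_of decK.
Qed.

Lemma nondeg_ex : exists2 G, nondeg pt h G & insx pt h G (@pp R).
Proof.
case: c_ok => /simplex_has[G cG /andP[nd cv]].
have nG : nondeg pt h G by rewrite -(simplex_of_nd R cG).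
by exists G; [exact: nG|rewrite -(simplex_of_cov s_ok nG)].
Qed.

Lemma pp_in : hull pt [set: 'I_16]%SET (@pp R).
Proof.
have [G nG iG] := nondeg_ex; exact: (insx_setT (@h_facet R f_ok) nG iG).
Qed.

End Points.

Local Close Scope ring_scope.

(** * Correctness of the count *)

Section Invariant.
Variable R : realType.
Local Notation pt := (@pt R).
Local Notation h := (@h R).
Local Notation pp := (@pp R).
Local Notation I := 'I_16.
Implicit Types (F G : {set I}) (P : seq {set I}) (S : {set {set I}}).

Hypothesis f_ok : checked facets_ok.
Hypothesis s_ok : checked (all simplex_ok all_simplices).
Hypothesis c_ok : checked (has (fun s => s_nd s && s_cov s) all_simplices).

Definition cube_triang S := triang pt h pp S.

Variable f : {set I} -> {set I}.

Definition invariant_triangs : {set {set {set I}}} :=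
  [set S : {set {set I}} | `[< cube_triang S >] && [forall G, (f G \in S) == (G \in S)]]%SET.

Local Notation E := invariant_triangs.

Lemma invariant_triangsP S : reflect (cube_triang S /\ forall G, (f G \in S) = (G \in S)) (S \in E).
Proof.
rewrite inE; apply: (iffP andP) => [[/asboolP tS /forallP H]|[tS H]]; split=> //.
- by move=> G; apply/eqP.
- exact/asboolP.
- by apply/forallP => G; apply/eqP.
Qed.

Lemma cube_triang_nondeg S G : cube_triang S -> G \in S -> nondeg pt h G.
Proof. by case=> nS _ _; exact: nS. Qed.

Let hf := @h_facet R f_ok.
Let pg : generic pt h pp := @pp_generic R s_ok.
Let pin := pp_in R f_ok s_ok c_ok.

Lemma cube_triang_proper S : cube_triang S -> properS pt h S.
Proof. exact: (triang_proper hf pg pin). Qed.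

(** Invariance is stated with multiplicity: [P] is composed of whole orbits even before it is known
    to have no repetition. *)
Definition good P := [/\ {in P, forall G, nondeg pt h G},
  forall G, count_mem (f G) P = count_mem G P & cov pt h P pp = 1].

Local Notation nfacR := (nfac (fac R)).

Lemma nfac_key P g sg : interior_facet pt h g -> nfacR P (key g sg) = nside pt h P g sg.
Proof. by move=> ig; apply: eq_count => G; rewrite fac_key ig. Qed.

Lemma nfac_opp_key P g sg : interior_facet pt h g ->
  nfacR P (opp (key g sg)) = nside pt h P g (~~ sg).
Proof. by move=> ig; rewrite opp_key nfac_key. Qed.

Lemma fac_interior G k : fac R G k -> exists g sg, k = key g sg /\ interior_facet pt h g.
Proof. by case/facP => i iG [ii ->]; exists (G :\ i), (0 < affv (h (G :\ i)) (pt i))%R. Qed.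

Lemma nfac_interior P k : 0 < nfacR P k -> exists g sg, k = key g sg /\ interior_facet pt h g.
Proof. by rewrite -has_count => /hasP[G _ /fac_interior]. Qed.

Lemma E_bal S k : S \in E -> nfacR (enum S) k = nfacR (enum S) (opp k).
Proof.
case/invariant_triangsP => -[nS bS _] _.
have bal g sg : interior_facet pt h g ->
    nside pt h (enum S) g sg = nside pt h (enum S) g (~~ sg).
  by move=> ig; case: sg; rewrite /= bS.
have H k' : 0 < nfacR (enum S) k' -> nfacR (enum S) k' = nfacR (enum S) (opp k').
  by move=> /nfac_interior[g [sg [-> ig]]]; rewrite nfac_opp_key // nfac_key // bal.
case: (posnP (nfacR (enum S) k)) => [k0|/H//].
by case: (posnP (nfacR (enum S) (opp k))) => [->//|/H]; rewrite oppK => ->.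
Qed.

Lemma E_le1 S k : S \in E -> nfacR (enum S) k <= 1.
Proof.
case/invariant_triangsP => tS _; case: (posnP (nfacR (enum S) k)) =>
  [->//|/nfac_interior[g [sg [-> ig]]]].
rewrite nfac_key //; apply: (nside_le1 hf) => // [|G].
  exact: cube_triang_proper.
exact: cube_triang_nondeg tS.
Qed.

Lemma E_conf S p G G' : S \in E -> G \in S -> G' \in S ->
  itm circuits p G -> cfl circuits p G' -> False.
Proof.
case/invariant_triangsP => tS _ GS GS' iG cG.
have [s1 [s2 [sc sub1 sub2]]] := conflict_circuit iG cG.
have [a [b [[a0 aF a1] [b0 bG b1] e [i]]]] := circuits_weights R sc.
clear sc; case/eqP.
have pS := cube_triang_proper tS.
apply: (proper_weights hf pS _ GS' GS a0 _ a1 b0 _ b1 e).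
- by move=> H; exact: cube_triang_nondeg tS.
- by move=> j jG; apply: aF; apply: contra jG => /(fintype.subsetP sub1).
- by move=> j jG; apply: bG; apply: contra jG => /(fintype.subsetP sub2).
Qed.

Lemma good_cat P Q : {in Q, forall G, nondeg pt h G} ->
  (forall G, count_mem (f G) Q = count_mem G Q) -> cov pt h Q pp = 0 ->
  good P -> good (Q ++ P).
Proof.
move=> nQ cQ vQ [nP cP vP]; split.
- by move=> G; rewrite mem_cat => /orP[/nQ|/nP].
- by move=> G; rewrite !count_cat cQ cP.
- by rewrite /cov count_cat -/(cov _ _ _ _) vQ.
Qed.

Definition rest P S : seq {set I} := [seq G <- enum S | G \notin P].

Lemma mem_rest P S G : (G \in rest P S) = (G \notin P) && (G \in S).
Proof. by rewrite mem_filter mem_enum. Qed.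

Lemma enum_cat_perm P S : minc P S -> perm_eq (enum S) (P ++ rest P S).
Proof.
move=> mP; have uP := minc_uniq mP.
apply: (@perm_trans _ ([seq G <- enum S | G \in P] ++ rest P S)).
  by rewrite perm_sym; exact: permEl (perm_filterC (mem P) (enum S)).
rewrite perm_cat2r; apply: uniq_perm => // [|G]; first by rewrite filter_uniq ?enum_uniq.
by rewrite mem_filter mem_enum; case: (boolP (G \in P)) => [|_];
  rewrite ?andbF //= => /(minc_mem mP) ->.
Qed.

Lemma key_balanced P : (forall k, nfacR P k = nfacR P (opp k)) -> balanced pt h P.
Proof. by move=> H g ig; rewrite -!nfac_key // H opp_key. Qed.

Lemma set_seq_E P : good P -> (forall k, nfacR P k = nfacR P (opp k)) ->
  uniq P /\ [set G in P]%SET \in E.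
Proof.
move=> [nP cP vP] /key_balanced bP.
have [uP tP] := balanced_triang hf pg pin nP bP vP.
split=> //; apply/invariant_triangsP; split=> // G.
by rewrite !inE -!has_pred1 !has_count cP.
Qed.

Lemma exchange_E P P' S : good P -> good P' ->
  (forall k, nfacR P k + nfacR P' (opp k) = nfacR P (opp k) + nfacR P' k) -> S \in Ext E P ->
  [set G in P' ++ rest P S]%SET \in Ext E P' /\ uniq (P' ++ rest P S).
Proof.
move=> [nP cP vP] [nP' cP' vP'] R'; rewrite inE => /andP[SE mP].
have pe := enum_cat_perm mP; have [tS iS] := invariant_triangsP S SE.
have gd : good (P' ++ rest P S).
  split.
  - move=> G; rewrite mem_cat mem_rest => /orP[/nP' //|/andP[_]].
    exact: cube_triang_nondeg tS.
  - move=> G; rewrite !count_cat cP'; congr (_ + _).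
    have uR : uniq (rest P S) by rewrite filter_uniq ?enum_uniq.
    rewrite !(count_uniq_mem _ uR) !mem_rest iS.
    by rewrite -!has_pred1 !has_count cP.
  (* [S] and [P] both cover the generic point once, so the rest of [S] avoids it and [P'] covers it
     once. *)
  - by case: tS => _ _; rewrite /cov (seq.permP pe) !count_cat -!/(cov pt h _ pp) vP vP' => ->.
have [|uQ qE] := set_seq_E gd.
  move=> k; have := E_bal k SE; have := R' k; rewrite /nfac !(seq.permP pe) !count_cat;
    do 6! [move: (count _ _) => ?]; clear; lia.
split=> //; rewrite inE qE /=; apply/allP => G GP; rewrite inE mem_cat GP.
by rewrite count_uniq_mem ?GP //; move: uQ; rewrite cat_uniq => /andP[].
Qed.

Lemma exchange_le P P' : good P -> good P' ->
  (forall k, nfacR P k + nfacR P' (opp k) = nfacR P (opp k) + nfacR P' k) -> #|Ext E P| <= #|Ext E P'|.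
Proof.
move=> gP gP' R'.
pose phi S : {set {set I}} := [set G in P' ++ rest P S]%SET.
(* Exchanging [P'] back for [P] recovers [S], so [phi] is injective. *)
have restE S : S \in Ext E P -> S = [set G in P ++ rest P' (phi S)]%SET.
  move=> SE; have [_ uQ] := exchange_E gP gP' R' SE.
  apply/setP => G; rewrite inE mem_cat mem_rest inE mem_cat mem_rest.
  have mP : minc P S by move: SE; rewrite inE => /andP[].
  case: (boolP (G \in P)) => [/(minc_mem mP) -> //|GP] /=.
  case: (boolP (G \in P')) => //= GP'; apply/idP => GS.
  move: uQ; rewrite cat_uniq => /and3P[_ /hasPn/(_ G)]; rewrite mem_rest GS GP.
  by move=> /(_ isT); rewrite /= GP'.
rewrite -(card_in_imset (f := phi) (D := mem (Ext E P))); last first.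
  by move=> S1 S2 h1 h2 e; rewrite (restE _ h1) (restE _ h2) e.
apply: subset_leq_card; apply/fintype.subsetP => _ /imsetP[S SE ->].
by have [] := exchange_E gP gP' R' SE.
Qed.

Lemma exchange P P' : good P -> good P' ->
  (forall k, nfacR P k + nfacR P' (opp k) = nfacR P (opp k) + nfacR P' k) -> #|Ext E P| = #|Ext E P'|.
Proof.
move=> gP gP' R'; apply/eqP; rewrite eqn_leq !exchange_le //.
by move=> k; rewrite addnC [RHS]addnC R'.
Qed.

(** A balanced [P] already is a triangulation, and no triangulation properly contains another. *)
Lemma complete P : good P -> (forall k, nfacR P k = nfacR P (opp k)) -> #|Ext E P| = 1.
Proof.
move=> gP /(set_seq_E gP)[uP PE].
suff -> : Ext E P = [set [set G in P]]%SET by rewrite cards1.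
apply/setP => S; rewrite [LHS]inE [RHS]inE; apply/andP/eqP => [[/invariant_triangsP[tS _] mP]|->].
  have [tP _] := invariant_triangsP _ PE.
  apply/esym/(triang_sub_eq hf pg pin tS tP).
  by apply/fintype.subsetP => G; rewrite inE => /(minc_mem mP).
split=> //.
by apply/allP => G GP; rewrite inE GP count_uniq_mem ?GP.
Qed.

End Invariant.

Local Notation I := 'I_16.
Arguments simplex_of : simpl never.

(** * Permutations of the vertices as lists *)

Section Lists.
Implicit Types (F G : {set I}) (b c : {perm I}) (l : seq nat).

Definition lst b : seq nat := [seq val (b i) | i <- enum I].

Lemma size_lst b : size (lst b) = 16. Proof. by rewrite size_map size_enum_ord. Qed.

Lemma nth_lst b (i : I) : nth 0 (lst b) i = b i.
Proof. by rewrite (nth_map i) ?size_enum_ord // nth_ord_enum. Qed.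

Lemma lst_inj : injective lst.
Proof. by move=> b c e; apply/permP => i; apply: ord_inj; rewrite -!nth_lst e. Qed.

Definition pre b F : {set I} := [set i | b i \in F]%SET.

Lemma pre_inj b : injective (pre b).
Proof.
move=> F G /setP e; apply/setP => i; have := e ((b^-1)%g i).
by rewrite !inE permKV.
Qed.

Lemma iter_pre b n F : iter n (pre b) F = [set i | (b ^+ n)%g i \in F]%SET.
Proof.
elim: n => [|n IH] /=; first by apply/setP => i; rewrite inE expg0 perm1.
by apply/setP => i; rewrite IH !inE expgS permM.
Qed.

Lemma img_enc b F : img (lst b) (enc F) = enc (pre b F).
Proof.
apply: (@eq_from_nth _ false) => [|i]; rewrite size_map size_lst ?size_enc // => i16.
rewrite (nth_map 0) ?size_lst // -[i]/(val (Ordinal i16)) nth_lst !nth_enc.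
by rewrite inE.
Qed.

Lemma compo_lst b c : compo (lst b) (lst c) = lst (c * b)%g.
Proof.
apply: (@eq_from_nth _ 0) => [|i]; rewrite size_map !size_lst // => i16.
by rewrite (nth_map 0) ?size_lst // -[i]/(val (Ordinal i16)) !nth_lst permM.
Qed.

Lemma lst1 : lst 1%g = idl.
Proof. by rewrite /lst /idl -val_enum_ord; apply: eq_map => i; rewrite perm1. Qed.

Lemma inverse_lst b : inverse_list (lst b) = lst (b^-1)%g.
Proof.
rewrite /inverse_list -lst1; apply: (@eq_from_nth _ 0) => [|i]; rewrite size_map !size_lst // => i16.
rewrite (nth_map 0) ?size_lst // -[i]/(val (Ordinal i16)) !nth_lst perm1.
rewrite -{1}[Ordinal i16](permKV b) -nth_lst index_uniq ?size_lst ?ltn_ord //.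
by rewrite map_inj_uniq ?enum_uniq // => j k /val_inj /perm_inj.
Qed.

Lemma iter_compo b n : iter n (compo (lst b)) idl = lst (b ^+ n)%g.
Proof.
elim: n => [|n IH] /=; first by rewrite expg0 lst1.
by rewrite IH compo_lst expgSr.
Qed.

Lemma order_pre b G : small_order (lst b) -> fingraph.order (pre b) G <= 12.
Proof.
case/hasP => m; rewrite mem_iota => /andP[m0 m12].
rewrite iter_compo => /nat_seq_eqP; rewrite -lst1 => /lst_inj bm.
have lp : looping (pre b) G m.
  have -> : looping (pre b) G m = (iter m (pre b) G \in traject (pre b) G m) by [].
  rewrite iter_pre bm; case: m m0 {m12 bm} => // m _; rewrite /= inE; apply/orP; left.
  by apply/eqP/setP => i; rewrite inE perm1.
apply: leq_trans (_ : m <= 12); last by case: (m) m12 => // k; lia.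
rewrite /fingraph.order -(size_traject (pre b) G m); apply: leq_trans (card_size _).
apply: subset_leq_card; apply/fintype.subsetP => F; rewrite unfold_in => /iter_findex <-.
exact: loopingP lp _.
Qed.

Lemma orb_orbit b G : small_order (lst b) ->
  orb 12 (lst b) (code (enc G)) (enc G) = map enc (fingraph.orbit (pre b) G).
Proof.
move=> so; have oG := order_pre G so.
have f_inj := @pre_inj b; set f := pre b in oG f_inj *.
rewrite /fingraph.orbit; set o := fingraph.order f G in oG *.
suff H k j : j < o -> o - j <= k.+1 ->
    orb k (lst b) (code (enc G)) (enc (iter j f G)) = map enc (traject f (iter j f G) (o - j)).
  have := H 12 0; rewrite subn0; apply; first exact: fingraph.order_gt0.
  by apply: leq_trans oG _.
have uo : uniq (traject f G o) by exact: orbit_uniq.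
elim: k j => [|k IH] j jo ojk.
  by have -> : o - j = 1 by lia.
rewrite /= img_enc -/f.
(* For an injective map the orbit closes up at its first element, and only after its full length. *)
have ret : (f (iter j f G) == G) = (j.+1 == o).
  apply/eqP/eqP => [e|e]; last by rewrite -iterS e; exact: iter_order.
  apply/eqP; rewrite eqn_leq jo leqNgt; apply/negP => jo'.
  have := nth_uniq G _ _ uo; rewrite size_traject => /(_ j.+1 0 jo' (fingraph.order_gt0 _ _)).
  by rewrite !nth_traject ?fingraph.order_gt0 //= e eqxx.
have -> : o - j = (o - j.+1).+1 by lia.
case: pos_eqP => [/code_inj/(can_inj encK)/eqP|ne].
  by rewrite ret => /eqP <-; rewrite subnn.
rewrite trajectS map_cons -iterS IH //; last by lia.
rewrite ltn_neqAle jo andbT -ret; apply/eqP => e; apply: ne; by rewrite e.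
Qed.

End Lists.

(** * Counting the triangulations fixed by a symmetry *)

Section Fixed.
Variable R : realType.
Local Notation pt := (@pt R).
Local Notation h := (@h R).
Local Notation pp := (@pp R).
Implicit Types (F G : {set I}) (P : seq {set I}) (S : {set {set I}}).

Hypothesis f_ok : checked facets_ok.
Hypothesis s_ok : checked (all simplex_ok all_simplices).
Hypothesis c_ok : checked (has (fun s => s_nd s && s_cov s) all_simplices).

Definition nondeg_sets : seq {set I} := [seq G <- map dec (draws 16 5) | nondeg pt h G].

Lemma mem_nondeg_sets G : (G \in nondeg_sets) = nondeg pt h G.
Proof.
rewrite mem_filter andb_idr // => /nondeg_card cG.
by apply/mapP; exists (enc G); [exact: enc_draws|rewrite encK].
Qed.

Lemma nondeg_sets_uniq : uniq nondeg_sets.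
Proof.
apply: filter_uniq; rewrite map_inj_in_uniq ?draws_uniq // => s t.
by move=> /mem_draws16[s16 _] /mem_draws16[t16 _]; exact: (dec_inj s16 t16).
Qed.

Lemma nondeg_simplicesE : nondeg_simplices all_simplices = map simplex_of nondeg_sets.
Proof.
rewrite /nondeg_simplices /nondeg_sets /all_simplices.
have D5 : {in map dec (draws 16 5), forall G, #|G| = 5}.
  by move=> _ /mapP[e /mem_draws16[_ ce] ->].
have -> : [seq mksimplex htable (item_table (item_list circuits))
     (conflict_table (item_table (item_list circuits)) circuits) e | e <- draws 16 5] =
   [seq simplex_of G | G <- map dec (draws 16 5)].
  rewrite -map_comp; apply/eq_in_map => e /mem_draws16[se _].
  by rewrite /= /simplex_of decK.
move: (map dec _) D5 => l D5; rewrite filter_map; congr (map _ _).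
by apply: eq_in_filter => G Gl; exact: (simplex_of_nd R (D5 _ Gl)).
Qed.

Variable b : {perm I}.
Hypothesis b_nondeg : forall G, nondeg pt h G -> nondeg pt h (pre b G).
Hypothesis b_order : small_order (lst b).

Local Notation f := (pre b).
Local Notation E := (invariant_triangs R f).
Local Notation nfacR := (nfac (fac R)).
Local Notation orb := (fingraph.orbit f).
Local Notation eo := (eorb dec).

Lemma nondeg_orbit G F : nondeg pt h G -> F \in orb G -> nondeg pt h F.
Proof.
rewrite -fconnect_orbit => nG /iter_findex <-.
by elim: (findex _ _ _) => //= n; exact: b_nondeg.
Qed.

Lemma count_orbit G F : count_mem (f F) (orb G) = count_mem F (orb G).
Proof.
rewrite !count_uniq_mem ?orbit_uniq // -!fconnect_orbit.
by congr nat_of_bool; rewrite -same_fconnect1_r //; exact: pre_inj.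
Qed.

Lemma bs_mem_foldr (T : Type) (u : T -> bitset) p (d : seq T) :
  bs_mem p (foldr (fun x v => bs_union (u x) v) BEmpty d) -> has (fun x => bs_mem p (u x)) d.
Proof.
elim: d => [|x d IH] /=; first by case: p.
by move=> /bs_mem_union /orP[->//|/IH ->]; rewrite orbT.
Qed.

Lemma fkey_opp c sg : ~~ pos_eqb (fkey c sg) (opp (fkey c sg)).
Proof. by case: sg. Qed.

Lemma keys_opp G : all (fun k => ~~ pos_eqb k (opp k)) (s_keys (simplex_of G)).
Proof. by rewrite all_map; elim: (seq.filter _ _) => //= x l ->; rewrite fkey_opp. Qed.

Lemma simplex_tableP (l : seq {set I}) G : G \in l ->
  pt_get (code (enc G)) (simplex_table (map simplex_of l)) = Some (simplex_of G).
Proof.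
rewrite /simplex_table; elim: l => //= F l IH; rewrite inE pt_get_upd.
case: pos_eqP => [/code_inj/(can_inj encK) -> //|ne] /predU1P[e|/IH //].
by rewrite e in ne.
Qed.

Definition start_ok G (x : start) :=
  [/\ t_simplex x = simplex_of G, eo (t_entry x) = orb G,
      [/\ forall k, cnt k (e_keys (t_entry x)) = nfacR (orb G) k,
          uses (itm circuits) (e_use (t_entry x)) (orb G)
        & forbids (cfl circuits) (e_forb (t_entry x)) (orb G)],
      all (fun k => ~~ pos_eqb k (opp k)) (e_keys (t_entry x))
    & t_cov x = cov pt h (orb G) pp].

Lemma mkstart_ok G : nondeg pt h G ->
  start_ok G (mkstart (simplex_table (map simplex_of nondeg_sets)) (lst b) (simplex_of G)).
Proof.
move=> nG; rewrite /mkstart.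
have -> : s_bits (simplex_of G) = enc G by [].
rewrite orb_orbit //.
have -> : pmap (fun e => pt_get (code e) (simplex_table (map simplex_of nondeg_sets))) (map enc
  (orb G)) =
    map simplex_of (orb G).
  have : {subset orb G <= nondeg_sets} by move=> F /(nondeg_orbit nG); rewrite mem_nondeg_sets.
  elim: (orb G) => //= F l IH sub; rewrite simplex_tableP ?sub ?mem_head //= IH // => F' F'l.
  by apply: sub; rewrite inE F'l orbT.
have cardo F : F \in orb G -> #|F| = 5 by move=> /(nondeg_orbit nG)/nondeg_card.
split=> //=.
- by rewrite /eorb /= mapK //; exact: encK.
- split=> [k|p pu|p pu].
  + rewrite /cnt count_flatten -!map_comp /nfac -sumn_count; congr sumn.
    by apply/eq_in_map => F /cardo cF; exact: cnt_keys.
  + by have := bs_mem_foldr pu; rewrite has_map; apply: sub_has => F; exact: collect_has.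
  + by have := bs_mem_foldr pu; rewrite has_map; apply: sub_has => F; exact: collect_has.
- by elim: (orb G) => //= F l IH; rewrite all_cat keys_opp.
- by rewrite /cov count_map; apply: eq_in_count => F /(nondeg_orbit nG) nF; exact: simplex_of_cov.
Qed.

Variable xs : {set I} -> start.
Hypothesis xs_ok : forall G, nondeg pt h G -> start_ok G (xs G).

Lemma pt_list_add_start k x t : pt_list k (add_start x t) =
  nseq (cnt k (s_keys (t_simplex x))) (t_entry x) ++ pt_list k t.
Proof.
rewrite /add_start /cnt; elim: (s_keys _) => //= k' l IH; rewrite pt_list_cons {}IH.
by case: pos_eqb.
Qed.

Lemma In_nseq (T : Type) n (x y : T) : List.In y (nseq n x) <-> 0 < n /\ y = x.
Proof.
elim: n => [|n IH] /=; first by split=> // -[].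
by split=> [[->|/IH[_ ->]]|[_ ->]]; auto.
Qed.

Lemma In_tab k e (l : seq {set I}) : List.In e (pt_list k (mktab (map xs l))) <->
  exists2 G, G \in l & [/\ eligible 0 (xs G), 0 < cnt k (s_keys (t_simplex (xs G)))
                         & e = t_entry (xs G)].
Proof.
rewrite /mktab; elim: l => [|G l IH] /=; first by split=> // -[].
have tail : (exists2 F, F \in l & [/\ eligible 0 (xs F), 0 < cnt k (s_keys (t_simplex (xs F)))
    & e = t_entry (xs F)]) -> exists2 F, F \in G :: l & [/\ eligible 0 (xs F),
    0 < cnt k (s_keys (t_simplex (xs F))) & e = t_entry (xs F)].
  by move=> [F Fl H]; exists F; rewrite // inE Fl orbT.
case: ifP => el.
  rewrite pt_list_add_start; split.
    move/(@In_cat _ _ _ _) => [/In_nseq[k0 ->]|/IH/tail //].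
    by exists G; rewrite ?mem_head.
  have inl x l1 l2 : List.In x l1 \/ List.In x l2 -> List.In x (l1 ++ l2 : seq entry).
    by move=> h; apply/List.in_app_iff.
  move=> [F]; rewrite inE => /predU1P[->|Fl] [eF k0 ee]; apply: inl; first by left; apply/In_nseq.
  by right; apply/IH; exists F.
split=> [/IH/tail //|[F]]; rewrite inE => /predU1P[->|Fl] [eF k0 ee]; first by rewrite eF in el.
by apply/IH; exists F.
Qed.

Local Notation tab := (mktab (map xs nondeg_sets)).

Lemma start_cnt G k : nondeg pt h G -> cnt k (s_keys (t_simplex (xs G))) = fac R G k.
Proof. by move=> nG; have [-> _ _ _ _] := xs_ok nG; exact: cnt_keys (nondeg_card nG). Qed.

Lemma eligibleP n G : nondeg pt h G ->
  eligible n (xs G) -> cov pt h (orb G) pp = n /\ static_ok (t_entry (xs G)).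
Proof. by move=> nG; have [_ _ _ _ <-] := xs_ok nG; rewrite /eligible; case: eqnP. Qed.

Local Notation good := (good R f).

Lemma tab_entry k e : List.In e (pt_list k tab) ->
  [/\ forall k', cnt k' (e_keys e) = nfacR (eo e) k', uses (itm circuits) (e_use e) (eo e),
      forbids (cfl circuits) (e_forb e) (eo e), all (fun k => ~~ pos_eqb k (opp k)) (e_keys e)
    & forall P, good P -> good (eo e ++ P)].
Proof.
move=> /In_tab[G]; rewrite mem_nondeg_sets => nG [/(eligibleP nG)[c0 _] _ ->].
have [_ -> [? ? ?] ? _] := xs_ok nG; split=> // P.
by apply: good_cat => //; [move=> F; exact: nondeg_orbit|exact: count_orbit].
Qed.

Lemma orbit_sub S G F : S \in E -> G \in S -> F \in orb G -> F \in S.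
Proof.
case/invariant_triangsP => _ iS GS; rewrite -fconnect_orbit => /iter_findex <-.
by elim: (findex _ _ _) => //= n; rewrite iS.
Qed.

Lemma static_E S G : S \in E -> G \in S -> static_ok (t_entry (xs G)).
Proof.
move=> SE GS; have [tS _] := invariant_triangsP _ _ _ SE; have nG := cube_triang_nondeg tS GS.
have [_ _ [_ us fb] _ _] := xs_ok nG.
apply: contraT => /bs_disjointPn[p /andP[/us/hasP[F1 o1 i1] /fb/hasP[F2 o2 i2]]].
by case: (E_conf f_ok s_ok c_ok SE (orbit_sub SE GS o1) (orbit_sub SE GS o2) i1 i2).
Qed.

Lemma count_sub (a : pred {set I}) P S : uniq P -> {subset P <= S} ->
  count a P <= count a (enum S).
Proof.
move=> uP sub; rewrite -!size_filter; apply: uniq_leq_size; first exact: filter_uniq.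
by move=> F; rewrite mem_filter => /andP[aF /sub FS]; rewrite mem_filter aF mem_enum.
Qed.

Lemma minc_uniqE P S : uniq P -> minc P S = all (mem S) P.
Proof. by move=> uP; apply: eq_in_all => G GP; rewrite count_uniq_mem // GP -[RHS]/(G \in S);
  case: (G \in S). Qed.

Lemma tab_complete k P S G : good P -> S \in Ext E P -> G \in S -> fac R G k -> nfacR P k = 0 ->
  exists2 e, List.In e (pt_list k tab) & S \in Ext E (eo e ++ P).
Proof.
move=> [nP cP vP] SP GS Gk Pk.
have [SE mP] : S \in E /\ minc P S by move: SP; rewrite inE => /andP.
have [tS iS] := invariant_triangsP _ _ _ SE; have nG := cube_triang_nondeg tS GS.
have GP : G \notin P.
  apply/negP => GP; move: Pk => /eqP; rewrite -leqn0 leqNgt => /negP; apply.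
  by rewrite -has_count; apply/hasP; exists G.
have oP F : F \in orb G -> F \notin P.
  rewrite -fconnect_orbit => /iter_findex <-; elim: (findex _ _ _) => //= n.
  by rewrite -!has_pred1 !has_count cP.
have uOP : uniq (orb G ++ P).
  rewrite cat_uniq orbit_uniq (minc_uniq mP) andbT /=.
  by apply/hasPn => F FP; apply: contraL FP; exact: oP.
have mOP : minc (orb G ++ P) S.
  rewrite minc_uniqE //; apply/allP => F; rewrite mem_cat => /orP[|/(minc_mem mP) //].
  exact: orbit_sub.
(* [S] has a single simplex over the generic point, and [P] already contains it. *)
have c0 : cov pt h (orb G) pp = 0.
  have [_ _ vS] := tS.
  have : cov pt h (orb G ++ P) pp <= 1.
    by rewrite -[X in (_ <= X)%N]vS; apply: count_sub => // F; exact: minc_mem.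
  by rewrite /cov count_cat -!/(cov pt h _ pp) vP addn1 ltnS leqn0 => /eqP.
have [_ oE _ _ vE] := xs_ok nG; exists (t_entry (xs G)); last by rewrite oE inE SE.
apply/In_tab; exists G; first by rewrite mem_nondeg_sets.
by rewrite /eligible vE c0 /= (static_E SE GS) start_cnt // Gk.
Qed.

Lemma mem_orbit_self G : G \in orb G. Proof. by rewrite -fconnect_orbit connect0. Qed.

(** Entries for side [k] whose orbits lie in [S] come from distinct simplices of [S] on that side,
    and there is at most one of these. *)
Lemma tab_uniq k S : S \in E ->
  count (fun e => all (mem S) (eo e)) (pt_list k tab) <= 1.
Proof.
move=> SE.
have H (l : seq {set I}) : {in l, forall G, nondeg pt h G} ->
   count (fun e => all (mem S) (eo e)) (pt_list k (mktab (map xs l))) <=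
   count (fun G => fac R G k && (G \in S)) l.
  rewrite /mktab; elim: l => [//|G l IH] nl /=.
  have nG : nondeg pt h G by apply: nl; rewrite mem_head.
  have {}IH := IH (fun F Fl => nl F (mem_behead (s := G :: l) Fl)).
  case: ifP => _; last by apply: leq_trans IH _; rewrite leq_addl.
  rewrite pt_list_add_start count_cat leq_add // start_cnt //.
  case: (fac R G k) => //=; rewrite addn0; have [_ -> _ _ _] := xs_ok nG.
  by case: allP => // /(_ _ (mem_orbit_self G)) /= ->.
apply: leq_trans (H nondeg_sets _) _; first by move=> G; rewrite mem_nondeg_sets.
apply: leq_trans (E_le1 f_ok s_ok c_ok k SE); rewrite -count_filter.
by apply: count_sub; [exact: filter_uniq nondeg_sets_uniq|move=> G; rewrite mem_filter => /andP[]].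
Qed.

Definition containing G : nat := #|[set S in E | G \in S]%SET|.

Lemma Ext_orbit G : Ext E (orb G) = [set S in E | G \in S]%SET.
Proof.
apply/setP => S; rewrite inE [RHS]inE; case: (boolP (S \in E)) => //= SE.
rewrite minc_uniqE ?orbit_uniq //; apply/allP/idP => [|GS F]; last exact: orbit_sub.
by apply; exact: mem_orbit_self.
Qed.

(** After exchanging the sums, each invariant triangulation counts for its only simplex over the
    generic point. *)
Lemma sum_containing : \sum_(G <- nondeg_sets | insx pt h G pp) containing G = #|E|.
Proof.
rewrite /containing -sum1_card.
transitivity (\sum_(G <- nondeg_sets | insx pt h G pp) \sum_(S in E) (G \in S : nat)).
  apply: eq_bigr => G _; rewrite -sum1_card big_mkcond [RHS]big_mkcond; apply: eq_bigr => S _.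
  by rewrite inE; case: (S \in E); case: (G \in S).
rewrite exchange_big; apply: eq_bigr => S SE.
have [[nS _ vS] _] := invariant_triangsP _ _ _ SE; rewrite -[RHS]vS /cov -sum1_count.
transitivity (\sum_(G <- [seq G <- nondeg_sets | G \in S] | insx pt h G pp) 1).
  by rewrite big_filter_cond big_mkcond [RHS]big_mkcond; apply: eq_bigr => G _;
    case: (G \in S); case: insx.
apply: perm_big; apply: uniq_perm; [exact: filter_uniq nondeg_sets_uniq|exact: enum_uniq|move=> G].
by rewrite mem_filter mem_enum mem_nondeg_sets andb_idr // => /nS.
Qed.

Variable cent : seq (seq nat).
Hypothesis cent_ok : forall l, l \in cent ->
  exists2 c, l = lst c & forall G, containing (pre c G) = containing G.

Definition seen_ok (t : ptrie N) := forall G n, pt_get (code (enc G)) t = Some n ->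
  containing G = nat_of_bin n.

Lemma record_ok G n t : containing G = nat_of_bin n -> seen_ok t ->
  seen_ok (record_orbit cent (enc G) n t).
Proof.
move=> Gn tok; rewrite /record_orbit; elim: cent cent_ok => //= l cs IH H F m.
have [c -> cc] := H _ (mem_head _ _); rewrite img_enc pt_get_upd.
case: pos_eqP => [/code_inj/(can_inj encK) -> [<-]|_]; first by rewrite cc.
by apply: IH => l' l'cs; apply: H; rewrite inE l'cs orbT.
Qed.

Lemma toggles_nil ks : all (fun k => ~~ pos_eqb k (opp k)) ks -> forall P,
  (forall k, cnt k ks = nfacR P k) ->
  match toggles ks [::] with
  | Some fr => consistent fr /\ frontier (fac R) P fr
  | None => #|Ext E P| = 0
  end.
Proof.
move=> ak P kP; case tE: (toggles ks [::]) => [fr|].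
  have [//|c H] := toggles_spec ak tE; split=> // k.
  by have := H k; rewrite -!kP /=; lia.
have [//|//|a] := toggles_None (N := fun=> 0) ak tE; rewrite kP add0n => a2.
exact: (Ext_facet_empty (@E_le1 R f_ok s_ok c_ok f) a2).
Qed.

Lemma runstarts_cons tb x xl seen m acc : runstarts tb cent (x :: xl) seen m acc =
  if s_cov (t_simplex x) then
    if eligible 1 x then
      match pt_get (code (s_bits (t_simplex x))) seen with
      | Some n => runstarts tb cent xl seen m (N.add n acc)
      | None =>
        match toggles (e_keys (t_entry x)) [::] with
        | None => runstarts tb cent xl seen m acc
        | Some fr =>
          match completions tb 30 (e_forb (t_entry x)) fr m with
          | None => None
          | Some (n, m') =>
            runstarts tb cent xl (record_orbit cent (s_bits (t_simplex x)) n seen) m' (N.add n acc)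
          end
        end
      end
    else runstarts tb cent xl seen m acc
  else runstarts tb cent xl seen m acc.
Proof. by []. Qed.

Theorem runstarts_correct (l : seq {set I}) seen m acc n : {in l, forall G, nondeg pt h G} ->
  runstarts tab cent (map xs l) seen m acc = Some n -> seen_ok seen ->
  memo_valid E (fac R) good m ->
  nat_of_bin n = \sum_(G <- l | insx pt h G pp) containing G + nat_of_bin acc.
Proof.
elim: l seen m acc => [|G l IH] seen m acc nl; first by move=> [<-] _ _; rewrite big_nil.
have nG : nondeg pt h G by apply: nl; rewrite mem_head.
have {}IH := IH _ _ _ (fun F Fl => nl F (mem_behead (s := G :: l) Fl)).
have [tG oG [kG uG fG] aG vG] := xs_ok nG.
rewrite map_cons runstarts_cons tG (simplex_of_cov s_ok nG) big_cons.
case: ifP => [iG|_]; last exact: IH.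
case: ifP => [el|nel]; last first.
  move=> run sk mv; rewrite (IH _ _ _ run sk mv).
  (* The orbit has a second simplex over the generic point or an internal conflict, so no invariant
     triangulation contains it. *)
  suff -> : containing G = 0 by [].
  apply/eqP; rewrite cards_eq0; apply/eqP/setP => S; rewrite inE [RHS]inE; apply/negP => /andP[SE GS].
  move/negP: nel; apply; rewrite /eligible (static_E SE GS) vG.
  suff -> : cov pt h (orb G) pp = 1 by [].
  have [[_ _ vS] _] := invariant_triangsP _ _ _ SE; apply/eqP; rewrite eqn_leq; apply/andP; split;
    last first.
    by rewrite -has_count; apply/hasP; exists G; [exact: mem_orbit_self|].
  rewrite -[X in (_ <= X)%N]vS; apply: count_sub; first exact: orbit_uniq.
  by move=> F; exact: orbit_sub.
have [c1 _] := eligibleP nG el.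
have -> : s_bits (simplex_of G) = enc G by [].
case sE: (pt_get _ seen) => [n1|].
  by move=> run sk mv; rewrite (IH _ _ _ run sk mv) nat_of_binD (sk _ _ sE); lia.
have := toggles_nil aG kG; case: (toggles _ _) => [fr [cfr ffr]|]; last first.
  rewrite Ext_orbit -/(containing G) => -> run sk mv; rewrite (IH _ _ _ run sk mv).
  by rewrite add0n.
case cE: (completions _ _ _ _ _) => [[n1 m1]|//] run sk mv.
have gO : good (orb G).
  by split=> //; [move=> F; exact: nondeg_orbit|exact: count_orbit].
have [eN mv1] := completions_correct (@E_bal R f) (@E_le1 R f_ok s_ok c_ok f) (@E_conf R f_ok s_ok
  c_ok f)
  (@exchange R f_ok s_ok c_ok f) (@complete R f_ok s_ok c_ok f)
  tab_entry tab_complete tab_uniq cE gO ffr cfr fG mv.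
move: eN; rewrite Ext_orbit -/(containing G) => eN.
rewrite (IH _ _ _ run _ mv1); last exact: record_ok.
by rewrite nat_of_binD eN; lia.
Qed.

End Fixed.

(** * Symmetries of the cube *)

Section Hamming.
Implicit Types (i j : I) (k : 'I_4) (a : 'I_4 -> bool) (b : {perm I}).

Definition hd i j := \sum_(k < 4) (vtx i k != vtx j k).

Definition vof a : I := inord (index [seq a k | k <- enum 'I_4] vbits).

Lemma mem_bits a : [seq a k | k <- enum 'I_4] \in vbits.
Proof. by rewrite mem_bitlists size_map size_enum_ord. Qed.

Lemma vofE a : val (vof a) = index [seq a k | k <- enum 'I_4] vbits.
Proof. by apply: inordK; have := mem_bits a; rewrite -index_mem. Qed.

Lemma vtx_vof a k : vtx (vof a) k = a k.
Proof. by rewrite /vtx vofE nth_index ?mem_bits // (nth_map k) ?size_enum_ord // nth_ord_enum. Qed.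

Lemma hd_eq0 i j : hd i j = 0 -> i = j.
Proof.
move=> /eqP; rewrite sum_nat_eq0 => /forallP H; apply: vtx_inj => k.
by have := H k; rewrite implyTb eqb0 negbK => /eqP.
Qed.

Lemma hdii i : hd i i = 0.
Proof. by rewrite /hd big1 // => k _; rewrite eqxx. Qed.

Lemma hd1 i j : hd i j = 1 -> exists k, forall k', vtx j k' = vtx i k' (+) (k' == k).
Proof.
move=> h1; have [k ik] : exists k, vtx i k != vtx j k.
  apply/existsP; apply: contraT; rewrite negb_exists => /forallP H.
  by move: h1; rewrite /hd big1 // => k _; rewrite (negbTE (H k)).
exists k => k'; move: h1; rewrite /hd (bigD1 k) //= ik => -[] /eqP.
rewrite sum_nat_eq0 => /forallP/(_ k'); case: eqVneq => [->|_] /=.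
  by case: (vtx i k) (vtx j k) ik => [] [].
by case: (vtx i k') (vtx j k') => [] [].
Qed.

(** Flipping bit [k] changes the distance by one, upward exactly when the bits agreed; both cases
    are added to opposite sides to avoid subtraction. *)
Lemma hd_flip i j j' k : (forall k', vtx j' k' = vtx j k' (+) (k' == k)) ->
  hd i j' + (vtx i k != vtx j k) = hd i j + (vtx i k == vtx j k).
Proof.
move=> H; rewrite /hd (bigD1 k) //= [in RHS](bigD1 k) //= H eqxx.
rewrite (eq_bigr (fun k' => (vtx i k' != vtx j k') : nat)) => [|k' /negbTE k'k].
  by rewrite addnAC [RHS]addnAC; congr (_ + _); case: (vtx i k) (vtx j k) => [] [].
by rewrite H k'k addbF.
Qed.

Definition cubeB : {set {perm I}} := [set b : {perm I} | [forall i : I, forall j : I, hd (b i) (b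
  j) == hd i j]]%SET.

Lemma cubeBP b : reflect (forall i j, hd (b i) (b j) = hd i j) (b \in cubeB).
Proof.
rewrite inE; apply: (iffP forallP) => [H i j|H i]; first by have /forallP/(_ j)/eqP := H i.
by apply/forallP => j; apply/eqP.
Qed.

Lemma cubeB_group : group_set cubeB.
Proof.
apply/group_setP; split; first by apply/cubeBP => i j; rewrite !perm1.
by move=> b c /cubeBP hb /cubeBP hc; apply/cubeBP => i j; rewrite !permM hc hb.
Qed.
Canonical cubeB_is_group := Group cubeB_group.

Definition signed b (s : 'I_4 -> 'I_4) (t : 'I_4 -> bool) :=
  forall i k, vtx (b i) k = vtx i (s k) (+) t k.

(** The neighbours of [z] go to neighbours of [b z], which defines a permutation [tau] of the
    coordinates. The distances of a vertex to [z] and to [e k] determine its coordinate [k], so [b]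
    is known everywhere. *)
Lemma cubeB_signed b : b \in cubeB -> exists (s : {perm 'I_4}) t, signed b s t.
Proof.
move=> /cubeBP hb.
have [vo voE] : exists vo : ('I_4 -> bool) -> I, forall a k, vtx (vo a) k = a k.
  by exists vof; exact: vtx_vof.
pose z := vo (fun=> false); pose e k := vo (fun k' => k' == k).
have ez k k' : vtx (e k) k' = vtx z k' (+) (k' == k) by rewrite !voE.
have hze k : hd z (e k) = 1.
  rewrite /hd (bigD1 k) //= big1 => [|k' /negbTE k'k]; rewrite !voE ?eqxx //.
  by rewrite k'k.
have ex k : exists l, [forall k', vtx (b (e k)) k' == vtx (b z) k' (+) (k' == l)].
  have [l H] := hd1 (etrans (hb z (e k)) (hze k)).
  by exists l; apply/forallP => k'; rewrite H.
pose tau k := xchoose (ex k).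
have tauP k k' : vtx (b (e k)) k' = vtx (b z) k' (+) (k' == tau k).
  by have /forallP/(_ k')/eqP := xchooseP (ex k).
have tau_inj : injective tau.
  move=> k l kl; have : b (e k) = b (e l) by apply: vtx_inj => k'; rewrite !tauP kl.
  move/perm_inj/(congr1 (fun i => vtx i k)); rewrite !voE eqxx.
  by move/esym/eqP.
pose s := perm tau_inj.
have H i k : vtx (b i) (tau k) = vtx i k (+) vtx (b z) (tau k).
  have := hd_flip (b i) (tauP k); have := hd_flip i (ez k); rewrite !hb [vtx z k]voE.
  by case: (vtx i k); case: (vtx (b i) _); case: (vtx (b z) _); rewrite //=; lia.
exists (s^-1)%g, (fun k => vtx (b z) k) => i k.
have e1 : tau ((s^-1)%g k) = k by rewrite -(permE tau_inj) permKV.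
by have := H i ((s^-1)%g k); rewrite e1.
Qed.

Lemma signed_cubeB b (s : {perm 'I_4}) t : signed b s t -> b \in cubeB.
Proof.
move=> H; apply/cubeBP => i j; rewrite /hd [RHS](reindex_inj (@perm_inj _ s)).
by apply: eq_bigr => k _; rewrite !H; case: (vtx i _) (vtx j _) (t k) => [] [] [].
Qed.

End Hamming.

Local Open Scope ring_scope.

(** * Symmetries act on triangulations *)

Section Invariance.
Variable R : realType.
Local Notation pt := (@pt R).
Local Notation h := (@h R).
Local Notation pp := (@pp R).
Implicit Types (F G : {set I}) (S : {set {set I}}).

Hypothesis f_ok : checked facets_ok.
Hypothesis s_ok : checked (all simplex_ok all_simplices).
Hypothesis c_ok : checked (has (fun s => s_nd s && s_cov s) all_simplices).

Let hf := @h_facet R f_ok.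
Let pg : generic pt h pp := @pp_generic R s_ok.
Let pin := pp_in R f_ok s_ok c_ok.

Section Move.
Variables (b : {perm I}) (s : {perm 'I_4}) (t : 'I_4 -> bool).
Hypothesis b_signed : signed b s t.

Definition amap (x : 'rV[R]_4) : 'rV[R]_4 :=
  \row_k (if t k then 1 - x 0 (s k) else x 0 (s k)).

Lemma amap_pt i : amap (pt i) = pt (b i).
Proof.
apply/rowP => k; rewrite mxE !pt_coord b_signed.
by case: (t k); case: (vtx i (s k)); rewrite /= ?subrr ?subr0.
Qed.

Lemma sumE (w : I -> R) (v : I -> 'rV[R]_4) l : (\sum_i w i *: v i) 0 l = \sum_i w i * v i 0 l.
Proof. by rewrite summxE; apply: eq_bigr => i _; rewrite mxE. Qed.

Lemma amap_comb (w : I -> R) : \sum_i w i = 1 ->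
  amap (\sum_i w i *: pt i) = \sum_i w i *: pt (b i).
Proof.
move=> w1; apply/rowP => k; rewrite mxE !sumE.
under [in RHS]eq_bigr do rewrite -amap_pt [amap _ _ _]mxE.
case: (t k) => //.
by rewrite -{1}w1 -sumrB; apply: eq_bigr => i _; rewrite mulrBr mulr1.
Qed.

Lemma pre_nondeg G : nondeg pt h G -> nondeg pt h (pre b G).
Proof.
move=> nG; apply: (aindep_nondeg s_ok).
  apply: etrans (nondeg_card nG); rewrite -(card_imset (pre b G) (@perm_inj _ b)).
  apply: eq_card => i; apply/imsetP/idP => [[j]|iG]; first by rewrite inE => ? ->.
  by exists ((b^-1)%g i); rewrite ?inE permKV.
move=> w w0 ws we i.
have := nondeg_aindep hf nG (w := fun i => w ((b^-1)%g i)).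
move=> /(_ _ _ _ (b i)); rewrite permK; apply.
- by move=> j jG; apply: w0; rewrite inE permKV.
- by rewrite -[RHS]ws [LHS](reindex_inj (@perm_inj _ b)); apply: eq_bigr => j _; rewrite permK.
rewrite [LHS](reindex_inj (@perm_inj _ b)).
under eq_bigr do rewrite permK -amap_pt.
have we0 l : \sum_j w j * pt j 0 l = 0 by rewrite -sumE we mxE.
apply/rowP => k; rewrite sumE [RHS]mxE.
under eq_bigr do rewrite [amap _ _ _]mxE.
case: (t k); last exact: we0.
under eq_bigr do rewrite mulrBr mulr1.
by rewrite sumrB ws we0 subrr.
Qed.

Lemma bary_pre G v x : nondeg pt h G -> v \in pre b G ->
  affv (bary pt h (pre b G) v) x = affv (bary pt h G (b v)) (amap x).
Proof.
move=> nG vG; have nG' := pre_nondeg nG; have [ex e1] := bary_rep hf x nG'.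
pose la u := if u \in pre b G then affv (bary pt h (pre b G) u) x else 0.
have la1 : \sum_u la u = 1 by rewrite /la -big_mkcond.
have xla : x = \sum_u la u *: pt u.
  rewrite -[LHS]ex big_mkcond; apply: eq_bigr => u _; rewrite /la.
  by case: ifP => // _; rewrite scale0r.
have -> : amap x = \sum_(u in G) la ((b^-1)%g u) *: pt u.
  rewrite {1}xla amap_comb // [RHS]big_mkcond [RHS](reindex_inj (@perm_inj _ b)).
  apply: eq_bigr => u _; rewrite permK /la inE; case: ifP => // _; by rewrite scale0r.
have bvG : b v \in G by move: vG; rewrite inE.
rewrite (bary_uniq hf nG bvG) ?permK /la ?vG //.
rewrite big_mkcond [LHS](reindex_inj (@perm_inj _ b)) -[RHS]la1; apply: eq_bigr => u _.
by rewrite permK /la !inE; case: (b u \in G).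
Qed.

Lemma insx_pre G x : nondeg pt h G -> insx pt h (pre b G) x = insx pt h G (amap x).
Proof.
move=> nG; apply/insxP/insxP => H v vG; last by rewrite bary_pre // H //; move: vG; rewrite inE.
have vG' : (b^-1)%g v \in pre b G by rewrite inE permKV.
by rewrite -[v](permKV b) -bary_pre // H.
Qed.

Lemma amap_hull x : hull pt [set: I]%SET x -> hull pt [set: I]%SET (amap x).
Proof.
move=> [w [w0 _ w1 ->]]; exists (fun i => w ((b^-1)%g i)); split=> //.
- by move=> i; rewrite inE.
- by rewrite -[RHS]w1 [LHS](reindex_inj (@perm_inj _ b)); apply: eq_bigr => j _; rewrite permK.
rewrite amap_comb // [RHS](reindex_inj (@perm_inj _ b)).
by apply: eq_bigr => j _; rewrite permK.
Qed.

(** Balance and the covering number at [p] involve chosen facet forms and a point that the symmetry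
    moves. Nondegeneracy, properness and covering carry over directly, and [triang_of_proper]
    recovers the rest. *)
Lemma cube_triang_pre S : cube_triang R S -> cube_triang R [set pre b G | G in S]%SET.
Proof.
move=> tS; have nS G := cube_triang_nondeg (G := G) tS; have pS := cube_triang_proper f_ok s_ok c_ok tS.
apply: (triang_of_proper hf pg pin) => //.
- by move=> _ /imsetP[G GS ->]; exact/pre_nondeg/nS.
- move=> _ _ x v /imsetP[F FS ->] /imsetP[G GS ->]; rewrite !insx_pre ?nS //.
  move=> iF iG vF; rewrite bary_pre ?nS // => lt; rewrite inE.
  by apply: (pS F G _ _ FS GS iF iG _ lt); move: vF; rewrite inE.
- move=> y /amap_hull/(triang_cover hf pg pin tS)[G GS iG].
  by exists (pre b G); [exact: imset_f|rewrite insx_pre ?nS].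
Qed.

End Move.

Lemma cubeB_nondeg b G : b \in cubeB -> nondeg pt h G -> nondeg pt h (pre b G).
Proof. by case/cubeB_signed => s [t H]; exact: (@pre_nondeg _ _ _ H G). Qed.

Lemma cubeB_cube_triang b S : b \in cubeB -> cube_triang R S ->
  cube_triang R [set pre b G | G in S]%SET.
Proof. by case/cubeB_signed => s [t H]; exact: (@cube_triang_pre _ _ _ H S). Qed.

(** As [c] commutes with [b], it maps the triangulations invariant under [b] and containing [G]
    injectively to those containing [pre c G]. *)
Lemma containing_le b c G : c \in cubeB -> commute b c ->
  (containing R b G <= containing R b (pre c G))%N.
Proof.
move=> cB bc; rewrite /containing -(card_imset _ (imset_inj (@pre_inj c))).
apply: subset_leq_card; apply/fintype.subsetP => _ /imsetP[S + ->].
rewrite inE => /andP[/invariant_triangsP[tS iS] GS]; rewrite inE imset_f // andbT.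
apply/invariant_triangsP; split; first exact: cubeB_cube_triang.
have com F : pre b (pre c F) = pre c (pre b F).
  by apply/setP => i; rewrite !inE -!permM bc.
move=> F; have [F' ->] : exists F', F = pre c F'.
  exists (pre c^-1%g F); apply/setP => i; by rewrite !inE permK.
by rewrite com !(mem_imset _ _ (@pre_inj c)) iS.
Qed.

Lemma containing_pre b c G : c \in cubeB -> commute b c ->
  containing R b (pre c G) = containing R b G.
Proof.
move=> cB bc; apply/eqP; rewrite eqn_leq containing_le // andbT.
have -> : G = pre c^-1%g (pre c G) by apply/setP => i; rewrite !inE permKV.
apply: leq_trans (containing_le _ (groupVr cB) (commuteV bc)) _.
by have -> : pre c (pre c^-1%g (pre c G)) = pre c G by apply/setP => i; rewrite !inE permK.
Qed.

End Invariance.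

Local Close Scope ring_scope.

Arguments cube_perms : simpl never.
Arguments inverse_list : simpl never.
Arguments compo : simpl never.
Arguments lcode : simpl never.

(** * The list of the 384 symmetries *)

Section GroupList.
Implicit Types (i j : I) (k : 'I_4) (b c : {perm I}) (s : {perm 'I_4}) (t : 'I_4 -> bool).

Definition lst4 s : seq nat := [seq val (s k) | k <- enum 'I_4].
Definition bits t : seq bool := [seq t k | k <- enum 'I_4].

Lemma size_lst4 s : size (lst4 s) = 4. Proof. by rewrite size_map size_enum_ord. Qed.
Lemma size_bits t : size (bits t) = 4. Proof. by rewrite size_map size_enum_ord. Qed.

Lemma nth_lst4 s k : nth 0 (lst4 s) k = s k.
Proof. by rewrite (nth_map k) ?size_enum_ord // nth_ord_enum. Qed.

Lemma nth_bits t k : nth false (bits t) k = t k.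
Proof. by rewrite (nth_map k) ?size_enum_ord // nth_ord_enum. Qed.

Lemma lst_sperm b s t : signed b s t -> lst b = sperm (lst4 s) (bits t).
Proof.
move=> H; have s16 : size vbits = 16 by [].
apply: (@eq_from_nth _ 0) => [|i]; rewrite size_lst ?size_map // => i16.
rewrite -[i]/(val (Ordinal i16)); move: (Ordinal i16) => {i16}i.
rewrite nth_lst (nth_map [::]) ?s16 ?ltn_ord //.
set l := map _ (iota 0 4).
have -> : l = nth [::] vbits (b i).
  apply: (@eq_from_nth _ false) => [|k]; rewrite /l size_map size_iota ?size_vbits_nth // => k4.
  rewrite -[k]/(val (Ordinal k4)); move: (Ordinal k4) => {k4}k.
  rewrite (nth_map 0) ?size_iota ?ltn_ord // nth_iota ?ltn_ord // add0n nth_lst4 nth_bits.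
  by rewrite -[RHS]/(vtx (b i) k) H.
by rewrite index_uniq ?s16 ?ltn_ord // bitlists_uniq.
Qed.

Lemma lst4_permutations s : lst4 s \in permutations (iota 0 4).
Proof.
rewrite mem_permutations; apply: uniq_perm => [||x]; rewrite ?iota_uniq //.
  by rewrite map_inj_uniq ?enum_uniq // => k l /val_inj /perm_inj.
rewrite mem_iota add0n; apply/mapP/idP => [[k _ ->]|x4]; first exact: ltn_ord.
exists ((s^-1)%g (Ordinal x4)); first exact: mem_enum.
by rewrite permKV.
Qed.

Lemma permutations_lst4 sg : sg \in permutations (iota 0 4) -> exists s, sg = lst4 s.
Proof.
rewrite mem_permutations => pe.
have s4 : size sg = 4 by rewrite (perm_size pe).
have us : uniq sg by rewrite (perm_uniq pe) iota_uniq.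
have lt k : nth 0 sg k < 4.
  have : nth 0 sg k \in sg by rewrite mem_nth ?s4.
  by rewrite (perm_mem pe) mem_iota.
pose f k : 'I_4 := Ordinal (lt k).
have f_inj : injective f.
  move=> k l /(congr1 val) /= /eqP; rewrite nth_uniq ?s4 // => /eqP; exact: ord_inj.
exists (perm f_inj); apply: (@eq_from_nth _ 0) => [|k]; rewrite s4 ?size_lst4 // => k4.
by rewrite -[k]/(val (Ordinal k4)) nth_lst4 permE.
Qed.

Lemma vbits_bits u : u \in vbits -> exists t, u = bits t.
Proof.
rewrite mem_bitlists => /eqP s4; exists (fun k => nth false u k).
apply: (@eq_from_nth _ false) => [|k]; rewrite s4 ?size_bits // => k4.
by rewrite -[k]/(val (Ordinal k4)) nth_bits.
Qed.

Lemma signed_exists s t : exists b, signed b s t.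
Proof.
have [vo voE] : exists vo : ('I_4 -> bool) -> I, forall a k, vtx (vo a) k = a k.
  by exists vof; exact: vtx_vof.
pose f i := vo (fun k => vtx i (s k) (+) t k).
have f_inj : injective f.
  move=> i j e; apply: vtx_inj => k; have := congr1 (fun x => vtx x ((s^-1)%g k)) e.
  by rewrite !voE permKV => /addIb.
by exists (perm f_inj) => i k; rewrite permE voE.
Qed.

Lemma groupP l : reflect (exists2 b, b \in cubeB & l = lst b) (l \in cube_perms).
Proof.
apply: (iffP allpairsP) => [[[sg u] /= [/permutations_lst4[s ->] /vbits_bits[t ->] ->]]|].
  have [b H] := signed_exists s t.
  by exists b; [exact: signed_cubeB H|rewrite (lst_sperm H)].
move=> [b /cubeB_signed[s [t H]] ->]; exists (lst4 s, bits t); split; rewrite ?(lst_sperm H) //.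
  exact: lst4_permutations.
exact: mem_bits.
Qed.

Lemma lcode_inj b c : lcode (lst b) = lcode (lst c) -> b = c.
Proof.
move=> /code_inj e; apply: lst_inj.
have sh a : shape [seq nth [::] vbits x | x <- lst a] = nseq 16 4.
  have : all (pred1 4) (shape [seq nth [::] vbits x | x <- lst a]).
    by apply/allP => _ /mapP[_ /mapP[_ /mapP[i _ ->] ->] ->]; rewrite /= size_vbits_nth.
  by move/all_pred1P; rewrite {2}/shape 2!size_map size_lst.
have := congr1 (reshape (nseq 16 4)) e; rewrite -{1}(sh b) -(sh c) !flattenK => e2.
apply: (@eq_from_nth _ 0) => [|i]; rewrite !size_lst // => i16.
have := congr1 (fun l => nth [::] l i) e2; rewrite !(nth_map 0) ?size_lst //.
rewrite -[i]/(val (Ordinal i16)) !nth_lst => /eqP; rewrite nth_uniq ?bitlists_uniq //.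
by move/eqP.
Qed.

End GroupList.

(** * Numbers of fixed triangulations and their sum over the group *)

Section Burnside.
Variable R : realType.
Implicit Types (F G : {set I}) (S : {set {set I}}) (b c : {perm I}).

Hypothesis f_ok : checked facets_ok.
Hypothesis s_ok : checked (all simplex_ok all_simplices).
Hypothesis c_ok : checked (has (fun s => s_nd s && s_cov s) all_simplices).

(* Variables, lest a tactic evaluate [cube_perms] or [all_simplices]. *)
Variables (gs : seq (seq nat)) (ss : seq simplex).
Hypothesis gsP : forall l, reflect (exists2 b, b \in cubeB & l = lst b) (l \in gs).
Hypothesis ssE : ss = map simplex_of (nondeg_sets R).

Definition num_fixed b : nat := #|invariant_triangs R (pre b)|.

Lemma fixcount_correct b n : b \in cubeB -> small_order (lst b) ->
  fixcount ss (centralizer gs (lst b)) (lst b) = Some n ->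
  num_fixed b = nat_of_bin n.
Proof.
move=> bB bo; rewrite /fixcount ssE -map_comp => run.
have bn (G : {set I}) : nondeg (pt R) (h R) G -> nondeg (pt R) (h R) (pre b G).
  exact: cubeB_nondeg.
pose xs (G : {set I}) := mkstart (simplex_table (map simplex_of (nondeg_sets R))) (lst b)
  (simplex_of G).
have xs_ok (G : {set I}) : nondeg (pt R) (h R) G -> start_ok R b G (xs G).
  by move=> nG; exact: mkstart_ok.
have co l : l \in centralizer gs (lst b) ->
    exists2 c, l = lst c & forall G, containing R b (pre c G) = containing R b G.
  rewrite mem_filter => /andP[/nat_seq_eqP + /gsP[c cB e]].
  rewrite e !compo_lst => /lst_inj bc; exists c => // G; exact: containing_pre.
have Gn : {in nondeg_sets R, forall G, nondeg (pt R) (h R) G} by move=> G; rewrite mem_nondeg_sets.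
have sk : seen_ok R b PLeaf by move=> G m; rewrite pt_getLeaf.
have mv : memo_valid (invariant_triangs R (pre b)) (fac R) (good R (pre b)) MLeaf.
  by move=> fr m; rewrite memo_get_leaf.
have {}run : runstarts (mktab (map xs (nondeg_sets R))) (centralizer gs (lst b)) (map xs
  (nondeg_sets R))
   PLeaf MLeaf N0 = Some n := run.
by rewrite (runstarts_correct f_ok s_ok c_ok bn bo xs_ok co Gn run sk mv) addn0 sum_containing.
Qed.

Lemma fixn_le b c : c \in cubeB -> num_fixed b <= num_fixed (c * b * c^-1)%g.
Proof.
move=> cB; rewrite /num_fixed -(card_imset _ (imset_inj (@pre_inj c))).
apply: subset_leq_card; apply/fintype.subsetP => _ /imsetP[S /invariant_triangsP[tS iS] ->].
apply/invariant_triangsP; split; first exact: cubeB_cube_triang.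
have com F : pre (c * b * c^-1)%g (pre c F) = pre c (pre b F).
  by apply/setP => i; rewrite !inE -!permM -!mulgA mulVg mulg1.
move=> F; have [F' ->] : exists F', F = pre c F'.
  by exists (pre c^-1%g F); apply/setP => i; rewrite !inE permK.
by rewrite com !(mem_imset _ _ (@pre_inj c)) iS.
Qed.

Lemma fixn_conj b c : c \in cubeB -> num_fixed (c * b * c^-1)%g = num_fixed b.
Proof.
move=> cB; apply/eqP; rewrite eqn_leq fixn_le // andbT.
by have := fixn_le (c * b * c^-1)%g (groupVr cB); rewrite !mulgA mulVg mul1g invgK mulgKV.
Qed.

Lemma conj_table_ok gl rs b n : (forall l, l \in gl -> exists2 c, c \in cubeB & l = lst c) ->
  (forall r, List.In r rs -> exists2 c, r.1 = lst c & num_fixed c = nat_of_bin r.2) ->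
  pt_get (lcode (lst b)) (conj_table gl rs) = Some n -> num_fixed b = nat_of_bin n.
Proof.
move=> hg; rewrite /conj_table; elim: rs => [//|r rs IH] hr /=.
have {}IH := IH (fun r' h => hr r' (or_intror h)).
have [a ra fa] := hr r (or_introl erefl).
move: (foldr _ _ rs) IH => t IH; rewrite ra.
elim: gl hg => [|l gl IHg] hg /=; first exact: IH.
have [c cB ->] := hg _ (mem_head _ _); rewrite pt_get_upd inverse_lst !compo_lst.
case: pos_eqP => [/lcode_inj -> [<-]|_]; last first.
  by apply: IHg => l' l'g; apply: hg; rewrite inE l'g orbT.
by rewrite -fa -{2}[c]invgK fixn_conj ?groupV.
Qed.

Lemma conj_sum_ok t bs n : (forall b m, pt_get (lcode (lst b)) t = Some m ->
  num_fixed b = nat_of_bin m) ->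
  conj_sum t (map lst bs) = Some n -> nat_of_bin n = \sum_(b <- bs) num_fixed b.
Proof.
move=> ht; rewrite /conj_sum; elim: bs n => [|b bs IH] n /=; first by move=> [<-]; rewrite big_nil.
case: (foldr _ _ _) IH => // a IH; case gE: (pt_get _ _) => [m|//] [<-].
by rewrite nat_of_binD big_cons (ht _ _ gE) (IH a).
Qed.

Lemma group_lst : uniq gs -> exists2 bs, gs = map lst bs & perm_eq bs (enum cubeB).
Proof.
move=> ug; pose g l := odflt 1%g [pick b : {perm I} | (b \in cubeB) && (lst b == l)].
have gE : gs = map lst (map g gs).
  rewrite -map_comp -[LHS]map_id; apply/eq_in_map => l /gsP[b bB ->]; rewrite /= /g.
  case: (@fintype.pickP _ (fun c : {perm I} => (c \in cubeB) && (lst c == lst b))) => [c|/(_ b)].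
    by move=> /andP[_ /eqP].
  by rewrite bB eqxx.
move: (map g gs) gE => bs gE.
exists bs => //; apply: uniq_perm; rewrite ?enum_uniq //.
  by move: ug; rewrite gE => /map_uniq.
move=> b; rewrite mem_enum -(mem_map lst_inj) -gE.
by apply/gsP/idP => [[c cB /lst_inj ->]|bB]; last exists b.
Qed.

Hypothesis g_ok : checked (group_ok gs).
Hypothesis r_ok : checked (run_ok ss gs).

Lemma all_In (T : Type) (a : pred T) l : all a l -> forall x, List.In x l -> a x.
Proof. by elim: l => //= y l IH /andP[ay /IH{}IH] x [<-|/IH]. Qed.

Lemma nested_if (a b c : bool) : (if a then if b then c else false else false) -> [/\ a, b & c].
Proof. by case: a b => [] []. Qed.

Lemma reps_ok r : List.In r reps ->
  exists c n, [/\ c \in cubeB, r.1 = lst c, n = r.2 & num_fixed c = nat_of_bin n].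
Proof.
case: r_ok => /all_In H rin; have := H r rin; clear H rin.
rewrite /rep_ok => /nested_if[so /gsP[c cB e]].
rewrite {}e in so *; have fc n := fixcount_correct (n := n) cB so.
move: (fixcount _ _ _) fc => [n|] fc; last by [].
by move=> /N.eqb_eq e2; exists c, n; split; [exact: cB| |exact: e2|exact: fc].
Qed.

(** The large number is kept in binary behind an equation, so that it is never unfolded as a unary
    natural number. *)
Lemma sum_fixn : exists n, [/\ n = 95021184%num, \sum_(b in cubeB) num_fixed b = nat_of_bin n
  & #|cubeB| = 384].
Proof.
case: g_ok; rewrite /group_ok => /nested_if[/group_lst[bs gE pe] /eqnP s384].
have tok := @conj_table_ok gs reps; have sok := @conj_sum_ok (conj_table gs reps) bs.
move: sok; rewrite -gE; move: (conj_sum _ _) => [n|] sok; last discriminate.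
move=> /N.eqb_eq n_eq; exists n; split=> //; last by rewrite cardE -(perm_size pe) -s384 gE size_map.
rewrite -big_enum /= -(perm_big _ pe) /=; apply/esym/sok => // b m.
apply: tok => [l /gsP //|r /reps_ok[c [n' [_ e1 <- e2]]]].
by exists c.
Qed.

Lemma fixn1 : exists2 n, n = 92487256%num & num_fixed 1%g = nat_of_bin n.
Proof.
have [c [n [_ e en fn]]] := reps_ok (r := (idl, 92487256%num)) (or_introl erefl).
exists n; [exact: en|rewrite -fn].
by congr (#|invariant_triangs R (pre _)|); apply: lst_inj; rewrite -e lst1.
Qed.

End Burnside.

Local Open Scope ring_scope.

Lemma card_image_finset (X : finType) (U : pointedType) (A : {set X}) (f : X -> U) (B : set U) :
  {in A &, injective f} -> B = (f @` [set` A])%classic -> (B #= `I_#|A|)%card.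
Proof.
move=> f_inj ->; rewrite card_eq_sym; apply/card_set_bijP.
have sA : size (enum A) = #|A| by rewrite cardE.
have [A0|[a0 _]] := set_0Vmem A.
  exists (fun=> point); rewrite A0 cards0; split=> [k //|k l|y [x]]; first by rewrite inE.
  by rewrite /= inE.
have memA k : (k < #|A|)%N -> nth a0 (enum A) k \in A.
  by move=> kA; rewrite -mem_enum mem_nth ?sA.
exists (fun k => f (nth a0 (enum A) k)); split.
- by move=> k /= kA; exists (nth a0 (enum A) k) => //; exact: memA.
- move=> k l /set_mem kA /set_mem lA /(f_inj _ _ (memA _ kA) (memA _ lA))/eqP.
  by rewrite nth_uniq ?sA ?enum_uniq // => /eqP.
- move=> _ [x /= xA <-]; exists (index x (enum A)); rewrite /= ?nth_index ?mem_enum //.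
  by rewrite -sA index_mem mem_enum.
Qed.

(** * Isometries and orbits *)

Section Isometries.
Variable R : realType.
Local Notation pt := (@pt R).
Local Notation cube := (@cube R 4).
Local Notation dist := (@euclidean_dist R 4).
Implicit Types (i j : I) (b : {perm I}).

Lemma dist_pt i j : dist (pt i) (pt j) = Num.sqrt (hd i j)%:R.
Proof.
rewrite /euclidean_dist natr_sum; congr Num.sqrt; apply: eq_bigr => k _.
by rewrite !pt_coord; case: (vtx i k) (vtx j k) => [] [];
  rewrite /= ?subrr ?subr0 ?sub0r ?expr0n ?sqrrN ?expr1n.
Qed.

Lemma sqrt_nat_inj (m n : nat) : Num.sqrt m%:R = Num.sqrt n%:R :> R -> m = n.
Proof.
move=> /(congr1 (fun x => x ^+ 2)); rewrite !sqr_sqrtr ?ler0n // => /eqP.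
by rewrite eqr_nat => /eqP.
Qed.

Lemma pt_cube i : cube (pt i).
Proof. by move=> k; rewrite pt_coord; case: (vtx i k); rewrite /= ?lexx ?ler01. Qed.

Lemma unit_diff (x y : R) : 0 <= x <= 1 -> 0 <= y <= 1 ->
  (x - y) ^+ 2 <= 1 ?= iff ((x - y) ^+ 2 == 1).
Proof. by move=> /andP[x0 x1] /andP[y0 y1]; split=> //; nra. Qed.

Lemma unit_diff_vertex (x y : R) : 0 <= x <= 1 -> 0 <= y <= 1 -> (x - y) ^+ 2 = 1 ->
  x = 0 \/ x = 1.
Proof.
move=> /andP[x0 x1] /andP[y0 y1] /eqP; rewrite -[1 in X in X -> _](expr1n _ 2) eqf_sqr.
by move=> /orP[] /eqP e; [right|left]; lra.
Qed.

(** A vertex and its antipode are at distance 2. Two points of the cube attain this only if every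
    coordinate differs by 1, which forces both to be vertices. *)
Lemma isometry_vertex (g : 'rV[R]_4 -> 'rV[R]_4) i : cube_isometry g -> exists j, g (pt i) = pt j.
Proof.
move=> [gd gc]; pose i' := vof (fun k => ~~ vtx i k).
have gcube j : cube (g (pt j)) by rewrite -gc; exists (pt j) => //; exact: pt_cube.
have hd4 : hd i i' = 4.
  rewrite /hd (eq_bigr (fun=> 1%N)) => [|k _]; first by rewrite sum_nat_const card_ord.
  by rewrite vtx_vof; case: (vtx i k).
set x := g (pt i); set y := g (pt i').
have d4 : \sum_k (x 0 k - y 0 k) ^+ 2 = \sum_(k < 4) (1 : R).
  have := gd (pt i) (pt i'); rewrite dist_pt hd4 => /(congr1 (fun x => x ^+ 2)).
  rewrite !sqr_sqrtr ?ler0n ?sumr_ge0 // => [->|k _]; last exact: sqr_ge0.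
  by rewrite sumr_const card_ord.
have d1 k : (x 0 k - y 0 k) ^+ 2 = 1.
  have := leif_sum (fun k (_ : true) => unit_diff (gcube i k) (gcube i' k)).
  rewrite -/x -/y => -[_]; rewrite d4 eqxx => /esym/forallP/(_ k) /=.
  by move/eqP.
have : cube_vertices x by move=> k; exact: unit_diff_vertex (gcube i k) (gcube i' k) (d1 k).
by rewrite -range_pt => -[j _ <-]; exists j.
Qed.

Lemma isometry_perm (g : 'rV[R]_4 -> 'rV[R]_4) : cube_isometry g ->
  exists2 b, b \in cubeB & forall i, g (pt i) = pt (b i).
Proof.
move=> ig; have [gd _] := ig.
have [b bE] := @choice _ _ (fun i j => g (pt i) = pt j) (fun i => isometry_vertex i ig).
have bd i j : hd (b i) (b j) = hd i j by apply: sqrt_nat_inj; rewrite -!dist_pt -!bE.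
have b_inj : injective b by move=> i j e; apply: hd_eq0; rewrite -bd e hdii.
exists (perm b_inj) => [|i]; last by rewrite permE.
by apply/cubeBP => i j; rewrite !permE.
Qed.

Lemma amap_isometry (s : {perm 'I_4}) (t : 'I_4 -> bool) : cube_isometry (amap (R := R) s t).
Proof.
split=> [x y|].
  rewrite /euclidean_dist; congr Num.sqrt; rewrite [RHS](reindex_inj (@perm_inj _ s)).
  apply: eq_bigr => k _; rewrite !mxE; case: (t k) => //.
  by ring.
apply/seteqP; split=> [_ [x cx <-] k|y cy].
  rewrite mxE; have := cx (s k); case: (t k) => // /andP[x0 x1].
  by rewrite subr_ge0 x1 lerBlDr lerDl.
exists (\row_l (if t ((s^-1)%g l) then 1 - y 0 ((s^-1)%g l) else y 0 ((s^-1)%g l))).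
  move=> l; rewrite mxE; have := cy ((s^-1)%g l); case: (t _) => // /andP[y0 y1].
  by rewrite subr_ge0 y1 lerBlDr lerDl.
apply/rowP => k; rewrite !mxE permK; case: (t k) => //.
by rewrite opprB addrC subrK.
Qed.

End Isometries.

Local Close Scope ring_scope.

(** * Triangulations and symmetry classes as group orbits *)

Section Orbits.
Variable R : realType.
Local Notation pt := (@pt R).
Local Notation V := 'rV[R]_4.
Implicit Types (F G : {set I}) (S : {set {set I}}) (b c : {perm I}).

Hypothesis f_ok : checked facets_ok.
Hypothesis s_ok : checked (all simplex_ok all_simplices).
Hypothesis c_ok : checked (has (fun s => s_nd s && s_cov s) all_simplices).

Definition set_action : {action {perm I} &-> {set {set I}}} := (('P : {action {perm I} &-> I})^*^*)%act.

Lemma imset_pre b F : [set b i | i in F]%SET = pre b^-1%g F.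
Proof.
apply/setP => i; rewrite inE; apply/imsetP/idP => [[j jF ->]|iF]; first by rewrite permK.
by exists (b^-1%g i); rewrite ?permKV.
Qed.

Lemma set_actionE S b : set_action S b = [set pre b^-1%g F | F in S]%SET.
Proof.
rewrite /set_action /= /setact; apply: eq_imset => F; rewrite -imset_pre.
by apply: eq_imset.
Qed.

Definition cube_triangs : {set {set {set I}}} := [set S : {set {set I}} | `[< cube_triang R S >]]%SET.

Lemma mem_cube_triangs S : reflect (cube_triang R S) (S \in cube_triangs).
Proof. by rewrite inE; exact: asboolP. Qed.

Lemma preVK b F : pre b^-1%g (pre b F) = F.
Proof. by apply/setP => i; rewrite !inE permKV. Qed.

Lemma fixed_E b : 'Fix_(cube_triangs | set_action)[b]%g = invariant_triangs R (pre b).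
Proof.
apply/setP => S; rewrite inE; apply/andP/invariant_triangsP =>
  [[/mem_cube_triangs tS /afix1P e]|[tS iS]]; split=> //.
- by move=> G; have := mem_imset S (pre b G) (@pre_inj b^-1%g); rewrite -set_actionE e preVK.
- exact/mem_cube_triangs.
- apply/afix1P; rewrite set_actionE; apply/setP => G.
  have := mem_imset S (pre b G) (@pre_inj b^-1%g).
  by rewrite preVK iS.
Qed.

Lemma acts_cube_triangs : [acts cubeB, on cube_triangs | set_action]%g.
Proof.
apply/actsP => b bB S; apply/mem_cube_triangs/mem_cube_triangs; last first.
  by rewrite set_actionE; apply: cubeB_cube_triang => //; rewrite groupV.
move=> H; have -> : S = set_action (set_action S b) b^-1%g by rewrite -actM mulgV act1.
by rewrite set_actionE invgK; exact: cubeB_cube_triang.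
Qed.

Definition orbits : {set {set {set {set I}}}} := [set orbit set_action cubeB S | S in cube_triangs]%SET.

Lemma card_orbits : (#|orbits| * #|cubeB| = \sum_(b in cubeB) num_fixed R b)%N.
Proof.
rewrite -(@Frobenius_Cauchy _ _ _ set_action cubeB_is_group cube_triangs acts_cube_triangs).
by apply: eq_bigr => b _; rewrite fixed_E.
Qed.

Lemma fixn1_cube_triangs : num_fixed R 1%g = #|cube_triangs|.
Proof.
rewrite /num_fixed -fixed_E afix1 finset.setIT //.
Qed.

Lemma fset_vset (g : V -> V) b F : (forall i, g (pt i) = pt (b i)) ->
  [fset g v | v in vset pt F]%fset = vset pt [set b i | i in F]%SET.
Proof.
move=> gE; apply/fsetP => x; apply/imfsetP/imfsetP =>
  [[v /imfsetP[i /= iF ->] ->]|[j /= /imsetP[i iF ->] ->]].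
  by exists (b i); rewrite ?gE //=; exact: imset_f.
by exists (pt i); rewrite ?gE //; apply/imfsetP; exists i.
Qed.

Local Open Scope classical_set_scope.

Lemma move_toT (g : V -> V) b S : (forall i, g (pt i) = pt (b i)) ->
  move_triangulation g (toT pt S) = toT pt (set_action S b).
Proof.
move=> gE; apply/seteqP; split=> [_ [_ [F [G GS FG] <-] <-]|_ [F [G' + FG] <-]].
  rewrite (fset_vset _ gE); exists [set b i | i in F]%SET => //.
  exists [set b i | i in G]%SET; last exact: imsetS.
  by rewrite set_actionE imset_pre imset_f.
rewrite set_actionE => /imsetP[G GS e]; rewrite {}e in FG.
exists (vset pt (pre b F)).
  exists (pre b F) => //; exists G => //; apply/fintype.subsetP => i.
  rewrite inE => /(fintype.subsetP FG); by rewrite inE permK.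
by rewrite (fset_vset _ gE) imset_pre preVK.
Qed.

Lemma symmetry_class_orbit S :
  symmetry_class (toT pt S) = toT pt @` [set` orbit set_action cubeB S].
Proof.
apply/seteqP; split=> [_ [g ig <-]|_ [_ /orbitP[b bB <-] <-]].
  have [b bB gE] := isometry_perm ig; exists (set_action S b); last by rewrite (move_toT _ gE).
  exact: mem_orbit.
have [s [t bs]] := cubeB_signed bB; exists (amap s t); first exact: amap_isometry.
by apply: move_toT => i; exact: amap_pt bs i.
Qed.

Lemma cube_triangulationsE : cube_triangulations R 4 = toT pt @` [set` cube_triangs].
Proof.
have [G0 nG0 _] := nondeg_ex R s_ok c_ok.
apply/seteqP; split=> [T|_ [S /mem_cube_triangs tS <-]]; last first.
  rewrite /cube_triangulations /= -range_pt.
  exact: (triang_triangulation (@h_facet R f_ok) (@pt_inj R) (pp_generic s_ok)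
    (pp_in R f_ok s_ok c_ok) tS).
rewrite /cube_triangulations /= -range_pt => tT.
have [S tS ->] := triangulation_triang (@h_facet R f_ok) (@pt_inj R) (@pt_extreme R)
  (@aindep_nondeg R s_ok) (pp_generic s_ok) (pp_in R f_ok s_ok c_ok) nG0 isT tT.
by exists S => //; exact/mem_cube_triangs.
Qed.

Lemma symmetry_classesE :
  symmetry_classes R 4 = (fun O : {set {set {set I}}} => toT pt @` [set` O]) @` [set` orbits].
Proof.
rewrite /symmetry_classes cube_triangulationsE image_comp.
apply/seteqP; split=> [_ [S St <-]|_ [_ /imsetP[S St ->] <-]].
  by exists (orbit set_action cubeB S); [exact: imset_f|rewrite /= symmetry_class_orbit].
by exists S => //=; rewrite symmetry_class_orbit.
Qed.

Lemma cube_triangs_toT_inj : {in cube_triangs &, injective (toT pt)}.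
Proof.
move=> S S' /mem_cube_triangs tS /mem_cube_triangs tS'; exact: (toT_inj (@pt_inj R) tS tS').
Qed.

Lemma orbits_inj : {in orbits &, injective (fun O : {set {set {set I}}} => toT pt @` [set` O])}.
Proof.
have sub O S : O \in orbits -> S \in O -> S \in cube_triangs.
  by case/imsetP => S0 S0t -> /orbitP[b bB <-]; rewrite (actsP acts_cube_triangs).
move=> O O' Oo Oo' e; apply/setP => S; apply/idP/idP => SO.
  have : (toT pt @` [set` O]) (toT pt S) by exists S.
  rewrite e => -[S' S'O' /cube_triangs_toT_inj <- //]; first exact: sub S'O'.
  exact: sub SO.
have : (toT pt @` [set` O']) (toT pt S) by exists S.
rewrite -e => -[S' S'O' /cube_triangs_toT_inj <- //]; first exact: sub S'O'.
exact: sub SO.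
Qed.

Lemma cube_triangulations_card : (cube_triangulations R 4 #= `I_#|cube_triangs|)%card.
Proof. exact: card_image_finset cube_triangs_toT_inj cube_triangulationsE. Qed.

Lemma symmetry_classes_card : (symmetry_classes R 4 #= `I_#|orbits|)%card.
Proof. exact: card_image_finset orbits_inj symmetry_classesE. Qed.

End Orbits.

(** * Evaluation of the checks and the final numbers *)

Lemma facets_checked : checked facets_ok.
Proof. by constructor; vm_cast_no_check (erefl true). Qed.

Lemma simplices_checked : checked (simplices_ok all_simplices).
Proof. by constructor; vm_cast_no_check (erefl true). Qed.

Lemma group_checked : checked (group_ok cube_perms).
Proof. by constructor; vm_cast_no_check (erefl true). Qed.

Lemma run_checked : checked (run_ok (nondeg_simplices all_simplices) cube_perms).
Proof. by constructor; vm_cast_no_check (erefl true). Qed.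

Lemma checked_simplices_ok ss : checked (simplices_ok ss) ->
  checked (all simplex_ok ss) /\ checked (has (fun s => s_nd s && s_cov s) ss).
Proof.
by case; rewrite /simplices_ok; case: ifP => // h1 h2; split; constructor.
Qed.

(** Cancels the order of the group while the large numbers stay in binary. *)
Lemma cancel_384 (k : nat) (a b : N) : nat_of_bin a = 384 ->
  k * 384 = nat_of_bin (N.mul a b) -> k = nat_of_bin b.
Proof.
move=> a384; have -> : nat_of_bin (N.mul a b) = 384 * b.
  by rewrite -a384; case: a b {a384} => [|p] [|q] //=; rewrite ?muln0 // nat_of_mul_pos.
by rewrite mulnC => /eqP; rewrite eqn_pmul2l // => /eqP.
Qed.

Local Open Scope classical_set_scope.
Local Open Scope card_scope.

Theorem corollary3 (R : realType) :
  cube_triangulations R 4 #= `I_(nat_of_bin 92487256) /\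
  symmetry_classes R 4 #= `I_(nat_of_bin 247451).
Proof.
have [s_ok c_ok] := checked_simplices_ok simplices_checked.
have f_ok := facets_checked.
have ssE := nondeg_simplicesE R.
split.
  have := cube_triangulations_card R f_ok s_ok c_ok.
  have [n <-] := fixn1 f_ok s_ok c_ok groupP ssE run_checked.
  by rewrite fixn1_cube_triangs => ->.
have := symmetry_classes_card R f_ok s_ok c_ok.
have [m [me msum B384]] := sum_fixn f_ok s_ok c_ok groupP ssE group_checked run_checked.
have := card_orbits R f_ok s_ok c_ok; rewrite msum B384.
have -> : m = N.mul 384%num 247451%num by rewrite me.
by move=> /(cancel_384 (erefl : nat_of_bin 384 = 384%N)) ->.
Qed.
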